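(* For a multi-faced positive symmetric universal product $\odot$ with highest coefficients $(\alpha_\pi)_{\pi\in\mathcal P}$, the following are equivalent: (1) $\odot$ is unit preserving; (2) for every $\mathsf Q\in\mathcal F$, $\nu_{\mathsf Q}=1$, where $\nu_{\mathsf Q}$ is the highest coefficient of the partition $\{\{1,3\},\{2\}\}\in\mathcal P(\mathbf f)$ with $\mathbf f\in\mathcal F^3$, $\mathbf f(2)=\mathsf Q$ (the faces $\mathbf f(1),\mathbf f(3)$ being arbitrary); (3) the highest coefficients of $\odot$ are singleton inductive.
   Context: Algebras are complex associative, not necessarily unital; $\sqcup$ is the free product. Fix a finite set $\mathcal F$ of faces. A multi-faced algebra is an algebra $A$ with subalgebras $A^{\mathsf Q}$ such that $\bigsqcup_{\mathsf Q}A^{\mathsf Q}\to A$ is an isomorphism; multi-faced homomorphisms preserve faces; $A_1\sqcup A_2$ has faces $A_1^{\mathsf Q}\sqcup A_2^{\mathsf Q}$. Multi-faced $*$-algebras have an involution with $*$-invariant faces; a restricted state is a linear functional whose unital extension to the unitization is positive. A multi-faced universal product assigns to linear functionals $\varphi_i$ on multi-faced algebras $A_i$ a functional $\varphi_1\odot\varphi_2$ on $A_1\sqcup A_2$ that is universal ($(\varphi_1\circ h_1)\odot(\varphi_2\circ h_2)=(\varphi_1\odot\varphi_2)\circ(h_1\sqcup h_2)$ for multi-faced homomorphisms), associative, and satisfies $(\varphi_1\odot\varphi_2)|_{A_i}=\varphi_i$; symmetric: $\varphi_1\odot\varphi_2=\varphi_2\odot\varphi_1$; positive: products of restricted states are restricted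 states. Highest coefficients: by the Manzel–Schürmann structure theorem, for a positive universal product there are unique $\alpha_{\mathbf s}$ such that for $\mathbf s=\mathbf b\times\mathbf f\in([k]\times\mathcal F)^n$, functionals $\varphi_\kappa$ on $A_\kappa$, and $a=a_1\cdots a_n$ with $a_\ell\in A^{\mathbf f(\ell)}_{\mathbf b(\ell)}$, $\frac{\partial^k}{\partial t_1\cdots\partial t_k}((t_1\varphi_1)\odot\cdots\odot(t_k\varphi_k))(a)|_{t=0}=\alpha_{\mathbf s}\prod_\kappa\varphi_\kappa(\overrightarrow\prod_{\mathbf b(\ell)=\kappa}a_\ell)$ (ordered products). For symmetric $\odot$, $\alpha_{\mathbf s}$ depends only on the partition $\pi\in\mathcal P(\mathbf f)$ with blocks $\mathbf b^{-1}(\kappa)$, and is written $\alpha_\pi$. Here $\mathcal P(\mathbf f)$, $\mathbf f\in\mathcal F^n$, is the set of set partitions of $[n]$ whose elements $\ell$ carry face $\mathbf f(\ell)$, $\mathcal P=\bigcup_{\mathbf f}\mathcal P(\mathbf f)$, and partitions of subsets of $[n]$ are identified with elements of $\mathcal P$ via the order-preserving bijection. Weights are singleton inductive if $\alpha_\pi=\alpha_{\pi\setminus\{s\}}$ for every singleton block $\{s\}\in\pi$, $\pi\setminus\{s\}$ being the induced partition of $[n]\setminus\{s\}$. Unit preserving: whenever $A_1,A_2$ are multi-faced algebras with every face $A_i^{\mathsf Q}$ unital (unit $1_i^{\mathsf Q}$) and $\varphi_i$ is a linear functional on $A_i$ vanishing on the ideal generated by $\{1_i^{\mathsf q}-1_i^{\mathsf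 Q}:\mathsf q,\mathsf Q\in\mathcal F\}$ with $\varphi_i(1_i^{\mathsf Q})=1$ for all $\mathsf Q$, then $\varphi_1\odot\varphi_2$ vanishes on the ideal of $A_1\sqcup A_2$ generated by $\{1_i^{\mathsf q}-1_j^{\mathsf Q}:i,j\in[2],\mathsf q,\mathsf Q\in\mathcal F\}$ and $(\varphi_1\odot\varphi_2)(1_i^{\mathsf Q})=1$ for all $i,\mathsf Q$. *)

(* Defs.v *)
(* Complex numbers: C := R[i] with R the Stdlib reals (a realType via Rstruct). *)
From HB Require Import structures.
From mathcomp Require Import all_boot all_algebra complex.
From mathcomp Require Import boolp reals Rstruct topology normedtype derive.
Import GRing.Theory Num.Theory numFieldNormedType.Exports.

Set Implicit Arguments.
Unset Strict Implicit.
Unset Printing Implicit Defensive.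

Local Open Scope ring_scope.

(* The field of complex numbers.                                             *)
Definition C : numClosedFieldType := Rdefinitions.R[i].
Definition CN : numFieldType := C.

(* (Not necessarily unital) complex associative algebras.                    *)
(* An [alg] is the raw data; [is_alg] are the axioms.                        *)
Record alg := Alg {
  acar :> Type;
  azero : acar;
  aadd : acar -> acar -> acar;
  ascale : C -> acar -> acar;
  amul : acar -> acar -> acar }.

Arguments azero {a}.

Record is_alg (A : alg) : Prop := IsAlg {
  alg_addA : forall x y z : A, aadd x (aadd y z) = aadd (aadd x y) z;
  alg_addC : forall x y : A, aadd x y = aadd y x;
  alg_add0 : forall x : A, aadd azero x = x;
  alg_addN : forall x : A, aadd x (ascale (-1) x) = azero;
  alg_scale1 : forall x : A, ascale 1 x = x;
  alg_scaleA : forall (a b : C) (x : A), ascale a (ascale b x) = ascale (a * b) x;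
  alg_scaleDl : forall (a b : C) (x : A), ascale (a + b) x = aadd (ascale a x) (ascale b x);
  alg_scaleDr : forall (a : C) (x y : A), ascale a (aadd x y) = aadd (ascale a x) (ascale a y);
  alg_mulA : forall x y z : A, amul x (amul y z) = amul (amul x y) z;
  alg_mulDl : forall x y z : A, amul (aadd x y) z = aadd (amul x z) (amul y z);
  alg_mulDr : forall x y z : A, amul x (aadd y z) = aadd (amul x y) (amul x z);
  alg_mulZl : forall (a : C) (x y : A), ascale a (amul x y) = amul (ascale a x) y;
  alg_mulZr : forall (a : C) (x y : A), ascale a (amul x y) = amul x (ascale a y) }.

Definition asub (A : alg) (x y : A) : A := aadd x (ascale (-1) y).

(* linear functionals, homomorphisms, subalgebras, ideals *)
Definition lin (A : alg) (phi : A -> C) : Prop :=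
  (forall x y, phi (aadd x y) = phi x + phi y) /\
  (forall c x, phi (ascale c x) = c * phi x).

Definition is_hom (A B : alg) (h : A -> B) : Prop :=
  [/\ forall x y, h (aadd x y) = aadd (h x) (h y),
      forall c x, h (ascale c x) = ascale c (h x) &
      forall x y, h (amul x y) = amul (h x) (h y)].

Definition is_subalg (A : alg) (P : A -> Prop) : Prop :=
  [/\ P azero, forall x y, P x -> P y -> P (aadd x y),
      forall c x, P x -> P (ascale c x) &
      forall x y, P x -> P y -> P (amul x y)].

Definition is_ideal (A : alg) (J : A -> Prop) : Prop :=
  [/\ J azero, forall x y, J x -> J y -> J (aadd x y),
      forall c x, J x -> J (ascale c x),
      forall x y, J y -> J (amul x y) &
      forall x y, J x -> J (amul x y)].

(* the two-sided ideal generated by a set G *)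
Definition ideal_gen (A : alg) (G : A -> Prop) (z : A) : Prop :=
  forall J, is_ideal J -> (forall g, G g -> J g) -> J z.

(* ordered product of a nonempty list *)
Definition lprod (A : alg) (s : seq A) : A :=
  match s with [::] => azero | y :: s' => foldl (@amul A) y s' end.

(* Free product of a family of subalgebras S i of algebras A i, i : I,      *)
(* given by generators and relations: terms over the disjoint union of the  *)
(* S i, modulo the congruence generated by the axioms of (non-unital)       *)
(* complex algebras and the operations of each S i.                         *)
Unset Implicit Arguments.
Section FreeProduct.
Variables (I : Type) (A : I -> alg) (S : forall i, A i -> Prop).

Definition gen_t := {i : I & {x : A i | S i x}}.

Inductive term : Type :=
| tgen of gen_t
| tzero
| tadd of term & term
| tscale of C & term
| tmul of term & term.

Inductive fpeq : term -> term -> Prop :=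
| fe_refl t : fpeq t t
| fe_sym s t : fpeq s t -> fpeq t s
| fe_trans s t u : fpeq s t -> fpeq t u -> fpeq s u
| fe_add s s' t t' : fpeq s s' -> fpeq t t' -> fpeq (tadd s t) (tadd s' t')
| fe_scale c t t' : fpeq t t' -> fpeq (tscale c t) (tscale c t')
| fe_mul s s' t t' : fpeq s s' -> fpeq t t' -> fpeq (tmul s t) (tmul s' t')
| fe_addA x y z : fpeq (tadd x (tadd y z)) (tadd (tadd x y) z)
| fe_addC x y : fpeq (tadd x y) (tadd y x)
| fe_add0 x : fpeq (tadd tzero x) x
| fe_addN x : fpeq (tadd x (tscale (-1) x)) tzero
| fe_scale1 x : fpeq (tscale 1 x) x
| fe_scaleA a b x : fpeq (tscale a (tscale b x)) (tscale (a * b) x)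
| fe_scaleDl a b x : fpeq (tscale (a + b) x) (tadd (tscale a x) (tscale b x))
| fe_scaleDr a x y : fpeq (tscale a (tadd x y)) (tadd (tscale a x) (tscale a y))
| fe_mulA x y z : fpeq (tmul x (tmul y z)) (tmul (tmul x y) z)
| fe_mulDl x y z : fpeq (tmul (tadd x y) z) (tadd (tmul x z) (tmul y z))
| fe_mulDr x y z : fpeq (tmul x (tadd y z)) (tadd (tmul x y) (tmul x z))
| fe_mulZl a x y : fpeq (tscale a (tmul x y)) (tmul (tscale a x) y)
| fe_mulZr a x y : fpeq (tscale a (tmul x y)) (tmul x (tscale a y))
| fe_gen_eq i (x y : {x : A i | S i x}) :
    sval x = sval y -> fpeq (tgen (existT _ i x)) (tgen (existT _ i y))
| fe_gen_add i (x y z : {x : A i | S i x}) :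
    sval z = aadd (sval x) (sval y) ->
    fpeq (tgen (existT _ i z)) (tadd (tgen (existT _ i x)) (tgen (existT _ i y)))
| fe_gen_scale i c (x z : {x : A i | S i x}) :
    sval z = ascale c (sval x) ->
    fpeq (tgen (existT _ i z)) (tscale c (tgen (existT _ i x)))
| fe_gen_mul i (x y z : {x : A i | S i x}) :
    sval z = amul (sval x) (sval y) ->
    fpeq (tgen (existT _ i z)) (tmul (tgen (existT _ i x)) (tgen (existT _ i y))).

(* the quotient (classes of terms) *)
Definition fpcar : Type := {P : term -> Prop | exists t, P = fpeq t}.
Definition fpcls (t : term) : fpcar := exist _ (fpeq t) (ex_intro _ t erefl).
Definition fprep (q : fpcar) : term := projT1 (cid (proj2_sig q)).

Definition fpalg : alg := @Alg fpcar (fpcls tzero)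
  (fun p q => fpcls (tadd (fprep p) (fprep q)))
  (fun c q => fpcls (tscale c (fprep q)))
  (fun p q => fpcls (tmul (fprep p) (fprep q))).

(* all generators of a term satisfy P *)
Fixpoint tgens_in (P : gen_t -> Prop) (t : term) : Prop :=
  match t with
  | tgen g => P g
  | tzero => True
  | tadd s u => tgens_in P s /\ tgens_in P u
  | tscale _ u => tgens_in P u
  | tmul s u => tgens_in P s /\ tgens_in P u
  end.

(* evaluation of terms in an algebra, and the induced map on the quotient *)
Fixpoint evalt (B : alg) (f : gen_t -> B) (t : term) : B :=
  match t with
  | tgen g => f g
  | tzero => azero
  | tadd s u => aadd (evalt B f s) (evalt B f u)
  | tscale c u => ascale c (evalt B f u)
  | tmul s u => amul (evalt B f s) (evalt B f u)
  end.

Definition fplift (B : alg) (f : gen_t -> B) (q : fpcar) : B := evalt B f (fprep q).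

(* involution on terms induced by a map on generators *)
Fixpoint tstar (sg : gen_t -> gen_t) (t : term) : term :=
  match t with
  | tgen g => tgen (sg g)
  | tzero => tzero
  | tadd s u => tadd (tstar sg s) (tstar sg u)
  | tscale c u => tscale (c^*) (tstar sg u)
  | tmul s u => tmul (tstar sg u) (tstar sg s)
  end.

End FreeProduct.
Set Implicit Arguments.
Arguments tgen {I A S}.
Arguments fpalg {I A} S.
Arguments gen_t {I A} S.
Arguments tzero {I A S}.
Arguments fpcls {I A S}.
Arguments fprep {I A S}.
Arguments fplift {I A S B}.
Arguments tstar {I A S}.
Arguments tgens_in {I A S}.

(* Multi-faced algebras over the set of faces F.                            *)
Record mfalg (F : Type) := MFAlg {
  mcar : alg;
  face : F -> mcar -> Prop }.
Arguments mcar {F} m.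
Arguments face {F} m Q x.

(* A with subalgebras A^Q such that the canonical map from the free product *)
(* of the faces to A is an isomorphism.                                     *)
Definition valid_mf (F : Type) (A : mfalg F) : Prop :=
  [/\ is_alg (mcar A), forall Q, is_subalg (face A Q) &
      bijective (@fplift F (fun _ => mcar A) (face A) (mcar A)
                   (fun g => sval (projT2 g)))].

Definition mfhom (F : Type) (A B : mfalg F) (h : mcar A -> mcar B) : Prop :=
  is_hom h /\ forall Q x, face A Q x -> face B Q (h x).

Definition truep (I : Type) (A : I -> alg) : forall i, A i -> Prop := fun _ _ => True.
Arguments truep {I} A i x.

(* free product of a family of multi-faced algebras; its face Q is the      *)
(* subalgebra generated by the faces Q of the factors                       *)
Definition FPm (F I : Type) (A : I -> mfalg F) : mfalg F :=
  @MFAlg F (fpalg (truep (fun i => mcar (A i))))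
    (fun Q z => exists t, z = fpcls t /\
       tgens_in (fun g => face (A (projT1 g)) Q (sval (projT2 g))) t).

Definition fembed (F I : Type) (A : I -> mfalg F) (i : I) (x : mcar (A i)) :
  mcar (FPm A) :=
  fpcls (tgen (existT (fun i => {x : mcar (A i) | truep (fun i => mcar (A i)) i x}) i
                      (exist _ x Logic.I))).

(* binary free product A1 ⊔ A2 *)
Definition fam2 (F : Type) (A1 A2 : mfalg F) : bool -> mfalg F :=
  fun b => if b then A1 else A2.

Definition fprod (F : Type) (A1 A2 : mfalg F) : mfalg F := FPm (fam2 A1 A2).

Definition inj1 (F : Type) (A1 A2 : mfalg F) (x : mcar A1) : mcar (fprod A1 A2) :=
  @fembed F bool (fam2 A1 A2) true x.
Definition inj2 (F : Type) (A1 A2 : mfalg F) (x : mcar A2) : mcar (fprod A1 A2) :=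
  @fembed F bool (fam2 A1 A2) false x.
Arguments inj1 {F} A1 A2 x.
Arguments inj2 {F} A1 A2 x.

(* the homomorphism A1 ⊔ A2 -> B induced by f1 : A1 -> B and f2 : A2 -> B *)
Definition fcopair (F : Type) (A1 A2 : mfalg F) (B : alg)
  (f1 : mcar A1 -> B) (f2 : mcar A2 -> B) : mcar (fprod A1 A2) -> B :=
  @fplift bool (fun b => mcar (fam2 A1 A2 b)) (truep _) B
    (fun g => let (b, y) := g in
       match b return {x : mcar (fam2 A1 A2 b) | truep _ b x} -> B with
       | true => fun y => f1 (sval y)
       | false => fun y => f2 (sval y)
       end y).

(* h1 ⊔ h2 *)
Definition map2 (F : Type) (B1 B2 A1 A2 : mfalg F)
  (h1 : mcar B1 -> mcar A1) (h2 : mcar B2 -> mcar A2) :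
  mcar (fprod B1 B2) -> mcar (fprod A1 A2) :=
  fcopair (fun x => inj1 A1 A2 (h1 x)) (fun x => inj2 A1 A2 (h2 x)).

(* canonical isomorphisms A1 ⊔ A2 -> A2 ⊔ A1 and (A1 ⊔ A2) ⊔ A3 -> A1 ⊔ (A2 ⊔ A3) *)
Definition fswap (F : Type) (A1 A2 : mfalg F) :
  mcar (fprod A1 A2) -> mcar (fprod A2 A1) :=
  fcopair (inj2 A2 A1) (inj1 A2 A1).

Definition fassoc (F : Type) (A1 A2 A3 : mfalg F) :
  mcar (fprod (fprod A1 A2) A3) -> mcar (fprod A1 (fprod A2 A3)) :=
  fcopair (fcopair (inj1 A1 (fprod A2 A3))
                   (fun x => inj2 A1 (fprod A2 A3) (inj1 A2 A3 x)))
          (fun x => inj2 A1 (fprod A2 A3) (inj2 A2 A3 x)).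

(* Multi-faced *-algebras and restricted states.                             *)
Record mfsalg (F : Type) := MFSAlg {
  sbase : mfalg F;
  sstar : mcar sbase -> mcar sbase }.
Arguments sbase {F} m.
Arguments sstar {F} m x.

Definition valid_mfs (F : Type) (A : mfsalg F) : Prop :=
  let s := sstar A in
  valid_mf (sbase A) /\
  (forall x y, s (aadd x y) = aadd (s x) (s y)) /\
  (forall c x, s (ascale c x) = ascale (c^*) (s x)) /\
  (forall x y, s (amul x y) = amul (s y) (s x)) /\
  (forall x, s (s x) = x) /\
  (forall Q x, face (sbase A) Q x -> face (sbase A) Q (s x)).

(* involution of A1 ⊔ A2 induced by those of A1 and A2 *)
Definition fsprod (F : Type) (A1 A2 : mfsalg F) : mfsalg F :=
  let B1 := sbase A1 in let B2 := sbase A2 in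
  let sg (g : gen_t (truep (fun b => mcar (fam2 B1 B2 b)))) :
      gen_t (truep (fun b => mcar (fam2 B1 B2 b))) :=
    let (b, y) := g in
    existT _ b (exist _
      (match b return mcar (fam2 B1 B2 b) -> mcar (fam2 B1 B2 b) with
       | true => sstar A1 | false => sstar A2 end (sval y)) Logic.I) in
  @MFSAlg F (fprod B1 B2) (fun q => fpcls (tstar sg (fprep q))).

(* phi is linear and its unital extension phi~(lambda, a) = lambda + phi a
   to the unitization is positive:
   phi~((lambda,a)^* (lambda,a))
     = lambda^* lambda + lambda^* phi(a) + lambda phi(a^* ) + phi(a^* a) >= 0 *)
Definition rstate (F : Type) (A : mfsalg F) (phi : mcar (sbase A) -> C) : Prop :=
  lin phi /\
  forall (l : C) (a : mcar (sbase A)),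
    0 <= l^* * l + l^* * phi a + l * phi (sstar A a)
         + phi (amul (sstar A a) a).

(* Multi-faced universal products.                                          *)
Definition uprod (F : Type) : Type :=
  forall A1 A2 : mfalg F,
    (mcar A1 -> C) -> (mcar A2 -> C) -> mcar (fprod A1 A2) -> C.

Definition is_uprod (F : Type) (P : uprod F) : Prop :=
  [/\ (* products of linear functionals are linear functionals *)
      forall (A1 A2 : mfalg F) p1 p2, valid_mf A1 -> valid_mf A2 ->
        lin p1 -> lin p2 -> lin (P A1 A2 p1 p2),
      (* universality *)
      forall (A1 A2 B1 B2 : mfalg F) (h1 : mcar B1 -> mcar A1)
             (h2 : mcar B2 -> mcar A2) p1 p2,
        valid_mf A1 -> valid_mf A2 -> valid_mf B1 -> valid_mf B2 ->
        mfhom h1 -> mfhom h2 -> lin p1 -> lin p2 ->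
        forall z, P B1 B2 (fun x => p1 (h1 x)) (fun x => p2 (h2 x)) z
                  = P A1 A2 p1 p2 (map2 h1 h2 z),
      (* associativity *)
      forall (A1 A2 A3 : mfalg F) p1 p2 p3,
        valid_mf A1 -> valid_mf A2 -> valid_mf A3 ->
        lin p1 -> lin p2 -> lin p3 ->
        forall z, P (fprod A1 A2) A3 (P A1 A2 p1 p2) p3 z
                  = P A1 (fprod A2 A3) p1 (P A2 A3 p2 p3) (fassoc z) &
      (* restriction property *)
      forall (A1 A2 : mfalg F) p1 p2, valid_mf A1 -> valid_mf A2 ->
        lin p1 -> lin p2 ->
        (forall x, P A1 A2 p1 p2 (inj1 A1 A2 x) = p1 x) /\
        (forall x, P A1 A2 p1 p2 (inj2 A1 A2 x) = p2 x)].

Definition symmetric_up (F : Type) (P : uprod F) : Prop :=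
  forall (A1 A2 : mfalg F) p1 p2, valid_mf A1 -> valid_mf A2 ->
    lin p1 -> lin p2 ->
    forall z, P A1 A2 p1 p2 z = P A2 A1 p2 p1 (fswap z).

Definition positive_up (F : Type) (P : uprod F) : Prop :=
  forall (A1 A2 : mfsalg F) p1 p2, valid_mfs A1 -> valid_mfs A2 ->
    rstate p1 -> rstate p2 ->
    rstate (A := fsprod A1 A2) (P (sbase A1) (sbase A2) p1 p2).

(* Unit preservation.                                                       *)
(* u Q is a unit of the face A^Q *)
Definition unit_family (F : Type) (A : mfalg F) (u : F -> mcar A) : Prop :=
  forall Q, face A Q (u Q) /\
    forall x, face A Q x -> amul (u Q) x = x /\ amul x (u Q) = x.

Definition unit_preserving (F : Type) (P : uprod F) : Prop :=
  forall (A1 A2 : mfalg F) (u1 : F -> mcar A1) (u2 : F -> mcar A2) p1 p2,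
    valid_mf A1 -> valid_mf A2 -> unit_family u1 -> unit_family u2 ->
    lin p1 -> lin p2 ->
    (forall z, ideal_gen (fun w => exists q Q, w = asub (u1 q) (u1 Q)) z -> p1 z = 0) ->
    (forall Q, p1 (u1 Q) = 1) ->
    (forall z, ideal_gen (fun w => exists q Q, w = asub (u2 q) (u2 Q)) z -> p2 z = 0) ->
    (forall Q, p2 (u2 Q) = 1) ->
    let U (i : bool) (Q : F) : mcar (fprod A1 A2) :=
      if i then inj1 A1 A2 (u1 Q) else inj2 A1 A2 (u2 Q) in
    (forall z, ideal_gen (fun w => exists i j q Q, w = asub (U i q) (U j Q)) z ->
               P A1 A2 p1 p2 z = 0) /\
    (forall i Q, P A1 A2 p1 p2 (U i Q) = 1).

(* Highest coefficients.                                                    *)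
(* iterated free product A_0 ⊔ ... ⊔ A_m (left-nested) *)
Fixpoint iprod (F : Type) (A : nat -> mfalg F) (m : nat) : mfalg F :=
  match m with 0 => A 0 | m'.+1 => fprod (iprod A m') (A m'.+1) end.

(* (phi_0 ⊙ ... ⊙ phi_m) *)
Fixpoint iphi (F : Type) (P : uprod F) (A : nat -> mfalg F)
  (phi : forall k, mcar (A k) -> C) (m : nat) : mcar (iprod A m) -> C :=
  match m return mcar (iprod A m) -> C with
  | 0 => phi 0
  | m'.+1 => P (iprod A m') (A m'.+1) (@iphi F P A phi m') (phi m'.+1)
  end.

Arguments iphi {F} P {A} phi m _.

(* canonical embedding A_k -> A_0 ⊔ ... ⊔ A_m (for k <= m) *)
Fixpoint emb (F : Type) (A : nat -> mfalg F) (m k : nat) :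
  mcar (A k) -> mcar (iprod A m) :=
  match m return mcar (A k) -> mcar (iprod A m) with
  | 0 => match k return mcar (A k) -> mcar (iprod A 0) with
         | 0 => fun x => x
         | _.+1 => fun _ => azero
         end
  | m'.+1 => fun x =>
      match PeanoNat.Nat.eq_dec k m'.+1 with
      | left e => inj2 (iprod A m') (A m'.+1)
                       (eq_rect k (fun j => mcar (A j)) x m'.+1 e)
      | right _ => inj1 (iprod A m') (A m'.+1) (@emb F A m' k x)
      end
  end.

Arguments emb {F} A m k x.

(* mixed partial derivative d^k / dt_0 ... dt_{k-1} at t = 0 *)
Fixpoint dmix (k : nat) (g : (nat -> C) -> C) : C :=
  match k with
  | 0 => g (fun _ => 0)
  | k'.+1 => @derive1 CN CN
      (fun s : C => dmix k' (fun t => g (fun j => if j == k' then s else t j))) 0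
  end.

(* alpha n f pi is the highest coefficient of the partition pi of [n] whose
   elements carry the faces f *)
Definition coeffs (F : Type) : Type :=
  forall n : nat, ('I_n -> F) -> {set {set 'I_n}} -> C.

(* Manzel--Schürmann: for s = b x f (b with range {0,...,k-1}),
   d^k/dt_0..dt_{k-1} ((t_0 phi_0) ⊙ ... ⊙ (t_{k-1} phi_{k-1}))(a_1 ... a_n)|_{t=0}
     = alpha_pi * prod_kappa phi_kappa (ordered product of the a_l with b l = kappa),
   where pi is the partition with blocks b^{-1}(kappa).  The element a_l of
   A_{b l}^{f l} is x (b l) l. *)
Definition highest_coeffs (F : finType) (P : uprod F) (alpha : coeffs F) : Prop :=
  forall (k : nat) (A : nat -> mfalg F) (phi : forall kappa, mcar (A kappa) -> C)
         (n : nat) (f : 'I_n -> F) (b : 'I_n -> nat)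
         (x : forall kappa, 'I_n -> mcar (A kappa)),
    (0 < k)%N ->
    (forall kappa, (kappa < k)%N -> valid_mf (A kappa)) ->
    (forall kappa, (kappa < k)%N -> lin (phi kappa)) ->
    (forall l, (b l < k)%N) ->
    (forall kappa, (kappa < k)%N -> exists l, b l = kappa) ->
    (forall l, face (A (b l)) (f l) (x (b l) l)) ->
    dmix k (fun t => iphi P (fun kappa y => t kappa * phi kappa y) k.-1
              (lprod [seq emb A k.-1 (b l) (x (b l) l) | l <- enum 'I_n]))
    = alpha n f (preim_partition b [set: 'I_n])
      * \prod_(kappa < k) phi kappa (lprod [seq x kappa l | l <- enum 'I_n & b l == kappa]).

(* singleton inductivity: alpha_pi = alpha_{pi \ {s}} for a singleton block {s};
   pi \ {s} is renumbered order-preservingly via lift s : 'I_m -> 'I_m.+1.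
   (Convention: only for n >= 2, i.e. alpha of the empty partition is 1.) *)
Definition singleton_inductive (F : finType) (alpha : coeffs F) : Prop :=
  forall (m : nat) (f : 'I_m.+1 -> F) (pi : {set {set 'I_m.+1}}) (s : 'I_m.+1),
    (0 < m)%N -> partition pi [set: 'I_m.+1] -> [set s] \in pi ->
    alpha m.+1 f pi
    = alpha m (fun l => f (lift s l))
        [set (lift s) @^-1: B | B : {set 'I_m.+1} in pi & B != [set s]].

(* the partition {{1,3},{2}} of [3] (0-based: {{0,2},{1}}) *)
Definition pi_13_2 : {set {set 'I_3}} :=
  [set [set (inord 0 : 'I_3); inord 2]; [set (inord 1 : 'I_3)]].

(* nu_Q = 1 for every face Q, for all faces f(1), f(3) *)
Definition nu_one (F : finType) (alpha : coeffs F) : Prop :=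
  forall (Q : F) (f : 'I_3 -> F), f (inord 1) = Q -> alpha 3 f pi_13_2 = 1.

(* Main.v *)
(* A letter v of a new independent factor can be erased from a word if
   (phi (.) psi) (a_1 .. v .. a_n) = psi v * phi (a_1 .. a_n).  All three conditions
   amount to this unit erasing property.

   A functional of letters in an algebra that is multilinear in the letters and
   natural under homomorphisms depends only on the moments of words without repeated
   letters: split each letter into a sum of letters labelled by words, which
   distributes the moments over the choices of one summand for each letter.  A choice
   contributes only if the words in its support partition the letters, and such
   moments are realized by matrix units that run through each word cyclically, in a
   state of a matrix algebra.  Hence it suffices to erase units in matrix models, in
   which every face is a copy of the same matrix algebra.

   In a matrix model, unit preservation erases units at once.  If nu = 1 and the
   product is positive, then a unit u, being a projection of value 1, fixes the cyclic
   vector; nu = 1 says that u b - b is a null vector for b of mean zero in the face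
   of u; and every element of a matrix model equals, as a vector, a single element of
   that face.

   Conversely, erasing gives singleton inductivity, as the derivative in the variable
   of the singleton block becomes trivial.  It gives unit preservation since, by the
   dependence on moments, a unit of A_1 may be replaced by a unit of a third
   independent factor, which associativity moves out of the product. *)
From HB Require Import structures.
From mathcomp Require Import classical_sets filter.
From mathcomp Require Import all_boot all_algebra complex ring.
From mathcomp Require Import boolp reals Rstruct topology normedtype derive.
Require Import Defs.
Import GRing.Theory Num.Theory numFieldNormedType.Exports.
Set Implicit Arguments.
Unset Strict Implicit.
Unset Printing Implicit Defensive.
Local Open Scope ring_scope.

(** Positivity speaks only about restricted states, whereas unit preservation concerns arbitrary
    linear functionals. The cyclic matrix model bridges this: the moment of a word, an arbitrary
    complex number, becomes a scalar in front of the matrix unit of its first letter, while the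
    functional becomes a diagonal state with weight 1/r on each of the r first letters. The values
    of the functional thus move into the letters, where multilinearity handles them. Highest
    coefficients are only derivatives at 0. They determine a value of the product when it is linear
    in each variable. For letters of mean zero this is so, because scaling the functional changes
    the repetition-free moments exactly as scaling one letter does. A functional on A is pulled back
    from the free product of copies of A, one for each face. The functional cannot tell the copies
    apart, but the product may. Therefore a unit is first absorbed by elements of its own face, and
    the passage to other faces is paid for by null vectors in the kernel of [fold]. *)

Section AlgTheory.
Variables (A : alg) (HA : is_alg A).
Implicit Types x y z : A.

Lemma alg_addr0 x : aadd x azero = x.
Proof. by rewrite (alg_addC HA) (alg_add0 HA). Qed.

Lemma alg_addI x y z : aadd x y = aadd x z -> y = z.
Proof.
move=> e; have := congr1 (aadd (ascale (-1) x)) e.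
by rewrite !(alg_addA HA) ![aadd (ascale _ x) x](alg_addC HA) (alg_addN HA) !(alg_add0 HA).
Qed.

Lemma alg_scale0 x : ascale 0 x = azero.
Proof. by apply: (@alg_addI (ascale 0 x)); rewrite -(alg_scaleDl HA) addr0 alg_addr0. Qed.

Lemma alg_scaler0 (c : C) : ascale c azero = azero :> A.
Proof.
by apply: (@alg_addI (ascale c azero)); rewrite -(alg_scaleDr HA) !alg_addr0.
Qed.

Lemma alg_mul0r x : amul azero x = azero.
Proof. by apply: (@alg_addI (amul azero x)); rewrite -(alg_mulDl HA) !alg_addr0. Qed.

Lemma alg_mulr0 x : amul x azero = azero.
Proof. by apply: (@alg_addI (amul x azero)); rewrite -(alg_mulDr HA) !alg_addr0. Qed.

Lemma lin0 (phi : A -> C) : lin phi -> phi azero = 0.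
Proof. by move=> [_ hZ]; rewrite -(alg_scale0 azero) hZ mul0r. Qed.

Lemma linB (phi : A -> C) : lin phi -> forall x y, phi (asub x y) = phi x - phi y.
Proof. by move=> [hD hZ] x y; rewrite /asub hD hZ mulN1r. Qed.

End AlgTheory.

Lemma hom0 (A B : alg) (h : A -> B) : is_alg A -> is_alg B -> is_hom h -> h azero = azero.
Proof. by move=> HA HB [_ hZ _]; rewrite -(alg_scale0 HA azero) hZ alg_scale0. Qed.

Lemma hom_id (A : alg) : is_hom (@id A). Proof. by split. Qed.

Lemma hom_comp (A B D : alg) (g : B -> D) (h : A -> B) :
  is_hom g -> is_hom h -> is_hom (g \o h).
Proof.
by move=> [g1 g2 g3] [h1 h2 h3]; split=> *; rewrite /= ?h1 ?h2 ?h3 ?g1 ?g2 ?g3.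
Qed.

Lemma lin_comp (A B : alg) (h : A -> B) (phi : B -> C) :
  is_hom h -> lin phi -> lin (fun x => phi (h x)).
Proof. by move=> [h1 h2 _] [p1 p2]; split=> *; rewrite ?h1 ?h2 ?p1 ?p2. Qed.

Lemma lin_scale (A : alg) (phi : A -> C) (c : C) :
  lin phi -> lin (fun x => c * phi x).
Proof. by move=> [p1 p2]; split=> *; rewrite ?p1 ?p2 ?mulrDr // mulrCA. Qed.

(** * Words and linear spans *)

Section Words.
Variables (A : alg) (HA : is_alg A).
Implicit Types (x y z : A) (s : seq A).

Lemma foldl_amul x y s : foldl (@amul A) (amul x y) s = amul x (foldl (@amul A) y s).
Proof. by elim: s y => //= z s IH y; rewrite -(alg_mulA HA) IH. Qed.

Lemma lprod1 x : lprod [:: x] = x. Proof. by []. Qed.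

Lemma lprod_cons x y s : lprod [:: x, y & s] = amul x (lprod (y :: s)).
Proof. by rewrite /= foldl_amul. Qed.

Lemma lprod_cat x y s t :
  lprod ((x :: s) ++ y :: t) = amul (lprod (x :: s)) (lprod (y :: t)).
Proof. by rewrite /= foldl_cat /= foldl_amul. Qed.

(** Isolates the letter [x] under one-sided multiplications, so that linearity in [x] and membership
    in ideals follow by induction on [s] and [t]. *)
Lemma lprod_ctx s x t :
  lprod (s ++ x :: t) = foldr (@amul A) (foldl (@amul A) x t) s.
Proof.
elim: s => [|y [|z s] IH] //=; first by rewrite foldl_amul.
by move: IH => /= <-; rewrite foldl_amul.
Qed.

End Words.

Fixpoint Forallp (T : Type) (G : T -> Prop) (s : seq T) : Prop :=
  if s is x :: s' then G x /\ Forallp G s' else True.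

Lemma Forallp_cat (T : Type) (G : T -> Prop) s t :
  Forallp G (s ++ t) <-> Forallp G s /\ Forallp G t.
Proof. by elim: s => [|x s IH] /=; [tauto | rewrite IH; tauto]. Qed.

Lemma Forallp_map (T U : Type) (f : T -> U) (G : U -> Prop) s :
  Forallp G (map f s) <-> Forallp (fun x => G (f x)) s.
Proof. by elim: s => [|x s IH] //=; rewrite IH. Qed.

Lemma Forallp_nth (T : Type) (G : T -> Prop) x0 s :
  Forallp G s -> forall i, (i < size s)%N -> G (nth x0 s i).
Proof. by elim: s => [|x s IH] //= [Gx Gs] [|i] //=; apply: IH. Qed.

Lemma Forallp_all (T : Type) (G : T -> Prop) s : (forall x, G x) -> Forallp G s.
Proof. by move=> h; elim: s => //=. Qed.

Lemma hom_lprod (A B : alg) (h : A -> B) (x : A) s :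
  is_hom h -> h (lprod (x :: s)) = lprod (map h (x :: s)).
Proof. by move=> [_ _ hM] /=; elim: s x => //= y s IH x; rewrite IH hM. Qed.

(** Closure under products is not a constructor, so that induction meets only words and linear
    combinations, as suits identities between linear functionals. Products come back with
    [span_mul]. *)
Inductive span (A : alg) (G : A -> Prop) : A -> Prop :=
| span_word x s : Forallp G (x :: s) -> span G (lprod (x :: s))
| span_zero : span G azero
| span_add x y : span G x -> span G y -> span G (aadd x y)
| span_scale c x : span G x -> span G (ascale c x).

Lemma span_gen (A : alg) (G : A -> Prop) x : G x -> span G x.
Proof. by move=> Gx; apply: (span_word (s := [::])). Qed.

Lemma span_mul (A : alg) (G : A -> Prop) x y :
  is_alg A -> span G x -> span G y -> span G (amul x y).
Proof.
move=> HA Sx Sy; elim: Sx => {x} [x s Gx||x x' _ IH _ IH'|c x _ IH].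
- elim: Sy => {y} [y t Gy||y y' _ IH _ IH'|c y _ IH].
  + by rewrite -(lprod_cat HA); apply: span_word; apply/(Forallp_cat G (x :: s) (y :: t)).
  + by rewrite alg_mulr0 //; apply: span_zero.
  + by rewrite (alg_mulDr HA); apply: span_add.
  + by rewrite -(alg_mulZr HA); apply: span_scale.
- by rewrite alg_mul0r //; apply: span_zero.
- by rewrite (alg_mulDl HA); apply: span_add.
- by rewrite -(alg_mulZl HA); apply: span_scale.
Qed.

Lemma span_subalg (A : alg) (G : A -> Prop) : is_alg A -> is_subalg (span G).
Proof.
move=> HA; split; [exact: span_zero|exact: span_add|exact: span_scale|].
by move=> x y; apply: span_mul.
Qed.

(** * Free products *)

Section FreeProductTheory.
Unset Implicit Arguments.
Variables (I : Type) (A : I -> alg) (S : forall i, A i -> Prop).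
Set Implicit Arguments.
Local Notation T := (term I A S).
Local Notation eqt := (fpeq I A S).
Local Notation G := (gen_t S).

Lemma fpcls_eq (s t : T) : eqt s t -> fpcls s = fpcls t.
Proof.
move=> e; apply: eq_exist; rewrite /=; apply/funext => u; apply/propext; split => h.
  by apply: fe_trans h; apply: fe_sym.
exact: fe_trans h.
Qed.

Lemma fprepK : cancel fprep (@fpcls I A S).
Proof.
move=> [p hp]; rewrite /fprep /=; case: cid => /= t e; subst p.
exact: eq_exist.
Qed.

Lemma fprep_cls (t : T) : eqt (fprep (fpcls t)) t.
Proof.
have e := fprepK (fpcls t).
have := congr1 (fun q => sval q t) e; rewrite /= => e'.
by rewrite e'; apply: fe_refl.
Qed.

Lemma fpcls_surj (q : fpalg S) : exists t, q = fpcls t.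
Proof. by exists (fprep q); rewrite fprepK. Qed.

Lemma fpcls_add (s t : T) : aadd (fpcls s : fpalg S) (fpcls t) = fpcls (tadd I A S s t).
Proof. by apply: fpcls_eq; apply: fe_add; apply: fprep_cls. Qed.
Lemma fpcls_scale c (t : T) : ascale c (fpcls t : fpalg S) = fpcls (tscale I A S c t).
Proof. by apply: fpcls_eq; apply: fe_scale; apply: fprep_cls. Qed.
Lemma fpcls_mul (s t : T) : amul (fpcls s : fpalg S) (fpcls t) = fpcls (tmul I A S s t).
Proof. by apply: fpcls_eq; apply: fe_mul; apply: fprep_cls. Qed.
Definition fpclsE := (fpcls_add, fpcls_scale, fpcls_mul).

Lemma fpalg_is_alg : is_alg (fpalg S).
Proof.
split; intros; repeat match goal with x : acar _ |- _ =>
  let t := fresh "t" in have [t ->] := fpcls_surj x; clear x end;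
  rewrite ?fpclsE; apply: fpcls_eq; by constructor.
Qed.

Definition fgen i (x : A i) (Sx : S i x) : fpalg S :=
  fpcls (tgen (existT (fun i => {x : A i | S i x}) i (exist _ x Sx))).

Lemma fpalg_ind (Q : fpalg S -> Prop) :
  Q azero -> (forall x y, Q x -> Q y -> Q (aadd x y)) ->
  (forall c x, Q x -> Q (ascale c x)) -> (forall x y, Q x -> Q y -> Q (amul x y)) ->
  (forall i x (Sx : S i x), Q (fgen Sx)) -> forall q, Q q.
Proof.
move=> Q0 QD QZ QM Qg q; have [t ->] := fpcls_surj q.
elim: t => [[i [x Sx]]||s hs t ht|c t ht|s hs t ht] //; first exact: Qg.
- by rewrite -fpcls_add; apply: QD.
- by rewrite -fpcls_scale; apply: QZ.
- by rewrite -fpcls_mul; apply: QM.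
Qed.


Lemma fgenD i x y (Sx : S i x) (Sy : S i y) (Sxy : S i (aadd x y)) :
  fgen Sxy = aadd (fgen Sx) (fgen Sy).
Proof. by rewrite /fgen fpclsE; apply: fpcls_eq; apply: fe_gen_add. Qed.
Lemma fgenZ i c x (Sx : S i x) (Sxy : S i (ascale c x)) :
  fgen Sxy = ascale c (fgen Sx).
Proof. by rewrite /fgen fpclsE; apply: fpcls_eq; apply: fe_gen_scale. Qed.
Lemma fgenM i x y (Sx : S i x) (Sy : S i y) (Sxy : S i (amul x y)) :
  fgen Sxy = amul (fgen Sx) (fgen Sy).
Proof. by rewrite /fgen fpclsE; apply: fpcls_eq; apply: fe_gen_mul. Qed.
Lemma fgen_eq i x y (Sx : S i x) (Sy : S i y) : x = y -> fgen Sx = fgen Sy.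
Proof. by move=> e; apply: fpcls_eq; apply: fe_gen_eq. Qed.

Section Lift.
Variables (B : alg) (HB : is_alg B) (f : forall i x, S i x -> B).
Hypothesis fext : forall i x y (Sx : S i x) (Sy : S i y), x = y -> f Sx = f Sy.
Hypothesis fD : forall i x y (Sx : S i x) (Sy : S i y) (Sxy : S i (aadd x y)),
  f Sxy = aadd (f Sx) (f Sy).
Hypothesis fZ : forall i c x (Sx : S i x) (Sxy : S i (ascale c x)), f Sxy = ascale c (f Sx).
Hypothesis fM : forall i x y (Sx : S i x) (Sy : S i y) (Sxy : S i (amul x y)),
  f Sxy = amul (f Sx) (f Sy).

Let fg (g : G) : B := f (proj2_sig (projT2 g)).

Lemma evalt_fpeq s t : eqt s t -> evalt I A S B fg s = evalt I A S B fg t.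
Proof.
elim=> {s t} /=; intros; rewrite ?(alg_add0 HB) ?(alg_addN HB) ?(alg_scale1 HB) //; try congruence.
- by rewrite (alg_addA HB).
- by rewrite (alg_addC HB).
- by rewrite (alg_scaleA HB).
- by rewrite (alg_scaleDl HB).
- by rewrite (alg_scaleDr HB).
- by rewrite (alg_mulA HB).
- by rewrite (alg_mulDl HB).
- by rewrite (alg_mulDr HB).
- by rewrite (alg_mulZl HB).
- by rewrite (alg_mulZr HB).
- exact: fext.
- case: z H => z Sz /= e; subst z; exact: fD.
- case: z H => z Sz /= e; subst z; exact: fZ.
- case: z H => z Sz /= e; subst z; exact: fM.
Qed.

Lemma fplift_cls t : fplift fg (fpcls t) = evalt I A S B fg t.
Proof. by apply: evalt_fpeq; apply: fprep_cls. Qed.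

Lemma fplift_hom : @is_hom (fpalg S) B (fplift fg).
Proof.
split; intros; repeat match goal with x : acar (fpalg _) |- _ =>
  let t := fresh "t" in have [t ->] := fpcls_surj x; clear x end;
  by rewrite fpclsE !fplift_cls.
Qed.

Lemma fplift_gen i x (Sx : S i x) : fplift fg (fgen Sx) = f Sx.
Proof. by rewrite fplift_cls. Qed.

End Lift.

End FreeProductTheory.

Lemma hom_eq_closed (A B : alg) (g h : A -> B) :
  is_alg A -> is_alg B -> is_hom g -> is_hom h -> is_subalg (fun x => g x = h x).
Proof.
move=> HA HB Hg Hh; split; first by rewrite !(hom0 HA HB).
- by case: Hg Hh => g1 _ _ [h1 _ _] x y; rewrite g1 h1 => -> ->.
- by case: Hg Hh => _ g1 _ [_ h1 _] c x; rewrite g1 h1 => ->.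
- by case: Hg Hh => _ _ g1 [_ _ h1] x y; rewrite g1 h1 => -> ->.
Qed.

Section ValidMf.
Variables (F : Type) (A : mfalg F).

Let incl (g : gen_t (face A)) : mcar A := sval (projT2 g).

Let inclP (HA : is_alg (mcar A)) : is_hom (A := fpalg (face A)) (fplift incl).
Proof. exact: (@fplift_hom _ _ (face A) _ HA (fun i x _ => x)). Qed.

Let incl_gen (HA : is_alg (mcar A)) Q x (Hx : face A Q x) :
  fplift incl (fgen (A := fun _ => mcar A) Hx) = x.
Proof. exact: (@fplift_gen _ _ (face A) _ HA (fun i x _ => x)). Qed.

Lemma valid_ind (R : mcar A -> Prop) : valid_mf A -> is_subalg R ->
  (forall Q x, face A Q x -> R x) -> forall x, R x.
Proof.
move=> [HA HF [g gK Kg]] [R0 RD RZ RM] RF x; rewrite -[x]Kg.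
have [h1 h2 h3] := inclP HA.
elim/(@fpalg_ind F (fun _ => mcar A) (face A)): (g x) => [|u v ? ?|c u ?|u v ? ?|Q y Hy].
- by rewrite (hom0 (fpalg_is_alg _) HA (inclP HA)).
- by rewrite h1; apply: RD.
- by rewrite h2; apply: RZ.
- by rewrite h3; apply: RM.
- by rewrite incl_gen //; apply: RF Hy.
Qed.

(** The universal property of the free product of the faces, carried to [A] by the inverse of the
    canonical map. [f] receives the membership proof because in [FPm_valid] its values are
    generators that contain such proofs. *)
Lemma valid_ext (B : alg) (f : forall Q x, face A Q x -> B) :
  valid_mf A -> is_alg B ->
  (forall Q x y (Sx : face A Q x) (Sy : face A Q y), x = y -> f Q x Sx = f Q y Sy) ->
  (forall Q x y (Sx : face A Q x) (Sy : face A Q y) (Sxy : face A Q (aadd x y)),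
     f Q _ Sxy = aadd (f Q _ Sx) (f Q _ Sy)) ->
  (forall Q c x (Sx : face A Q x) (Sxy : face A Q (ascale c x)),
     f Q _ Sxy = ascale c (f Q _ Sx)) ->
  (forall Q x y (Sx : face A Q x) (Sy : face A Q y) (Sxy : face A Q (amul x y)),
     f Q _ Sxy = amul (f Q _ Sx) (f Q _ Sy)) ->
  exists h : mcar A -> B, is_hom h /\ forall Q x (Hx : face A Q x), h x = f Q x Hx.
Proof.
move=> [HA HF [g gK Kg]] HB fext fD fZ fM.
have [h1 h2 h3] := inclP HA.
have Hg : is_hom (B := fpalg (face A)) g.
  by split=> *; apply: (can_inj gK); rewrite ?h1 ?h2 ?h3 !Kg.
have Hl := fplift_hom HB fext fD fZ fM.
exists (fplift (fun q : gen_t (face A) => f _ _ (proj2_sig (projT2 q))) \o g); split.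
  exact: (hom_comp Hl Hg).
move=> Q x Hx /=; rewrite -{1}[x](incl_gen HA Hx) gK.
exact: (fplift_gen HB fext fD fZ fM).
Qed.

(** Once the faces generate [A], a homomorphism back that sends face elements to their generators is
    inverse to the canonical map, since both composites fix generators. *)
Lemma valid_intro : is_alg (mcar A) -> (forall Q, is_subalg (face A Q)) ->
  (forall R, is_subalg R -> (forall Q x, face A Q x -> R x) -> forall x, R x) ->
  (exists h : mcar A -> fpalg (face A), is_hom h /\
     forall Q x (Hx : face A Q x), h x = fgen (A := fun _ => mcar A) Hx) ->
  valid_mf A.
Proof.
move=> HA HF gen [h [Hh hgen]]; split=> //; exists h.
- apply: (@fpalg_ind F (fun _ => mcar A) (face A) (fun q => h (fplift incl q) = q)).
  + by rewrite (hom0 (fpalg_is_alg _) HA (inclP HA)) (hom0 HA (fpalg_is_alg _) Hh).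
  + by move: (inclP HA) Hh => [h1 _ _] [k1 _ _] x y; rewrite h1 k1 => -> ->.
  + by move: (inclP HA) Hh => [_ h1 _] [_ k1 _] c x; rewrite h1 k1 => ->.
  + by move: (inclP HA) Hh => [_ _ h1] [_ _ k1] x y; rewrite h1 k1 => -> ->.
  + by move=> Q x Hx; rewrite incl_gen.
- apply: gen.
  + have e := hom_comp (inclP HA) Hh.
    exact: (hom_eq_closed HA HA e (hom_id _)).
  + by move=> Q x Hx; rewrite (hgen _ _ Hx) incl_gen.
Qed.

End ValidMf.

Section FPmTheory.
Variables (F I : Type) (A : I -> mfalg F).
Hypothesis HA : forall i, valid_mf (A i).

Let HAa i : is_alg (mcar (A i)). Proof. by case: (HA i). Qed.
Local Notation S := (truep (fun i => mcar (A i))).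

Lemma FPm_is_alg : is_alg (mcar (FPm A)). Proof. exact: fpalg_is_alg. Qed.

Lemma fembed_hom i : is_hom (@fembed F I A i).
Proof.
split=> *; [exact: (fgenD (S := S))|exact: (fgenZ (S := S))|exact: (fgenM (S := S))].
Qed.

Lemma FPm_ind (R : mcar (FPm A) -> Prop) : is_subalg R ->
  (forall i x, R (@fembed F I A i x)) -> forall x, R x.
Proof.
move=> [R0 RD RZ RM] RF; apply: (@fpalg_ind I _ S R) => // i x Sx.
by case: Sx; apply: RF.
Qed.

Section FPmLift.
Variables (B : alg) (HB : is_alg B) (h : forall i, mcar (A i) -> B).
Hypothesis Hh : forall i, is_hom (@h i).

Definition FPlift : mcar (FPm A) -> B :=
  fplift (fun g : gen_t S => h (sval (projT2 g))).

Let f i x (_ : S i x) := @h i x.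
Let fext i x y (Sx : S i x) (Sy : S i y) : x = y -> f Sx = f Sy.
Proof. by move=> e; rewrite /f e. Qed.
Let fD i x y (Sx : S i x) (Sy : S i y) (Sxy : S i (aadd x y)) :
  f Sxy = aadd (f Sx) (f Sy).
Proof. by have [k1 k2 k3] := Hh i; apply: k1. Qed.
Let fZ i c x (Sx : S i x) (Sxy : S i (ascale c x)) : f Sxy = ascale c (f Sx).
Proof. by have [k1 k2 k3] := Hh i; apply: k2. Qed.
Let fM i x y (Sx : S i x) (Sy : S i y) (Sxy : S i (amul x y)) :
  f Sxy = amul (f Sx) (f Sy).
Proof. by have [k1 k2 k3] := Hh i; apply: k3. Qed.

Lemma FPlift_hom : is_hom FPlift.
Proof. exact: (fplift_hom HB fext fD fZ fM). Qed.

Lemma FPlift_embed i x : FPlift (@fembed F I A i x) = h x.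
Proof. exact: (fplift_gen HB fext fD fZ fM). Qed.

End FPmLift.

Lemma face_FPm_ind Q (R : mcar (FPm A) -> Prop) : is_subalg R ->
  (forall i x, face (A i) Q x -> R (@fembed F I A i x)) ->
  forall x, face (FPm A) Q x -> R x.
Proof.
move=> [R0 RD RZ RM] RF x [t [-> ht]].
elim: t ht => [[i [x' []]]||s hs t ht|c t ht|s hs t ht] //=; first exact: RF.
- by case=> ? ?; rewrite -fpcls_add; apply: RD; [apply: hs|apply: ht].
- by move=> ?; rewrite -fpcls_scale; apply: RZ; apply: ht.
- by case=> ? ?; rewrite -fpcls_mul; apply: RM; [apply: hs|apply: ht].
Qed.

Lemma face_FPm_subalg Q : is_subalg (face (FPm A) Q).
Proof.
split.
- by exists (tzero (S := S)).
- by move=> _ _ [s [-> hs]] [t [-> ht]]; exists (tadd I _ S s t); split; first exact: fpcls_add.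
- by move=> c _ [t [-> ht]]; exists (tscale I _ S c t); split; first exact: fpcls_scale.
- by move=> _ _ [s [-> hs]] [t [-> ht]]; exists (tmul I _ S s t); split; first exact: fpcls_mul.
Qed.

Lemma fembed_face i Q x : face (A i) Q x -> face (FPm A) Q (@fembed F I A i x).
Proof. by move=> Hx; eexists; split; first by []. Qed.

Lemma fembed_mfhom i : mfhom (B := FPm A) (@fembed F I A i).
Proof. by split; [exact: fembed_hom|move=> Q x; exact: fembed_face]. Qed.

Lemma FPlift_mfhom (B : mfalg F) (h : forall i, mcar (A i) -> mcar B) :
  is_alg (mcar B) -> (forall Q, is_subalg (face B Q)) ->
  (forall i, mfhom (@h i)) -> mfhom (FPlift h).
Proof.
move=> HB HF Hh; have Hh1 i : is_hom (@h i) by case: (Hh i).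
split; first exact: FPlift_hom.
have [h1 h2 h3] := FPlift_hom HB Hh1.
move=> Q.
apply: (face_FPm_ind (R := fun x => face B Q (FPlift h x))).
  case: (HF Q) => k0 k1 k2 k3; split.
  - by rewrite (hom0 FPm_is_alg HB (FPlift_hom HB Hh1)).
  - by move=> x y; rewrite h1; apply: k1.
  - by move=> c x; rewrite h2; apply: k2.
  - by move=> x y; rewrite h3; apply: k3.
by move=> i x Hx; rewrite FPlift_embed //; case: (Hh i) => _; apply.
Qed.

Lemma FPm_valid : valid_mf (FPm A).
Proof.
apply: valid_intro; first exact: FPm_is_alg.
- exact: face_FPm_subalg.
- move=> R HR RF; apply: FPm_ind => // i x.
  case: (HR) => R0 RD RZ RM; have [e1 e2 e3] := fembed_hom i.
  move: x; apply: (valid_ind (HA i)); last first.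
    by move=> Q x Hx; apply: (RF Q); apply: fembed_face.
  split.
  + by rewrite (hom0 (HAa i) FPm_is_alg (fembed_hom i)).
  + by move=> x y; rewrite e1; apply: RD.
  + by move=> c x; rewrite e2; apply: RZ.
  + by move=> x y; rewrite e3; apply: RM.
- pose B := fpalg (face (FPm A)).
  (* The map back to the free product of the faces is built in two stages: on each factor from its
     faces, then on the free product of the factors. *)
  have HB : is_alg B by apply: fpalg_is_alg.
  have hext i : exists h : mcar (A i) -> B, is_hom h /\
      forall Q x (Hx : face (A i) Q x),
        h x = fgen (A := fun _ => mcar (FPm A)) (fembed_face Hx).
    have [e1 e2 e3] := fembed_hom i.
    apply: (@valid_ext F (A i) B (fun Q x Hx => fgen (A := fun _ => mcar (FPm A))
      (fembed_face Hx)) (HA i) HB).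
    + by move=> Q x y Sx Sy exy; apply: fgen_eq; rewrite exy.
    + move=> Q x y Sx Sy Sxy.
      have H : face (FPm A) Q (aadd (@fembed F I A i x) (@fembed F I A i y)).
        by rewrite -e1; apply: fembed_face.
      by rewrite -(fgenD (fembed_face Sx) (fembed_face Sy) H); apply: fgen_eq.
    + move=> Q c x Sx Sxy.
      have H : face (FPm A) Q (ascale c (@fembed F I A i x)).
        by rewrite -e2; apply: fembed_face.
      by rewrite -(fgenZ (fembed_face Sx) H); apply: fgen_eq.
    + move=> Q x y Sx Sy Sxy.
      have H : face (FPm A) Q (amul (@fembed F I A i x) (@fembed F I A i y)).
        by rewrite -e3; apply: fembed_face.
      by rewrite -(fgenM (fembed_face Sx) (fembed_face Sy) H); apply: fgen_eq.
  pose h i := projT1 (cid (hext i)).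
  have hP i : is_hom (@h i) by rewrite /h; case: cid => k [].
  have hE i Q x (Hx : face (A i) Q x) :
      h i x = fgen (A := fun _ => mcar (FPm A)) (fembed_face Hx).
    by rewrite /h; case: cid => k [].
  exists (FPlift h); split; first exact: FPlift_hom.
  have [l1 l2 l3] := FPlift_hom HB hP.
  move=> Q x Hx.
  (* The induction over face elements cannot keep the given membership proof, so it produces one of
     its own; [fgen_eq] then exchanges the two. *)
  suff [H ->] : exists H : face (FPm A) Q x,
      FPlift h x = fgen (A := fun _ => mcar (FPm A)) H by apply: fgen_eq.
  have [F0 FD FZ FM] := face_FPm_subalg Q.
  move: x Hx; apply: (face_FPm_ind (R := fun x => exists H : face (FPm A) Q x,
    FPlift h x = fgen (A := fun _ => mcar (FPm A)) H)).
  + split.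
    * exists F0; rewrite (hom0 FPm_is_alg HB (FPlift_hom HB hP)).
      (* No defining relation mentions the generator of zero, so zero is written as a multiple by
         0. *)
      have Fz : face (FPm A) Q (ascale 0 azero) by apply: FZ.
      rewrite (fgen_eq F0 Fz); last by rewrite alg_scaler0 //; exact: FPm_is_alg.
      by rewrite (fgenZ (A := fun _ => mcar (FPm A)) F0) alg_scale0.
    * move=> x y [Hx ex] [Hy ey]; exists (FD _ _ Hx Hy).
      by rewrite l1 ex ey; apply/esym/fgenD.
    * move=> c x [Hx ex]; exists (FZ c _ Hx).
      by rewrite l2 ex; apply/esym/fgenZ.
    * move=> x y [Hx ex] [Hy ey]; exists (FM _ _ Hx Hy).
      by rewrite l3 ex ey; apply/esym/fgenM.
  + by move=> i x Hx; exists (fembed_face Hx); rewrite FPlift_embed.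
Qed.

End FPmTheory.

Section Fprod.
Variables (F : Type) (A1 A2 : mfalg F).
Hypotheses (HA1 : valid_mf A1) (HA2 : valid_mf A2).

Lemma fam2_valid b : valid_mf (fam2 A1 A2 b). Proof. by case: b. Qed.

Lemma fprod_valid : valid_mf (fprod A1 A2).
Proof. exact: (FPm_valid fam2_valid). Qed.

Lemma fprod_alg : is_alg (mcar (fprod A1 A2)).
Proof. exact: (FPm_is_alg (fam2 A1 A2)). Qed.

Lemma inj1_mfhom : mfhom (inj1 A1 A2).
Proof. exact: (fembed_mfhom (fam2 A1 A2) true). Qed.
Lemma inj2_mfhom : mfhom (inj2 A1 A2).
Proof. exact: (fembed_mfhom (fam2 A1 A2) false). Qed.
Lemma inj1_hom : is_hom (inj1 A1 A2). Proof. by case: inj1_mfhom. Qed.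
Lemma inj2_hom : is_hom (inj2 A1 A2). Proof. by case: inj2_mfhom. Qed.

Lemma fprod_ind (R : mcar (fprod A1 A2) -> Prop) : is_subalg R ->
  (forall x, R (inj1 A1 A2 x)) -> (forall x, R (inj2 A1 A2 x)) -> forall x, R x.
Proof. by move=> HR R1 R2; apply: (FPm_ind HR) => -[]. Qed.

Section Copair.
Variables (B : alg) (f1 : mcar A1 -> B) (f2 : mcar A2 -> B).

Let h b : mcar (fam2 A1 A2 b) -> B :=
  match b return mcar (fam2 A1 A2 b) -> B with true => f1 | false => f2 end.

Lemma fcopairE : fcopair f1 f2 = FPlift h.
Proof. by congr (fplift _); apply/funext => -[[] y]. Qed.

Hypotheses (HB : is_alg B) (H1 : is_hom f1) (H2 : is_hom f2).

Let Hh b : is_hom (@h b). Proof. by case: b. Qed.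

Lemma fcopair_hom : is_hom (fcopair f1 f2).
Proof. by rewrite fcopairE; apply: FPlift_hom. Qed.
Lemma fcopair_inj1 x : fcopair f1 f2 (inj1 A1 A2 x) = f1 x.
Proof. by rewrite fcopairE; apply: (FPlift_embed HB Hh (i := true)). Qed.
Lemma fcopair_inj2 x : fcopair f1 f2 (inj2 A1 A2 x) = f2 x.
Proof. by rewrite fcopairE; apply: (FPlift_embed HB Hh (i := false)). Qed.
End Copair.
End Fprod.

Section FprodMaps.
Variables (F : Type) (A1 A2 : mfalg F).

Section Map2.
Variables (B1 B2 : mfalg F).
Variables (h1 : mcar A1 -> mcar B1) (h2 : mcar A2 -> mcar B2).
Hypotheses (H1 : is_hom h1) (H2 : is_hom h2).

Let k1 : is_hom (fun x => inj1 B1 B2 (h1 x)) := hom_comp (inj1_hom B1 B2) H1.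
Let k2 : is_hom (fun x => inj2 B1 B2 (h2 x)) := hom_comp (inj2_hom B1 B2) H2.

Lemma map2_hom : is_hom (map2 h1 h2).
Proof. exact: (fcopair_hom (fprod_alg _ _) k1 k2). Qed.
Lemma map2_inj1 x : map2 h1 h2 (inj1 A1 A2 x) = inj1 B1 B2 (h1 x).
Proof. exact: (fcopair_inj1 (fprod_alg _ _) k1 k2). Qed.
Lemma map2_inj2 x : map2 h1 h2 (inj2 A1 A2 x) = inj2 B1 B2 (h2 x).
Proof. exact: (fcopair_inj2 (fprod_alg _ _) k1 k2). Qed.
End Map2.

Lemma fswap_hom : is_hom (@fswap F A1 A2).
Proof. exact: (fcopair_hom (fprod_alg _ _) (inj2_hom A2 A1) (inj1_hom A2 A1)). Qed.
Lemma fswap_inj1 x : fswap (inj1 A1 A2 x) = inj2 A2 A1 x.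
Proof. exact: (fcopair_inj1 (fprod_alg _ _) (inj2_hom A2 A1) (inj1_hom A2 A1)). Qed.
Lemma fswap_inj2 x : fswap (inj2 A1 A2 x) = inj1 A2 A1 x.
Proof. exact: (fcopair_inj2 (fprod_alg _ _) (inj2_hom A2 A1) (inj1_hom A2 A1)). Qed.

Variable (A3 : mfalg F).
Let i1 := inj1_hom A1 (fprod A2 A3).
Let i2 := inj2_hom A1 (fprod A2 A3).
Let q1 : is_hom (fun x => inj2 A1 (fprod A2 A3) (inj1 A2 A3 x)) :=
  hom_comp i2 (inj1_hom A2 A3).
Let q2 : is_hom (fun x => inj2 A1 (fprod A2 A3) (inj2 A2 A3 x)) :=
  hom_comp i2 (inj2_hom A2 A3).
Let q3 := fcopair_hom (fprod_alg _ _) i1 q1.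

Lemma fassoc_hom : is_hom (@fassoc F A1 A2 A3).
Proof. exact: (fcopair_hom (fprod_alg _ _) q3 q2). Qed.
Lemma fassoc_inj1 x :
  fassoc (inj1 (fprod A1 A2) A3 (inj1 A1 A2 x)) = inj1 A1 (fprod A2 A3) x.
Proof.
rewrite /fassoc (fcopair_inj1 (fprod_alg _ _) q3 q2).
exact: (fcopair_inj1 (fprod_alg _ _) i1 q1).
Qed.
Lemma fassoc_inj2 x :
  fassoc (inj1 (fprod A1 A2) A3 (inj2 A1 A2 x)) = inj2 A1 (fprod A2 A3) (inj1 A2 A3 x).
Proof.
rewrite /fassoc (fcopair_inj1 (fprod_alg _ _) q3 q2).
exact: (fcopair_inj2 (fprod_alg _ _) i1 q1).
Qed.
Lemma fassoc_inj3 x :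
  fassoc (inj2 (fprod A1 A2) A3 x) = inj2 A1 (fprod A2 A3) (inj2 A2 A3 x).
Proof. exact: (fcopair_inj2 (fprod_alg _ _) q3 q2). Qed.

End FprodMaps.

(** * Free products of copies of one algebra, one for each face *)

Definition single (F : Type) (M : alg) (q : F) : mfalg F :=
  @MFAlg F M (fun Q x => Q = q \/ x = azero).

Lemma single_valid (F : Type) (M : alg) (q : F) : is_alg M -> valid_mf (single M q).
Proof.
move=> HM; have HF Q : is_subalg (face (single M q) Q).
  split=> [|x y [->|->] [e|->]|c x [->|->]|x y [->|->] [e|->]] /=; rewrite ?(alg_add0 HM) ?(alg_addr0 HM) ?(alg_scaler0 HM) ?(alg_mul0r HM) ?(alg_mulr0 HM); auto.
apply: valid_intro => //.
  by move=> R HR RF x; apply: (RF q); left.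
have qface x : face (single M q) q x by left.
exists (fun x => fgen (A := fun _ => M) (qface x)); split.
  by split=> *; [apply: fgenD|apply: fgenZ|apply: fgenM].
move=> Q x Hx; case: (Hx) => [e|e]; first by subst Q; apply: fgen_eq.
have z Q' (H : face (single M q) Q' azero) :
    fgen (A := fun _ => M) H = azero :> fpalg (face (single M q)).
  have H' : face (single M q) Q' (ascale 0 azero) by rewrite alg_scale0.
  rewrite (fgen_eq H H'); last by rewrite alg_scale0.
  rewrite (fgenZ (A := fun _ => M) H) alg_scale0 //; exact: fpalg_is_alg.
by subst x; rewrite !z.
Qed.

Section FMTheory.
Variable (F : Type).

(** Makes a multi-faced algebra out of a plain one. A functional [tau] on [M] enters the universal
    product as its pullback along [fold], which identifies all the copies. *)
Definition FM (M : alg) : mfalg F := FPm (fun q : F => single M q).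
Definition copy (M : alg) (q : F) (x : M) : mcar (FM M) :=
  @fembed F F (fun q : F => single M q) q x.
Definition fold (M : alg) : mcar (FM M) -> M :=
  FPlift (A := fun q : F => single M q) (fun q x => x).
Definition FMmap (M N : alg) (h : M -> N) : mcar (FM M) -> mcar (FM N) :=
  FPlift (A := fun q : F => single M q) (fun q x => copy q (h x)).

Variables (M : alg) (HM : is_alg M).
Let HS (N : alg) (HN : is_alg N) (q : F) : valid_mf (single N q) := single_valid q HN.

Lemma FM_valid : valid_mf (FM M). Proof. exact: (FPm_valid (HS HM)). Qed.
Lemma FM_alg : is_alg (mcar (FM M)). Proof. by case: FM_valid. Qed.
Lemma copy_hom q : is_hom (@copy M q).
Proof. exact: (fembed_hom (fun q : F => single M q) q). Qed.
Lemma fold_hom : is_hom (@fold M). Proof. exact: FPlift_hom. Qed.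
Lemma fold_copy q x : fold (@copy M q x) = x.
Proof. exact: (FPlift_embed (A := fun q : F => single M q) HM). Qed.
Lemma copy_face q x : face (FM M) q (@copy M q x).
Proof. by apply: (fembed_face (A := fun q : F => single M q)); left. Qed.
Lemma FM_ind (R : mcar (FM M) -> Prop) : is_subalg R ->
  (forall q x, R (copy q x)) -> forall x, R x.
Proof. exact: FPm_ind. Qed.

(** Only the factor with [q = Q] has a nonzero face [Q]. Hence the face is just the copy of [M], and
    a unit of [M] gives a unit of the face. *)
Lemma face_FM Q z : face (FM M) Q z -> z = copy Q (fold z).
Proof.
have [f1 f2 f3] := fold_hom; have [c1 c2 c3] := copy_hom Q.
move: z; apply: (face_FPm_ind (R := fun z => z = copy Q (fold z))).
- split=> [|x y ex ey|c x ex|x y ex ey].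
  + by rewrite (hom0 FM_alg HM fold_hom) (hom0 HM FM_alg (copy_hom Q)).
  + by rewrite f1 c1 -ex -ey.
  + by rewrite f2 c2 -ex.
  + by rewrite f3 c3 -ex -ey.
- move=> q x [e|e]; first by subst Q; rewrite (fold_copy q x).
  have -> : @fembed F F (fun q => single M q) q x = azero.
    by rewrite e; exact: (hom0 HM FM_alg (copy_hom q)).
  by rewrite (hom0 FM_alg HM fold_hom) (hom0 HM FM_alg (copy_hom Q)).
Qed.

Lemma unit_FM (e : M) : (forall x, amul e x = x /\ amul x e = x) ->
  unit_family (A := FM M) (fun q => copy q e).
Proof.
move=> He Q; split; first exact: copy_face.
have [c1 c2 c3] := copy_hom Q.
by move=> x /face_FM ->; rewrite -!c3; have [-> ->] := He (fold x).
Qed.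

Section FMmap.
Variables (N : alg) (HN : is_alg N) (h : M -> N) (Hh : is_hom h).

Let FMN : valid_mf (FM N) := FPm_valid (HS HN).
Let k q : mfhom (A := single M q) (B := FM N) (fun x => copy q (h x)).
Proof.
split; first exact: (hom_comp (fembed_hom (fun q : F => single N q) q) Hh).
move=> Q x Hx; apply: (fembed_face (A := fun q : F => single N q)).
by case: Hx => [->|->]; [left|right; apply: (hom0 HM HN Hh)].
Qed.

Lemma FMmap_mfhom : mfhom (FMmap h).
Proof. by case: FMN => ? ? _; apply: FPlift_mfhom. Qed.

Lemma FMmap_copy q x : FMmap h (copy q x) = copy q (h x).
Proof.
have k' q' : is_hom (A := M) (B := mcar (FM N)) (fun x => copy q' (h x)) by case: (k q').
exact: (FPlift_embed (A := fun q : F => single M q) (FPm_is_alg _) k').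
Qed.

Lemma fold_FMmap (foldN : is_hom (@fold N)) z : fold (FMmap h z) = h (fold z).
Proof.
move: z; have [Hm _] := FMmap_mfhom.
have Hl := hom_comp foldN Hm; have Hr := hom_comp Hh fold_hom.
apply: FM_ind; first exact: (hom_eq_closed FM_alg HN Hl Hr).
move=> q x; rewrite FMmap_copy fold_copy.
exact: (FPlift_embed (A := fun q : F => single N q) HN).
Qed.
End FMmap.
End FMTheory.

Arguments copy {F M} q x.
Arguments fold {F M} _.
Arguments FMmap {F M N} h _.

(* Every functional phi on A is the pullback of phi \o fold along j: the faces of A
   can be forgotten. *)
Lemma FM_universal (F : Type) (A : mfalg F) : valid_mf A ->
  exists j : mcar A -> mcar (FM F (mcar A)),
    [/\ mfhom j, forall Q x, face A Q x -> j x = copy Q x & forall x, fold (j x) = x].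
Proof.
move=> HA; have [HAa HF _] := HA; have HFM := FM_alg F HAa.
have [j [Hj jE]] : exists j : mcar A -> mcar (FM F (mcar A)),
    is_hom j /\ forall Q x (Hx : face A Q x), j x = copy Q x.
  apply: (@valid_ext F A (mcar (FM F (mcar A))) (fun Q x _ => copy Q x)) => //.
  - by move=> Q x y _ _ ->.
  - by move=> Q x y _ _ _; have [] := copy_hom (mcar A) Q.
  - by move=> Q c x _ _; have [] := copy_hom (mcar A) Q.
  - by move=> Q x y _ _ _; have [] := copy_hom (mcar A) Q.
exists j; split.
- by split=> // Q x Hx; rewrite (jE Q) //; apply: copy_face.
- by move=> Q x Hx; apply: jE.
- apply: (valid_ind HA).
    exact: (hom_eq_closed HAa HAa (hom_comp (fold_hom F HAa) Hj) (hom_id _)).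
  by move=> Q x Hx; rewrite (jE Q) // fold_copy.
Qed.

(** * Involutions on free products *)

Section Star.
Variables (F I : Type) (A : I -> mfalg F).
Hypothesis HA : forall i, valid_mf (A i).
Variable s : forall i, mcar (A i) -> mcar (A i).
Hypothesis sD : forall i x y, @s i (aadd x y) = aadd (s x) (s y).
Hypothesis sZ : forall i c x, @s i (ascale c x) = ascale (c^*) (s x).
Hypothesis sM : forall i x y, @s i (amul x y) = amul (s y) (s x).
Hypothesis sK : forall i x, @s i (s x) = x.
Hypothesis sF : forall i Q x, face (A i) Q x -> face (A i) Q (@s i x).

Local Notation S := (truep (fun i => mcar (A i))).

Definition sgen (g : gen_t S) : gen_t S :=
  existT (fun i => {x : mcar (A i) | S i x}) (projT1 g) (exist _ (s (sval (projT2 g))) Logic.I).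

Lemma tstar_fpeq t u : fpeq _ _ S t u -> fpeq _ _ S (tstar sgen t) (tstar sgen u).
Proof.
elim=> {t u} /=; intros; rewrite ?rmorphD ?rmorphM ?rmorphN ?rmorph1; try by constructor.
- exact: fe_trans H0 H2.
- exact/fe_sym/fe_mulA.
- by apply: fe_gen_eq => /=; rewrite H.
- by apply: fe_gen_add => /=; rewrite H.
- by apply: fe_gen_scale => /=; rewrite H.
- by apply: fe_gen_mul => /=; rewrite H.
Qed.

Definition fstar (q : mcar (FPm A)) : mcar (FPm A) := fpcls (tstar sgen (fprep q)).

Lemma fstar_cls t : fstar (fpcls t) = fpcls (tstar sgen t).
Proof. by apply/fpcls_eq/tstar_fpeq/fprep_cls. Qed.

Lemma FPm_add u t : aadd (fpcls u : mcar (FPm A)) (fpcls t) = fpcls (tadd _ _ S u t).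
Proof. exact: fpcls_add. Qed.
Lemma FPm_scale c t : ascale c (fpcls t : mcar (FPm A)) = fpcls (tscale _ _ S c t).
Proof. exact: fpcls_scale. Qed.
Lemma FPm_mul u t : amul (fpcls u : mcar (FPm A)) (fpcls t) = fpcls (tmul _ _ S u t).
Proof. exact: fpcls_mul. Qed.

Lemma fstarD x y : fstar (aadd x y) = aadd (fstar x) (fstar y).
Proof.
have [t ->] := fpcls_surj x; have [u ->] := fpcls_surj y.
by rewrite (FPm_add,FPm_scale,FPm_mul) !fstar_cls (FPm_add,FPm_scale,FPm_mul).
Qed.
Lemma fstarZ c x : fstar (ascale c x) = ascale (c^*) (fstar x).
Proof.
have [t ->] := fpcls_surj x.
by rewrite (FPm_add,FPm_scale,FPm_mul) !fstar_cls (FPm_add,FPm_scale,FPm_mul).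
Qed.
Lemma fstarM x y : fstar (amul x y) = amul (fstar y) (fstar x).
Proof.
have [t ->] := fpcls_surj x; have [u ->] := fpcls_surj y.
by rewrite (FPm_add,FPm_scale,FPm_mul) !fstar_cls (FPm_add,FPm_scale,FPm_mul).
Qed.
Lemma fstar_embed i x : fstar (@fembed F I A i x) = fembed (s x).
Proof. by rewrite /fembed fstar_cls. Qed.
Lemma fstarK x : fstar (fstar x) = x.
Proof.
move: x; apply: (FPm_ind (R := fun x => fstar (fstar x) = x)).
- split; last by move=> x y ex ey; rewrite !fstarM ex ey.
  + by rewrite /= !fstar_cls.
  + by move=> x y ex ey; rewrite !fstarD ex ey.
  + by move=> c x ex; rewrite !fstarZ ex conjCK.
- by move=> i x; rewrite !fstar_embed sK.
Qed.
Lemma fstar_face Q x : face (FPm A) Q x -> face (FPm A) Q (fstar x).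
Proof.
have [F0 FD FZ FM] := face_FPm_subalg A Q.
apply: (face_FPm_ind (R := fun x => face (FPm A) Q (fstar x))).
- split; first by rewrite /= fstar_cls.
  + by move=> u v hu hv; rewrite fstarD; apply: FD.
  + by move=> c u hu; rewrite fstarZ; apply: FZ.
  + by move=> u v hu hv; rewrite fstarM; apply: FM.
- by move=> i y Hy; rewrite fstar_embed; apply: fembed_face; apply: sF.
Qed.

Lemma FPm_mfs : valid_mfs (MFSAlg fstar).
Proof.
split; first exact: FPm_valid.
split; first exact: fstarD.
split; first exact: fstarZ.
split; first exact: fstarM.
by split; [exact: fstarK|exact: fstar_face].
Qed.
End Star.

Lemma fsprod_starE (F : Type) (A1 A2 : mfsalg F) :
  sstar (fsprod A1 A2) = fstar (A := fam2 (sbase A1) (sbase A2))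
    (fun b => match b return mcar (fam2 (sbase A1) (sbase A2) b) ->
                         mcar (fam2 (sbase A1) (sbase A2) b) with
       true => @sstar F A1 | false => @sstar F A2 end).
Proof.
by apply/funext => q; congr (fpcls (tstar _ _)); apply/funext => -[b y].
Qed.

Section FsprodStar.
Variables (F : Type) (A1 A2 : mfsalg F).
Hypotheses (H1 : valid_mfs A1) (H2 : valid_mfs A2).
Let A12 := fsprod A1 A2.

Lemma fsprod_mfs : valid_mfs A12.
Proof.
have [v1 [a1 [b1 [c1 [d1 e1]]]]] := H1; have [v2 [a2 [b2 [c2 [d2 e2]]]]] := H2.
have := @FPm_mfs F bool (fam2 (sbase A1) (sbase A2)) (fam2_valid v1 v2)
  (fun b => match b return mcar (fam2 (sbase A1) (sbase A2) b) ->
                         mcar (fam2 (sbase A1) (sbase A2) b) with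
       true => @sstar F A1 | false => @sstar F A2 end).
rewrite -fsprod_starE; apply; case; assumption.
Qed.

Lemma fsprod_star1 x : sstar A12 (inj1 (sbase A1) (sbase A2) x) =
  inj1 (sbase A1) (sbase A2) (sstar A1 x).
Proof.
have [v1 [a1 [b1 [c1 [d1 e1]]]]] := H1; have [v2 [a2 [b2 [c2 [d2 e2]]]]] := H2.
rewrite fsprod_starE; apply: (fstar_embed (A := fam2 (sbase A1) (sbase A2)) _ _ _ (i := true)); case; assumption.
Qed.
Lemma fsprod_star2 x : sstar A12 (inj2 (sbase A1) (sbase A2) x) =
  inj2 (sbase A1) (sbase A2) (sstar A2 x).
Proof.
have [v1 [a1 [b1 [c1 [d1 e1]]]]] := H1; have [v2 [a2 [b2 [c2 [d2 e2]]]]] := H2.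
rewrite fsprod_starE; apply: (fstar_embed (A := fam2 (sbase A1) (sbase A2)) _ _ _ (i := false)); case; assumption.
Qed.
End FsprodStar.

(** * Natural multilinear functionals *)

Section SubAlgebra.
Variables (A : alg) (P : A -> Prop) (HA : is_alg A) (HP : is_subalg P).

Let P0 : P azero. Proof. by case: HP. Qed.
Let PD x y : P x -> P y -> P (aadd x y). Proof. by case: HP => _ h _ _; apply: h. Qed.
Let PZ c x : P x -> P (ascale c x). Proof. by case: HP => _ _ h _; apply: h. Qed.
Let PM x y : P x -> P y -> P (amul x y). Proof. by case: HP => _ _ _; apply. Qed.

Definition subalg : alg := @Alg {x : A | P x} (exist _ azero P0)
  (fun x y => exist _ _ (PD (proj2_sig x) (proj2_sig y)))
  (fun c x => exist _ _ (PZ c (proj2_sig x)))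
  (fun x y => exist _ _ (PM (proj2_sig x) (proj2_sig y))).

Lemma subalg_is_alg : is_alg subalg.
Proof.
split; intros; repeat match goal with x : acar subalg |- _ => destruct x as [? ?] end;
  apply: eq_exist; rewrite /=.
- exact: alg_addA.
- exact: alg_addC.
- exact: alg_add0.
- exact: alg_addN.
- exact: alg_scale1.
- exact: alg_scaleA.
- exact: alg_scaleDl.
- exact: alg_scaleDr.
- exact: alg_mulA.
- exact: alg_mulDl.
- exact: alg_mulDr.
- exact: alg_mulZl.
- exact: alg_mulZr.
Qed.

Lemma sval_hom : is_hom (A := subalg) (fun x => sval x). Proof. by []. Qed.
End SubAlgebra.

Section ProdAlgebra.
Variables (A B : alg) (HA : is_alg A) (HB : is_alg B).

Definition palg : alg := @Alg (A * B) (azero, azero)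
  (fun x y => (aadd x.1 y.1, aadd x.2 y.2)) (fun c x => (ascale c x.1, ascale c x.2))
  (fun x y => (amul x.1 y.1, amul x.2 y.2)).

Lemma palg_is_alg : is_alg palg.
Proof.
split; intros; repeat match goal with x : acar palg |- _ => case: x => ? ? end;
  rewrite /=; congr pair; by [apply: alg_addA | apply: alg_addC|apply: alg_add0
  |apply: alg_addN|apply: alg_scale1|apply: alg_scaleA|apply: alg_scaleDl
  |apply: alg_scaleDr|apply: alg_mulA|apply: alg_mulDl|apply: alg_mulDr
  |apply: alg_mulZl|apply: alg_mulZr].
Qed.

Lemma fst_hom : is_hom (A := palg) (fun x => x.1). Proof. by []. Qed.
Lemma snd_hom : is_hom (A := palg) (fun x => x.2). Proof. by []. Qed.
End ProdAlgebra.

(** * Linear functionals with prescribed moments *)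

Section OpAlgebra.
Variable X : Type.

Definition is_linop (T : (X -> C) -> X -> C) : Prop :=
  (forall f g x, T (fun y => f y + g y) x = T f x + T g x) /\
  (forall c f x, T (fun y => c * f y) x = c * T f x).

Let zP : is_linop (fun _ _ => 0).
Proof. by split=> *; rewrite ?addr0 ?mulr0. Qed.
Let dP (S T : {T | is_linop T}) : is_linop (fun f x => sval S f x + sval T f x).
Proof.
case: S T => S [S1 S2] [T [T1 T2]]; split=> * /=; first by rewrite S1 T1 addrACA.
by rewrite S2 T2 mulrDr.
Qed.
Let sP c (T : {T | is_linop T}) : is_linop (fun f x => c * sval T f x).
Proof.
case: T => T [T1 T2]; split=> * /=; first by rewrite T1 mulrDr.
by rewrite T2 mulrCA.
Qed.
Let mP (S T : {T | is_linop T}) : is_linop (fun f => sval S (sval T f)).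
Proof.
case: S T => S [S1 S2] [T [T1 T2]]; split=> [f g x|c f x] /=.
  by rewrite -S1; congr S; apply/funext => y; rewrite T1.
by rewrite -S2; congr S; apply/funext => y; rewrite T2.
Qed.

Definition opalg : alg := @Alg {T | is_linop T} (exist _ _ zP)
  (fun S T => exist _ _ (dP S T)) (fun c T => exist _ _ (sP c T))
  (fun S T => exist _ _ (mP S T)).

Lemma opalg_is_alg : is_alg opalg.
Proof.
split; intros; repeat match goal with x : acar opalg |- _ => destruct x as [? ?] end;
  apply: eq_exist; apply/funext => f; apply/funext => v /=.
- by rewrite addrA.
- by rewrite addrC.
- by rewrite add0r.
- by rewrite mulN1r addrN.
- by rewrite mul1r.
- by rewrite mulrA.
- by rewrite mulrDl.
- by rewrite mulrDr.
- by [].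
- by [].
- by match goal with H : is_linop _ |- _ => case: H => [h _]; rewrite h end.
- by [].
- by match goal with H : is_linop _ |- _ => case: H => [_ h]; rewrite h end.
Qed.
End OpAlgebra.

Section ShiftOps.
Variable K : Type.

Let shiftP (k : K) : is_linop (fun f (w : seq K) => f (rcons w k)).
Proof. by []. Qed.
(** A product of shifts, applied to [m] and evaluated at the empty word, reads off [m] at the
    corresponding word. So any function on nonempty words is the moment function of a linear
    functional, namely [ev m]. *)
Definition shift (k : K) : opalg (seq K) := exist _ _ (shiftP k).
Definition ev (m : seq K -> C) (T : opalg (seq K)) : C := sval T m [::].

Lemma ev_lin m : lin (ev m). Proof. by []. Qed.

Lemma shift_word m k w v :
  sval (lprod (map shift (k :: w)) : opalg (seq K)) m v = m (v ++ k :: w).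
Proof.
elim: w k v => [|k' w IH] k v; first by rewrite /= cats1.
rewrite !map_cons (lprod_cons (opalg_is_alg _)) -map_cons.
rewrite -[LHS]/(sval (lprod (map shift (k' :: w)) : opalg (seq K)) m (rcons v k)).
by rewrite IH cat_rcons.
Qed.

Lemma ev_word m k w : ev m (lprod (map shift (k :: w))) = m (k :: w).
Proof. exact: shift_word. Qed.
End ShiftOps.

Definition upd (L : eqType) (T : Type) (a : L -> T) (l : L) (x : T) : L -> T :=
  fun l' => if l' == l then x else a l'.

Definition asum (A : alg) (s : seq A) : A := foldr (@aadd A) azero s.

Section Multilinear.
Variables (L J : finType).

Record multilin (A : alg) (G : (L -> A) -> C) : Prop := Multilin {
  mlD : forall a l x y, G (upd a l (aadd x y)) = G (upd a l x) + G (upd a l y);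
  mlZ : forall a l c x, G (upd a l (ascale c x)) = c * G (upd a l x) }.

Lemma upd_id (T : Type) (a : L -> T) l : upd a l (a l) = a.
Proof. by apply/funext => l'; rewrite /upd; case: eqP => // ->. Qed.

Lemma ml0 (A : alg) (G : (L -> A) -> C) (HA : is_alg A) : multilin G ->
  forall a l, a l = azero -> G a = 0.
Proof.
move=> HG a l al; rewrite -(upd_id a l) al -(alg_scale0 HA azero).
by rewrite (mlZ HG) mul0r.
Qed.

Lemma ml_sum (A : alg) (G : (L -> A) -> C) (HA : is_alg A) : multilin G ->
  forall a l (s : seq J) (y : J -> A),
    G (upd a l (asum (map y s))) = \sum_(x <- s) G (upd a l (y x)).
Proof.
move=> HG a l s y; elim: s => [|x s IH] /=.
  by rewrite big_nil; apply: (ml0 HA HG (l := l)); rewrite /upd eqxx.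
by rewrite big_cons (mlD HG) IH.
Qed.

Lemma ml_expand (A B : alg) (G : (L -> A) -> C) (H : (L -> B) -> C)
    (y : L -> J -> A) (z : L -> J -> B) :
  is_alg A -> is_alg B -> multilin G -> multilin H -> inhabited J ->
  (forall j : L -> J, G (fun l => y l (j l)) = H (fun l => z l (j l))) ->
  G (fun l => asum (map (y l) (enum J))) = H (fun l => asum (map (z l) (enum J))).
Proof.
move=> HA HB HG HH [j0] e.
(* The letters in [r] are already replaced by their full sums; the others still stand at the summand
   chosen by [j]. *)
have claim (r : seq L) (j : L -> J) :
  G (fun l => if l \in r then asum (map (y l) (enum J)) else y l (j l)) =
  H (fun l => if l \in r then asum (map (z l) (enum J)) else z l (j l)).
  elim: r j => [|l0 r IH] j.
    exact: e.
  have [l0r|l0r] := boolP (l0 \in r).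
    have er l : (l \in l0 :: r) = (l \in r) by rewrite inE; case: eqP => // ->.
    have -> : (fun l => if l \in l0 :: r then asum (map (y l) (enum J)) else y l (j l)) =
        (fun l => if l \in r then asum (map (y l) (enum J)) else y l (j l)).
      by apply/funext => l; rewrite er.
    rewrite IH; congr H; by apply/funext => l; rewrite er.
  have aux (T : alg) (u : L -> J -> T) x :
     upd (fun l => if l \in r then asum (map (u l) (enum J)) else u l (j l)) l0 (u l0 x) =
     fun l => if l \in r then asum (map (u l) (enum J)) else u l (upd j l0 x l).
    by apply/funext => l; rewrite /upd; case: eqP => // ->; rewrite (negbTE l0r).
  have aux2 (T : alg) (u : L -> J -> T) :
     (fun l => if l \in l0 :: r then asum (map (u l) (enum J)) else u l (j l)) =
     upd (fun l => if l \in r then asum (map (u l) (enum J)) else u l (j l)) l0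
       (asum (map (u l0) (enum J))).
    by apply/funext => l; rewrite /upd inE; case: eqP => // ->.
  rewrite !aux2 (ml_sum HA HG) (ml_sum HB HH); apply: eq_bigr => x _.
  by rewrite !aux.
have aux (T : alg) (u : L -> J -> T) :
  (fun l => asum (map (u l) (enum J))) =
  (fun l => if l \in enum L then asum (map (u l) (enum J)) else u l j0).
  by apply/funext => l; rewrite mem_enum.
by rewrite !aux claim.
Qed.
End Multilinear.

Section NatMl.
Variables (L : finType) (E : forall M : alg, (M -> C) -> (L -> M) -> C).

(** The properties that the universal product has as a functional of one factor: [nm_nat] is
    universality, and [nm_ml] is linearity in each letter. *)
Record natml : Prop := Natml {
  nm_nat : forall (M N : alg) (h : M -> N) tau a, is_alg M -> is_alg N -> is_hom h ->
    lin tau -> E (fun x => tau (h x)) a = E tau (fun l => h (a l));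
  nm_ml : forall (M : alg) (tau : M -> C), is_alg M -> lin tau -> multilin (E tau) }.

Hypothesis HE : natml.

(** In the subalgebra of the product of [M] and [N] generated by the pairs [(a l, b l)], the
    pullbacks of [tau] and [sig] agree on words, hence everywhere. Naturality along the two
    projections then compares both sides. *)
Lemma natml_moments (M N : alg) (tau : M -> C) (sig : N -> C) a b :
  is_alg M -> is_alg N -> lin tau -> lin sig ->
  (forall l w, tau (lprod (map a (l :: w))) = sig (lprod (map b (l :: w)))) ->
  E tau a = E sig b.
Proof.
move=> HM HN Ht Hs mom.
pose G (z : palg M N) := exists l, z = (a l, b l).
have HP := palg_is_alg HM HN.
have HS := span_subalg G HP.
have HSa := subalg_is_alg HP HS.
have p1 : is_hom (A := subalg HS) (fun x => (sval x).1).
  exact: (hom_comp (fst_hom M N) (sval_hom HS)).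
have p2 : is_hom (A := subalg HS) (fun x => (sval x).2).
  exact: (hom_comp (snd_hom M N) (sval_hom HS)).
pose s l : subalg HS := exist _ (a l, b l) (span_gen (ex_intro _ l erefl) : span G _).
transitivity (E (fun x : subalg HS => tau (sval x).1) s).
  by rewrite (nm_nat HE (h := fun x : subalg HS => (sval x).1)).
transitivity (E (fun x : subalg HS => sig (sval x).2) s); last first.
  by rewrite (nm_nat HE (h := fun x : subalg HS => (sval x).2)).
congr (E _ s); apply/funext => -[z /= Sz].
have [t1 t2] := Ht; have [s1 s2] := Hs.
elim: Sz => {z} [x v Gx||x y _ ex _ ey|c x _ ex] /=.
- rewrite -[foldl _ _ _]/(lprod (x :: v) : palg M N).
  have {Gx} [l [w]] : exists l w, x :: v = map (fun l => (a l, b l)) (l :: w).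
    move: Gx => /= [[l ->] Gv]; suff [w ->] : exists w, v = map (fun l => (a l, b l)) w.
      by exists l, w.
    elim: v Gv => [|u v IH] /=; first by exists [::].
    by move=> [[k ->] /IH [w ->]]; exists (k :: w).
  move=> ->; have /= e1 := @hom_lprod (palg M N) M _ (a l, b l) (map (fun l => (a l, b l)) w) (fst_hom M N).
  have /= e2 := @hom_lprod (palg M N) N _ (a l, b l) (map (fun l => (a l, b l)) w) (snd_hom M N).
  by rewrite e1 e2 -!map_comp; apply: (mom l w).
- by rewrite (lin0 HM Ht) (lin0 HN Hs).
- by rewrite t1 s1 ex ey.
- by rewrite t2 s2 ex.
Qed.

End NatMl.

(** * Splitting letters into labelled summands *)

Section Splitting.
Variables (L : finType).

(** A label names the word that a summand serves. Words without repetition have at most [#|L|]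
    letters, so bounded sequences suffice and the labels form a finite type, over which sums exist.
    The booleans serve words with repetitions. *)
Definition label := (bool + #|L|.-bseq L)%type.

Fixpoint repeats (acc w : seq L) : seq label :=
  if w is l :: w' then inl (l \in acc) :: repeats (l :: acc) w' else [::].

(* The labels of a word with repetitions differ at two occurrences of the same
   letter, so that no choice of one label for each letter produces them. *)
Definition labels (w : seq L) : seq label :=
  if uniq w then nseq (size w) (inr (insub_bseq _ w)) else repeats [::] w.

Lemma size_labels w : size (labels w) = size w.
Proof.
rewrite /labels; case: ifP => _; first exact: size_nseq.
by elim: w [::] => //= l w IH acc; rewrite IH.
Qed.

(** A letter of [acc] already has the label [inl false], while a further occurrence would demand
    [inl true]. *)
Lemma map_repeats (j : L -> label) acc w :
  (forall l, l \in acc -> j l = inl false) -> map j w = repeats acc w ->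
  uniq w /\ (forall l, l \in w -> l \notin acc).
Proof.
elim: w acc => [|l w IH] acc hacc //= [jl jw].
have lacc : l \notin acc by apply/negP => h; move: jl; rewrite h hacc.
have [|uw hw] := IH (l :: acc) _ jw.
  by move=> k; rewrite inE => /orP[/eqP->|/hacc //]; rewrite jl (negbTE lacc).
split; first by rewrite uw andbT; apply/negP => /hw; rewrite inE eqxx.
move=> k; rewrite inE => /orP[/eqP-> //|/hw]; by rewrite inE negb_or => /andP[].
Qed.

Lemma map_labels_uniq (j : L -> label) (w : seq L) : map j w = labels w -> uniq w.
Proof.
rewrite /labels; case: ifP => // nu e.
by have [//|uw _] := map_repeats (acc := [::]) _ e; rewrite uw in nu.
Qed.

Lemma insub_word (w : seq L) : uniq w -> val (insub_bseq #|L| w) = w.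
Proof.
by move=> /card_uniqP uw; rewrite /insub_bseq insubdK // unfold_in -uw max_card.
Qed.

Lemma map_labels (j : L -> label) (w : seq L) : uniq w ->
  map j w = labels w <-> forall l, l \in w -> j l = inr (insub_bseq _ w).
Proof.
move=> uw; rewrite /labels uw; move: (inr _) => x {uw}.
elim: w => [|l w IH] //=; split.
- by move=> [jl /IH jw] k; rewrite inE => /orP[/eqP->|/jw].
- move=> h; rewrite h ?mem_head //; congr cons; apply/IH => k kw.
  by apply: h; rewrite inE kw orbT.
Qed.

Fixpoint sumall (w : seq L) (K : seq label -> C) : C :=
  if w is l :: w' then \sum_(x : label) sumall w' (fun js => K (x :: js)) else K [::].

Lemma sumall_ext w K K' : (forall js, size js = size w -> K js = K' js) ->
  sumall w K = sumall w K'.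
Proof.
elim: w K K' => [|l w IH] K K' e /=; first exact: e.
by apply: eq_bigr => x _; apply: IH => js ejs; apply: e; rewrite /= ejs.
Qed.

Lemma sumall0 w : sumall w (fun _ => 0) = 0.
Proof. by elim: w => //= l w IH; rewrite big1. Qed.

Lemma sumall_pred1 w t (c : C) : size t = size w ->
  sumall w (fun js => if js == t then c else 0) = c.
Proof.
elim: w t => [|l w IH] [|x t] //= [st].
rewrite (bigD1 x) //= big1 ?addr0 => [|y yx].
  by rewrite -[RHS](IH t st); apply: sumall_ext => js _; rewrite eqseq_cons eqxx.
by rewrite -[RHS](sumall0 w); apply: sumall_ext => js _; rewrite eqseq_cons (negbTE yx).
Qed.

(** Each word gives its entire moment to a single labelling, so that the sum over all labellings
    returns [m]; see [split_moment_word]. *)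
Definition split_moment (m : seq L -> C) (ks : seq (L * label)) : C :=
  if map snd ks == labels (map fst ks) then m (map fst ks) else 0.

(** The moments that survive when every letter [l] is replaced by its one summand with label
    [j l]. *)
Definition part_moment (m : seq L -> C) (j : L -> label) (w : seq L) : C :=
  if map j w == labels w then m w else 0.

Definition sum_shift (l : L) : opalg (seq (L * label)) :=
  asum (map (fun x => shift (l, x)) (enum (label : finType))).

Lemma sum_shiftE l f v : sval (sum_shift l) f v = \sum_(x : label) f (rcons v (l, x)).
Proof.
rewrite -big_enum /sum_shift /=; elim: (enum _) => [|x s IH] /=; first by rewrite big_nil.
by rewrite big_cons -IH.
Qed.

Lemma sum_shift_word l w f v :
  sval (lprod (map sum_shift (l :: w))) f v =
  sumall (l :: w) (fun js => f (v ++ zip (l :: w) js)).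
Proof.
elim: w l v => [|l' w IH] l v.
  by rewrite /= sum_shiftE; apply: eq_bigr => x _; rewrite cats1.
rewrite !map_cons (lprod_cons (opalg_is_alg _)) -map_cons.
rewrite -[LHS]/(sval (sum_shift l) (sval (lprod (map sum_shift (l' :: w))) f) v).
rewrite sum_shiftE; apply: eq_bigr => x _; rewrite IH.
apply: (@sumall_ext (l' :: w) _ (fun js => f (v ++ zip [:: l, l' & w] (x :: js)))) => js _.
by rewrite cat_rcons.
Qed.

Lemma split_moment_word m l w :
  ev (split_moment m) (lprod (map sum_shift (l :: w))) = m (l :: w).
Proof.
rewrite /ev sum_shift_word -[RHS](sumall_pred1 _ (size_labels (l :: w))).
apply: (@sumall_ext (l :: w)) => js sjs; rewrite cat0s /split_moment.
by rewrite -/unzip2 -/unzip1 unzip1_zip ?unzip2_zip ?sjs.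
Qed.

End Splitting.

Section Uniq.
Variables (L : finType) (E : forall M : alg, (M -> C) -> (L -> M) -> C).
Hypothesis HE : natml E.

Definition moment (M : alg) (tau : M -> C) (a : L -> M) (w : seq L) : C :=
  tau (lprod (map a w)).

Let G (m : seq L -> C) (b : L -> opalg (seq (L * label L))) : C :=
  E (ev (split_moment m)) b.

Let G_ml m : multilin (G m).
Proof. exact: (nm_ml HE (opalg_is_alg _) (ev_lin _)). Qed.

Let G_sum (M : alg) (tau : M -> C) a : is_alg M -> lin tau ->
  E tau a = G (moment tau a) (fun l => @sum_shift L l).
Proof.
move=> HM Ht; apply: (natml_moments HE HM (opalg_is_alg _) Ht (ev_lin _)) => l w.
by rewrite split_moment_word.
Qed.

Let G_part m (j : L -> label L) :
  G m (fun l => shift (l, j l)) = E (ev (part_moment m j)) (@shift L).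
Proof.
apply: (natml_moments HE (opalg_is_alg _) (opalg_is_alg _) (ev_lin _) (ev_lin _)) => l w.
rewrite (map_comp (@shift _) (fun l => (l, j l))) !ev_word /part_moment /split_moment.
by rewrite -!map_cons -!map_comp /= map_id.
Qed.

Lemma natml_split0 (M : alg) (tau : M -> C) a : is_alg M -> lin tau ->
  (forall j, E (ev (part_moment (moment tau a) j)) (@shift L) = 0) -> E tau a = 0.
Proof.
move=> HM Ht e; rewrite G_sum //.
(* The comparison is with the zero functional, whose letters are immaterial. *)
apply: (@ml_expand L (label L) _ (opalg (seq L)) (G (moment tau a)) (fun _ => 0)
  (fun l x => shift (l, x)) (fun _ _ => azero)).
- exact: opalg_is_alg.
- exact: opalg_is_alg.
- exact: G_ml.
- by split=> *; rewrite ?addr0 ?mulr0.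
- by split; left; exact: true.
- by move=> j; rewrite G_part.
Qed.

(** After splitting, each choice of labels keeps only moments of repetition-free words, by
    [map_labels_uniq]. *)
Lemma natml_uniq (M N : alg) (tau : M -> C) (sig : N -> C) a b :
  is_alg M -> is_alg N -> lin tau -> lin sig ->
  (forall l w, uniq (l :: w) ->
     tau (lprod (map a (l :: w))) = sig (lprod (map b (l :: w)))) ->
  E tau a = E sig b.
Proof.
move=> HM HN Ht Hs e; rewrite !G_sum //.
apply: (@ml_expand L (label L) _ _ (G (moment tau a)) (G (moment sig b))
  (fun l x => shift (l, x)) (fun l x => shift (l, x))).
- exact: opalg_is_alg.
- exact: opalg_is_alg.
- exact: G_ml.
- exact: G_ml.
- by split; left; exact: true.
move=> j; rewrite !G_part.
apply: (natml_moments HE (opalg_is_alg _) (opalg_is_alg _) (ev_lin _) (ev_lin _)) => l w.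
rewrite !ev_word /part_moment; case: ifP => // /eqP /map_labels_uniq uw.
exact: e.
Qed.

(* W l is the word through the letter l; these words are disjoint. *)
Definition word_partition (m : seq L -> C) (W : L -> seq L) : Prop :=
  forall l, [/\ uniq (W l), l \in W l, {in W l, forall l', W l' = W l} & m (W l) != 0].

Lemma lprod_upd0 (M : alg) (a : L -> M) l w : is_alg M -> l \in w ->
  lprod (map (upd a l azero) w) = azero.
Proof.
move=> HM; case/splitPr => w1 w2.
rewrite map_cat map_cons lprod_ctx // {1}/upd eqxx.
have -> s : foldl (@amul M) azero s = azero by elim: s => //= x s IH; rewrite alg_mul0r.
by elim: w1 => //= x s ->; rewrite alg_mulr0.
Qed.

Lemma natml_partition0 (M : alg) (tau : M -> C) a : is_alg M -> lin tau ->
  (forall W, word_partition (moment tau a) W ->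
    forall (N : alg) (sig : N -> C) b, is_alg N -> lin sig ->
    (forall l w, uniq (l :: w) -> sig (lprod (map b (l :: w))) =
       if W l == l :: w then moment tau a (l :: w) else 0) ->
    E sig b = 0) ->
  E tau a = 0.
Proof.
move=> HM Ht H; apply: natml_split0 => // j.
set m := moment tau a in H *.
(* The word named by the label. A boolean label gives the empty word, which does not contain [l] and
   so cannot belong to a word partition. *)
pose W l : seq L := if j l is inr v then val v else [::].
have jW w l : uniq w -> l \in w -> map j w = labels w -> W l = w.
  by move=> uw lw /(map_labels _ uw) /(_ l lw); rewrite /W => ->; rewrite insub_word.
have [gW|/existsNP [l nl]] := pselect (word_partition m W).
  apply: (H W gW _ _ _ (opalg_is_alg _) (ev_lin _)) => l w uw.
  rewrite ev_word /part_moment.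
  have -> // : (map j (l :: w) == labels (l :: w)) = (W l == l :: w).
  apply/eqP/eqP => [e|e]; first by apply: jW => //; apply: mem_head.
  apply/map_labels => // k kw; have [_ _ /(_ k)] := gW l.
  rewrite e => /(_ kw); rewrite /W; case: (j k) => // v vE.
  by move=> _; congr inr; apply: val_inj; rewrite insub_word.
have HO := opalg_is_alg (seq L).
(* Every word through [l] now has moment 0: a surviving one would be [W l] and would satisfy the
   condition that [l] violates. So replacing this letter by zero changes no moment. *)
transitivity (E (ev (part_moment m j)) (upd (@shift L) l azero)).
  apply: (natml_moments HE HO HO (ev_lin _) (ev_lin _)) => k w.
  have [lw|lw] := boolP (l \in k :: w).
    rewrite lprod_upd0 // ev_word (lin0 HO (ev_lin _)) /part_moment.
    case: ifP => // /eqP e; have uw := map_labels_uniq e.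
    have [//|mw] := eqVneq (m (k :: w)) 0.
    case: nl; rewrite (jW _ _ uw lw e); split=> // l' l'w; exact: (jW _ _ uw l'w e).
  congr (ev _ (lprod _)); apply/eq_in_map => l' l'w; rewrite /upd.
  by case: eqP => // el; move: lw; rewrite -el l'w.
by apply: (ml0 HO (nm_ml HE HO (ev_lin _)) (l := l)); rewrite /upd eqxx.
Qed.

End Uniq.

(** * Matrix models of cyclic words *)

Definition matalg (n : nat) : alg :=
  @Alg 'M[C]_n 0 +%R *:%R (@mulmx C n n n).

Lemma matalg_is_alg n : is_alg (matalg n).
Proof.
split=> /=.
- exact: addrA.
- exact: addrC.
- exact: add0r.
- by move=> x; rewrite scaleN1r addrN.
- exact: scale1r.
- exact: scalerA.
- by move=> a b x; rewrite scalerDl.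
- by move=> a x y; rewrite scalerDr.
- by move=> x y z; apply: mulmxA.
- by move=> x y z; apply: mulmxDl.
- by move=> x y z; apply: mulmxDr.
- by move=> a x y; apply: scalemxAl.
- by move=> a x y; apply: scalemxAr.
Qed.

Definition wtrace n (p : 'I_n -> C) (T : matalg n) : C :=
  \sum_i p i * (T : 'M_n) i i.

Definition weights n (p : 'I_n -> C) : Prop :=
  (forall i, 0 <= p i) /\ \sum_i p i = 1.

Lemma wtrace_lin n (p : 'I_n -> C) : lin (wtrace p).
Proof.
split=> [x y|c x]; rewrite /wtrace /=.
  by rewrite -big_split; apply: eq_bigr => i _; rewrite mxE mulrDr.
by rewrite mulr_sumr; apply: eq_bigr => i _; rewrite mxE mulrCA.
Qed.

Lemma wtrace1 n (p : 'I_n -> C) : weights p -> wtrace p (1%:M : 'M_n) = 1.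
Proof.
by move=> [_ p1]; rewrite -[RHS]p1; apply: eq_bigr => i _; rewrite mxE eqxx mulr1.
Qed.

Lemma wtrace_delta n (p : 'I_n -> C) i j :
  wtrace p (delta_mx i j : 'M_n) = if i == j then p i else 0.
Proof.
rewrite /wtrace (bigD1 i) //= big1 ?addr0 => [|k ki].
  by rewrite mxE eqxx andTb; case: ifP => _; rewrite ?mulr1n ?mulr0n ?mulr1 ?mulr0.
by rewrite mxE (negbTE ki) mulr0.
Qed.

Lemma fcycle_orbit (T : finType) (f : T -> T) x s :
  uniq (x :: s) -> fcycle f (x :: s) -> x :: s = orbit f x.
Proof.
move=> us cs; rewrite /orbit (order_cycle cs us (mem_head _ _)).
rewrite [size _]/= trajectS; congr cons.
by apply/fpathE; move: cs; rewrite /= rcons_path => /andP[].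
Qed.

Section CyclicModel.
Variables (L : finType) (W : L -> seq L) (v : L -> C).
Hypothesis uW : forall l, uniq (W l).
Hypothesis lW : forall l, l \in W l.
Hypothesis WW : forall l, {in W l, forall l', W l' = W l}.

Definition first_letter l := head l (W l) == l.
Definition next_letter l := next (W l) l.
Let r : C := #|[pred l | first_letter l]|%:R.

(* The factor r compensates for the weights 1/r on the first letters. *)
Definition cyc_letter (l : L) : matalg #|L| :=
  (if first_letter l then r * v l else 1) *:
    delta_mx (enum_rank l) (enum_rank (next_letter l)).

(** The matrix units of a rotated word also multiply to a diagonal one. Putting weight on first
    letters only gives proper rotations the moment 0. *)
Definition cyc_weight (i : 'I_#|L|) : C :=
  if first_letter (enum_val i) then r^-1 else 0.

Lemma first_letter_head l w : W l = l :: w -> first_letter l.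
Proof. by rewrite /first_letter => ->; rewrite eqxx. Qed.

Lemma fcycle_word l : fcycle next_letter (W l).
Proof.
apply: (@sub_in_cycle _ (mem (W l)) _ _ _ _ _ (cycle_next (uW l))); last exact/allP.
by move=> x y xl yl /=; rewrite /next_letter (WW xl).
Qed.

(** A repetition-free cycle of [next_letter] is an orbit, hence determined by its starting point. *)
Lemma fcycle_wordP l w : uniq (l :: w) ->
  fcycle next_letter (l :: w) && first_letter l = (W l == l :: w).
Proof.
move=> uw; apply/andP/eqP => [[cw hl]|e]; last first.
  by split; [rewrite -e; apply: fcycle_word|apply: first_letter_head e].
rewrite (fcycle_orbit uw cw).
have := uW l; have := fcycle_word l; have := lW l; move: hl; rewrite /first_letter.
by case: (W l) => // x s /= /eqP -> _ cs us; apply: fcycle_orbit.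
Qed.

Lemma cyc_letters l w :
  lprod (map cyc_letter (l :: w)) =
  (\prod_(k <- l :: w) (if first_letter k then r * v k else 1)) *:
   (if path (frel next_letter) l w then
      delta_mx (enum_rank l) (enum_rank (next_letter (last l w))) else 0) :> 'M[C]_#|L|.
Proof.
elim: w l => [|k w IH] l; first by rewrite big_seq1.
rewrite !map_cons (lprod_cons (matalg_is_alg _)) -map_cons big_cons /=.
rewrite -[foldl _ _ _]/(lprod (map cyc_letter (k :: w))) IH.
rewrite -scalemxAl -scalemxAr scalerA; congr (_ *: _).
have [<-|nk] := eqVneq (next_letter l) k.
  by rewrite /=; case: ifP; rewrite ?mulmx0 // mul_delta_mx.
rewrite andFb; case: ifP; rewrite ?mulmx0 // mul_delta_mx_0 //.
by apply: contra nk => /eqP /enum_rank_inj ->.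
Qed.

Lemma cyc_moment l w : uniq (l :: w) ->
  wtrace cyc_weight (lprod (map cyc_letter (l :: w))) =
  if W l == l :: w then v l else 0.
Proof.
move=> uw; have [_ tZ] := wtrace_lin cyc_weight.
rewrite cyc_letters tZ -(fcycle_wordP uw) [fcycle _ _]/= rcons_path.
case: ifP => pw /=; last first.
  rewrite (lin0 (matalg_is_alg _) (wtrace_lin _)) mulr0 //.
rewrite wtrace_delta (inj_eq enum_rank_inj) /cyc_weight enum_rankK eq_sym.
have [nl|] := eqVneq; last by rewrite mulr0.
have [hl|] /= := boolP (first_letter l); last by rewrite mulr0.
have e : W l = l :: w.
  by apply/eqP; rewrite -(fcycle_wordP uw) hl andbT /= rcons_path pw /= nl.
(* Only the head of the word is a first letter, so the scalars multiply to [r * v l], and the weight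
   of the head cancels [r]. *)
rewrite big_cons hl big_seq big1 => [|k kw].
  rewrite mulr1 mulrAC divff ?mul1r // pnatr_eq0 -lt0n; apply/card_gt0P.
  by exists l; rewrite inE.
have lk : W k = W l by apply: WW; rewrite e inE kw orbT.
rewrite /first_letter lk e /=; case: eqP => // lk'.
by move: uw => /=; rewrite lk' kw.
Qed.

(** A letter is required to make [r] nonzero: the head of its word is a first letter. *)
Lemma cyc_weights : L -> weights cyc_weight.
Proof.
move=> l0; have rpos : (0 < #|[pred l | first_letter l]|)%N.
  apply/card_gt0P; exists (head l0 (W l0)); rewrite inE.
  have hW : head l0 (W l0) \in W l0 by case: (W l0) (lW l0) => //= *; rewrite mem_head.
  by rewrite /first_letter (WW hW); case: (W l0) (lW l0) => //=.
split=> [i|]; first by rewrite /cyc_weight; case: ifP => // _; rewrite invr_ge0 ler0n.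
rewrite /cyc_weight (reindex enum_rank) /=; last first.
  by exists enum_val => ? _; rewrite ?enum_rankK ?enum_valK.
under eq_bigr do rewrite enum_rankK.
by rewrite -big_mkcond sumr_const -[_ *+ _]mulr_natl divff // pnatr_eq0 -lt0n.
Qed.
End CyclicModel.

(** [tau] is an arbitrary linear functional, yet states suffice in the hypothesis: its moments enter
    the model only as the scalars [v l] of the letters. *)
Lemma natml_matrix0 (L : finType) (E : forall M : alg, (M -> C) -> (L -> M) -> C) :
  natml E -> L ->
  (forall n (p : 'I_n -> C) (T : L -> matalg n), weights p -> E _ (wtrace p) T = 0) ->
  forall (M : alg) (tau : M -> C) a, is_alg M -> lin tau -> E M tau a = 0.
Proof.
move=> HE l0 H M tau a HM Ht; apply: (natml_partition0 HE HM Ht) => W HW N sig b HN Hs mom.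
have uW l : uniq (W l) by case: (HW l).
have lW l : l \in W l by case: (HW l).
have WW l : {in W l, forall l', W l' = W l} by case: (HW l).
rewrite -(H _ _ (cyc_letter W (fun l => moment tau a (W l))) (cyc_weights lW WW l0)).
apply: (natml_uniq HE HN (matalg_is_alg _) Hs (wtrace_lin _)) => l w uw.
by rewrite mom // cyc_moment //; case: eqP => // ->.
Qed.

(** * Erasing units *)

Lemma hom_lprodn (A B : alg) (h : A -> B) s :
  is_alg A -> is_alg B -> is_hom h -> h (lprod s) = lprod (map h s).
Proof. by case: s => [|x s] HA HB Hh; [exact: hom0|exact: hom_lprod]. Qed.

Section Context.
Variables (A : alg) (HA : is_alg A).

Lemma ctxD (s t : seq A) x y : lprod (s ++ aadd x y :: t) =
  aadd (lprod (s ++ x :: t)) (lprod (s ++ y :: t)).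
Proof.
rewrite !lprod_ctx //.
have -> : foldl (@amul A) (aadd x y) t = aadd (foldl (@amul A) x t) (foldl (@amul A) y t).
  by elim: t x y => //= z t IH x y; rewrite (alg_mulDl HA) IH.
by elim: s => //= z s ->; rewrite (alg_mulDr HA).
Qed.

Lemma ctxZ (s t : seq A) c x : lprod (s ++ ascale c x :: t) =
  ascale c (lprod (s ++ x :: t)).
Proof.
rewrite !lprod_ctx //.
have -> : foldl (@amul A) (ascale c x) t = ascale c (foldl (@amul A) x t).
  by elim: t x => //= z t IH x; rewrite -(alg_mulZl HA) IH.
by elim: s => //= z s ->; rewrite (alg_mulZr HA).
Qed.
End Context.

(** Indexing by positions turns equal letters into different arguments, so that the value at a word
    becomes multilinear. *)
Lemma index_cat (T : Type) (c b : seq T) :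
  exists N (x : 'I_N -> T) (c0 b0 : seq 'I_N),
    [/\ uniq (c0 ++ b0), forall i, i \in c0 ++ b0, map x c0 = c & map x b0 = b].
Proof.
pose x i := tnth (in_tuple (c ++ b)) i; pose e := enum 'I_(size (c ++ b)).
have ex : map x e = c ++ b by rewrite map_tnth_enum.
exists _, x, (take (size c) e), (drop (size c) e); rewrite cat_take_drop.
split; first exact: enum_uniq.
- by move=> i; rewrite mem_enum.
- by rewrite map_take ex take_size_cat.
- by rewrite map_drop ex drop_size_cat.
Qed.

Lemma multilin_sub (L : finType) (A : alg) (G H : (L -> A) -> C) (c : C) :
  multilin G -> multilin H -> multilin (fun a => G a - c * H a).
Proof.
move=> [g1 g2] [h1 h2]; split=> *; rewrite ?g1 ?h1 ?g2 ?h2.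
  by rewrite mulrDr opprD addrACA.
by rewrite mulrBr; congr (_ - _); rewrite mulrCA.
Qed.

Lemma word_multilin (L : finType) (A : alg) (tau : A -> C) s :
  is_alg A -> lin tau -> uniq s -> (forall l : L, l \in s) ->
  multilin (fun a : L -> A => tau (lprod (map a s))).
Proof.
move=> HA [tD tZ] us fs; split=> a l; move: us (fs l) => us ls.
all: case/splitPr: ls us => s1 s2; rewrite cat_uniq /= negb_or -andbA.
all: case/and5P => _ l1 _ l2 _.
all: have e x : map (upd a l x) (s1 ++ l :: s2) = map a s1 ++ x :: map a s2.
1, 3: rewrite map_cat /= {2}/upd eqxx; congr (_ ++ _ :: _); apply/eq_in_map => k ks;
      rewrite /upd; case: eqP => // ek; by rewrite -ek ks in l1 l2.
- by move=> x y; rewrite !e ctxD.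
- by move=> c x; rewrite !e ctxZ.
Qed.

(** * The universal product as a functional of one factor *)

Section UniversalProduct.
Unset Implicit Arguments.
Variables (F : finType) (P : uprod F).
Set Implicit Arguments.
Hypothesis HP : is_uprod P.
Hypothesis Hsym : symmetric_up P.

Lemma up_lin A1 A2 p1 p2 : valid_mf A1 -> valid_mf A2 -> lin p1 -> lin p2 ->
  lin (P A1 A2 p1 p2).
Proof. by case: HP => h _ _ _; apply: h. Qed.

Lemma up_res1 A1 A2 p1 p2 x : valid_mf A1 -> valid_mf A2 -> lin p1 -> lin p2 ->
  P A1 A2 p1 p2 (inj1 A1 A2 x) = p1 x.
Proof. by case: HP => _ _ _ h v1 v2 l1 l2; have [-> _] := h A1 A2 p1 p2 v1 v2 l1 l2. Qed.

Lemma up_res2 A1 A2 p1 p2 x : valid_mf A1 -> valid_mf A2 -> lin p1 -> lin p2 ->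
  P A1 A2 p1 p2 (inj2 A1 A2 x) = p2 x.
Proof. by case: HP => _ _ _ h v1 v2 l1 l2; have [_ ->] := h A1 A2 p1 p2 v1 v2 l1 l2. Qed.

Definition letter (L : Type) (A B : mfalg F) (a : L -> mcar A) (x : L + mcar B) :
  mcar (fprod A B) :=
  match x with inl l => inj1 A B (a l) | inr y => inj2 A B y end.

Definition lefts (L T : Type) (s : seq (L + T)) : seq L :=
  pmap (fun x => if x is inl l then Some l else None) s.

Section FirstFactor.
Variables (L : finType) (B : mfalg F) (psi : mcar B -> C) (f : L -> F).
Variable s : seq (L + mcar B).
Hypotheses (HB : valid_mf B) (Hpsi : lin psi).
Hypotheses (us : uniq (lefts s)) (fs : forall l, l \in lefts s).

(** The pattern of the word, its letters in the second factor and the faces [f] are frozen; only the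
    data of the first factor vary. *)
Definition first_functional (M : alg) (tau : M -> C) (a : L -> M) : C :=
  P (FM F M) B (fun x => tau (fold x)) psi
    (lprod (map (letter (fun l => copy (f l) (a l))) s)).

Lemma lefts_split l : exists s1 s2,
  [/\ s = s1 ++ inl l :: s2, l \notin lefts s1 & l \notin lefts s2].
Proof.
move: us (fs l); elim: (s) => [|[k|y] v IH] //=.
- move=> /andP[kv uv]; rewrite inE => /orP[/eqP ->|lv].
    by exists [::], v.
  have [s1 [s2 [-> n1 n2]]] := IH uv lv; exists (inl k :: s1), s2.
  by split=> //=; rewrite inE negb_or n1 andbT; apply: contraNneq kv => <-.
- move=> uv lv; have [s1 [s2 [-> n1 n2]]] := IH uv lv.
  by exists (inr y :: s1), s2.
Qed.

Lemma map_letter_upd (A : mfalg F) (a : L -> mcar A) l x (t : seq (L + mcar B)) :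
  l \notin lefts t -> map (letter (upd a l x)) t = map (letter a) t.
Proof.
elim: t => [|[k|y] t IH] //=; last by move=> /IH ->.
rewrite inE negb_or => /andP[lk /IH ->]; congr (inj1 _ _ _ :: _).
by rewrite /upd eq_sym (negbTE lk).
Qed.

(** Naturality is universality along [FMmap h]. Linearity in a letter uses that each letter occurs
    exactly once in [s]. *)
Lemma first_functional_natml : natml first_functional.
Proof.
split.
- move=> M N h tau a HM HN Hh Ht; rewrite /first_functional.
  have Hf := fold_hom F HN.
  have vM := FM_valid F HM; have vN := FM_valid F HN.
  have [Hm mf] : mfhom (FMmap (F := F) h) by apply: FMmap_mfhom.
  have hid : @mfhom F B B id by [].
  have Htf : lin (fun x : mcar (FM F N) => tau (fold x)) by apply: lin_comp.
  have eM : is_hom (map2 (FMmap (F := F) h) (@id (mcar B))).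
    by apply: map2_hom.
  transitivity (P (FM F M) B (fun x => tau (fold (FMmap h x))) psi
    (lprod (map (letter (fun l => copy (f l) (a l))) s))).
    by congr (P _ _ _ _ _); apply/funext => x; rewrite fold_FMmap.
  have [_ huniv _ _] := HP.
  rewrite (huniv _ _ _ _ (FMmap h) id (fun x => tau (fold x)) psi) //.
  congr (P _ _ _ _ _).
  rewrite (hom_lprodn (h := map2 _ _)) //; try exact: fprod_alg.
  rewrite -map_comp; congr lprod; apply: eq_map => -[l|y] /=.
    by rewrite map2_inj1 // FMmap_copy.
  by rewrite map2_inj2.
- move=> M tau HM Ht.
  have vM := FM_valid F HM.
  have Htf : lin (fun x : mcar (FM F M) => tau (fold x)).
    by apply: lin_comp => //; apply: fold_hom.
  have [lD lZ] := up_lin vM HB Htf Hpsi.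
  have HA := fprod_alg (FM F M) B.
  have key a l : exists s1 s2, forall x, first_functional tau (upd a l x) =
      P (FM F M) B (fun x => tau (fold x)) psi
        (lprod (s1 ++ inj1 (FM F M) B (copy (f l) x) :: s2)).
    have [s1 [s2 [es n1 n2]]] := lefts_split l.
    exists (map (letter (fun l => copy (f l) (a l))) s1),
      (map (letter (fun l => copy (f l) (a l))) s2) => x; rewrite /first_functional.
    have -> : (fun l0 => copy (f l0) (upd a l x l0)) =
        upd (fun l => copy (f l) (a l)) l (copy (f l) x) :> (L -> mcar (FM F M)).
      by apply/funext => k; rewrite /upd; case: eqP => // ->.
    by rewrite es map_cat /= !map_letter_upd // {1}/upd eqxx.
  split=> a l; have [s1 [s2 e]] := key a l; move=> *; rewrite !e.
  + have [i1 i2 i3] := inj1_hom (FM F M) B; have [c1 c2 c3] := copy_hom M (f l).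
    by rewrite c1 i1 ctxD // lD.
  + have [i1 i2 i3] := inj1_hom (FM F M) B; have [c1 c2 c3] := copy_hom M (f l).
    by rewrite c2 i2 ctxZ // lZ.
Qed.

(** Universality along the homomorphism of [FM_universal], which sends a letter of face [Q] to the
    copy of itself in face [Q]. *)
Lemma first_functionalE (A : mfalg F) (phi : mcar A -> C) (a : L -> mcar A) :
  valid_mf A -> lin phi -> (forall l, face A (f l) (a l)) ->
  P A B phi psi (lprod (map (letter a) s)) = first_functional phi a.
Proof.
move=> HA Hphi fa; have [HAa _ _] := HA.
have vM := FM_valid F HAa.
have [j [Hj jc fj]] := FM_universal HA; have [Hj1 _] := Hj.
have Htf : lin (fun x : mcar (FM F (mcar A)) => phi (fold x)).
  by apply: lin_comp => //; apply: fold_hom.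
transitivity (P A B (fun x => phi (fold (j x))) psi (lprod (map (letter a) s))).
  by congr (P _ _ _ _ _); apply/funext => x; rewrite fj.
have [_ huniv _ _] := HP.
rewrite (huniv _ _ _ _ j id (fun x => phi (fold x)) psi) //; try by [split].
congr (P _ _ _ _ _).
rewrite (hom_lprodn (h := map2 _ _)) //; try exact: fprod_alg.
  rewrite -map_comp; congr lprod; apply: eq_map => -[l|y] /=.
    by rewrite map2_inj1 // (jc (f l)).
  by rewrite map2_inj2.
exact: map2_hom.
Qed.

(** The replacement tool: it trades a lone letter for a multiple of a unit of [B1], and a unit of
    [A1] for a unit of a new factor. *)
Lemma first_uniq (A A' : mfalg F) phi phi' (a : L -> mcar A) (a' : L -> mcar A') :
  valid_mf A -> valid_mf A' -> lin phi -> lin phi' ->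
  (forall l, face A (f l) (a l)) -> (forall l, face A' (f l) (a' l)) ->
  (forall l w, uniq (l :: w) ->
     phi (lprod (map a (l :: w))) = phi' (lprod (map a' (l :: w)))) ->
  P A B phi psi (lprod (map (letter a) s)) = P A' B phi' psi (lprod (map (letter a') s)).
Proof.
move=> HA HA' Hp Hp' fa fa' e; rewrite !first_functionalE //.
have [HAa _ _] := HA; have [HAa' _ _] := HA'.
exact: (natml_uniq first_functional_natml).
Qed.

End FirstFactor.

Definition tr1 : matalg 1 -> C := wtrace (fun _ => 1).
(** Every face is a copy of the complex numbers. This is the smallest model with a unit of value 1
    in each face. *)
Definition B1 : mfalg F := FM F (matalg 1).
Definition delta (x : mcar B1) : C := tr1 (fold x).
Definition unit1 (Q : F) : mcar B1 := copy Q (1%:M : matalg 1).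

Lemma tr1_weights : weights (fun _ : 'I_1 => 1).
Proof. by split; [move=> _; apply: ler01|rewrite big_ord1]. Qed.
Lemma B1_valid : valid_mf B1. Proof. exact/FM_valid/matalg_is_alg. Qed.
Lemma delta_lin : lin delta.
Proof. by apply: lin_comp (wtrace_lin _); apply/fold_hom/matalg_is_alg. Qed.
Lemma delta_unit1 Q : delta (unit1 Q) = 1.
Proof.
rewrite /delta /unit1 fold_copy; first exact: (wtrace1 tr1_weights).
exact: matalg_is_alg.
Qed.

(** The erasing property in matrix models. The three positions of the unit are listed separately
    because the algebras have no element for the empty word. *)
Definition matrix_unit_erasing : Prop :=
  forall n (p : 'I_n -> C) Q, weights p ->
    let A := FM F (matalg n) in
    let phi (x : mcar A) := wtrace p (fold x) in
    let u := inj2 A B1 (unit1 Q) in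
    [/\ forall b, P A B1 phi delta (amul u (inj1 A B1 b)) = phi b,
        forall c, P A B1 phi delta (amul (inj1 A B1 c) u) = phi c &
        forall c b, P A B1 phi delta (amul (amul (inj1 A B1 c) u) (inj1 A B1 b)) =
                    phi (amul c b)].

Lemma matrix_erase_word n (p : 'I_n -> C) Q (c b : seq (mcar (FM F (matalg n)))) :
  matrix_unit_erasing -> weights p -> c ++ b <> [::] ->
  let A := FM F (matalg n) in
  P A B1 (fun x => wtrace p (fold x)) delta
    (lprod (map (inj1 A B1) c ++ inj2 A B1 (unit1 Q) :: map (inj1 A B1) b)) =
  wtrace p (fold (lprod (c ++ b))).
Proof.
move=> MP pw ne A; have [m1 m2 m3] := MP n p Q pw.
have HA := fprod_alg A B1; have Hi := inj1_hom A B1.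
have HM : is_alg (mcar A) by apply/FM_alg/matalg_is_alg.
case: c ne => [|x c] ne.
  case: b ne => [//|y b] ne.
  by rewrite cat0s map_cons (lprod_cons HA) -map_cons -(hom_lprod _ _ Hi) m1.
case: b {ne} => [|y b].
  by rewrite map_cons (lprod_cat HA) -map_cons -(hom_lprod _ _ Hi) lprod1 m2 cats0.
rewrite !map_cons (lprod_cat HA) (lprod_cons HA) -!map_cons -!(hom_lprod _ _ Hi).
by rewrite (alg_mulA HA) m3 (lprod_cat HM).
Qed.

Definition in_faces (A : mfalg F) (x : mcar A) : Prop := exists Q, face A Q x.

(** The defect [D] of erasing is itself natural and multilinear in the letters, so by
    [natml_matrix0] it vanishes once it does in matrix models. *)
Lemma erase_word (A : mfalg F) phi Q (c b : seq (mcar A)) :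
  matrix_unit_erasing -> valid_mf A -> lin phi -> c ++ b <> [::] ->
  Forallp (@in_faces A) (c ++ b) ->
  P A B1 phi delta
    (lprod (map (inj1 A B1) c ++ inj2 A B1 (unit1 Q) :: map (inj1 A B1) b)) =
  phi (lprod (c ++ b)).
Proof.
move=> MP HA Hphi; have [N [a [c0 [b0 [ucb fcb <- <-]]]]] := index_cat c b.
rewrite -map_cat => ne /Forallp_map Hf.
have l0 : 'I_N by case: (c0 ++ b0) ne => // i.
have af l : exists Q, face A Q (a l).
  have : exists i, (i < size (c0 ++ b0))%N /\ nth l0 (c0 ++ b0) i = l.
    by exists (index l (c0 ++ b0)); rewrite index_mem nth_index fcb.
  by move=> [i [hi <-]]; apply: (Forallp_nth l0 Hf hi).
pose f l := projT1 (cid (af l)).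
have Hfa l : face A (f l) (a l) by rewrite /f; case: cid.
pose s : seq ('I_N + mcar B1) := map inl c0 ++ inr (unit1 Q) :: map inl b0.
have es (A' : mfalg F) (a' : 'I_N -> mcar A') :
    map (letter a') s = map (inj1 A' B1) (map a' c0) ++
      inj2 A' B1 (unit1 Q) :: map (inj1 A' B1) (map a' b0).
  by rewrite /s map_cat /= -!map_comp.
have lefts_inl (t : seq 'I_N) : lefts (map (@inl _ (mcar B1)) t) = t.
  by elim: t => //= x t ->.
have ls : lefts s = c0 ++ b0.
  by rewrite /s /lefts pmap_cat /= -!/(lefts _) !lefts_inl.
have us : uniq (lefts s) by rewrite ls.
have fs l : l \in lefts s by rewrite ls.
have HB := B1_valid; have Hd := delta_lin.
rewrite -es (first_functionalE s HB Hd HA Hphi Hfa).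
pose D (M : alg) (tau : M -> C) (d : 'I_N -> M) :=
  first_functional delta f s tau d - 1 * tau (lprod (map d (c0 ++ b0))).
suff : D _ phi a = 0 by rewrite /D mul1r => /eqP; rewrite subr_eq0 => /eqP.
have [HAa _ _] := HA.
have Dn : natml D.
  have [n1 n2] := first_functional_natml f HB Hd us fs.
  split.
    move=> M N' h tau d HM HN Hh Ht; rewrite /D n1 //; congr (_ - _ * tau _).
    by rewrite hom_lprodn // -map_comp.
  move=> M tau HM Ht; apply: multilin_sub; first exact: n2.
  exact: word_multilin.
apply: (natml_matrix0 Dn) => // n p T pw.
rewrite /D /first_functional es matrix_erase_word //; last first.
  by rewrite -map_cat; case: (c0 ++ b0) ne.
rewrite -map_cat (hom_lprodn (h := fold)); first 1 last.
- exact/FM_alg/matalg_is_alg.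
- exact: matalg_is_alg.
- exact/fold_hom/matalg_is_alg.
rewrite -map_comp mul1r; apply/eqP; rewrite subr_eq0; apply/eqP.
congr (wtrace _ (lprod _)); apply: eq_map => l /=.
by rewrite fold_copy //; apply: matalg_is_alg.
Qed.

Lemma swap_word (A B : mfalg F) phi psi (s : seq (mcar A + mcar B)) :
  valid_mf A -> valid_mf B -> lin phi -> lin psi ->
  P A B phi psi (lprod (map (letter id) s)) =
  P B A psi phi (lprod (map (letter id)
    (map (fun x => match x with inl y => inr y | inr y => inl y end) s))).
Proof.
move=> HA HB Hp Hq; rewrite Hsym //; congr (P _ _ _ _ _).
rewrite (hom_lprodn (h := @fswap F A B)); try exact: fprod_alg.
  rewrite -!map_comp; congr lprod; apply: eq_map => -[x|x] /=.
    exact: fswap_inj1.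
  exact: fswap_inj2.
exact: fswap_hom.
Qed.

Lemma swap_single (A B : mfalg F) phi psi v (c b : seq (mcar A)) :
  valid_mf A -> valid_mf B -> lin phi -> lin psi ->
  P A B phi psi (lprod (map (inj1 A B) c ++ inj2 A B v :: map (inj1 A B) b)) =
  P B A psi phi (lprod (map (inj2 B A) c ++ inj1 B A v :: map (inj2 B A) b)).
Proof.
move=> HA HB Hp Hq.
have := swap_word (map inl c ++ inr v :: map inl b) HA HB Hp Hq.
by rewrite !map_cat /= -!map_comp.
Qed.

(** [v] is the only letter of its factor, so its only repetition-free moment is [psi v], which
    [psi v] times a unit of [B1] shares. The swap puts this factor first, where [first_uniq]
    applies. *)
Lemma reduce_single (A B : mfalg F) phi psi Q v (c b : seq (mcar A)) :
  valid_mf A -> valid_mf B -> lin phi -> lin psi -> face B Q v ->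
  P A B phi psi (lprod (map (inj1 A B) c ++ inj2 A B v :: map (inj1 A B) b)) =
  psi v * P A B1 phi delta
    (lprod (map (inj1 A B1) c ++ inj2 A B1 (unit1 Q) :: map (inj1 A B1) b)).
Proof.
move=> HA HB Hp Hq Fv; rewrite swap_single //.
pose s : seq (unit + mcar A) := map inr c ++ inl tt :: map inr b.
have es (B' : mfalg F) (v' : mcar B') :
    map (letter (fun _ : unit => v')) s =
    map (inj2 B' A) c ++ inj1 B' A v' :: map (inj2 B' A) b.
  by rewrite /s map_cat /= -!map_comp.
have ls : lefts s = [:: tt].
  have lr (t : seq (mcar A)) : lefts (map (@inr unit _) t) = [::] by elim: t.
  by rewrite /s /lefts pmap_cat /= -!/(lefts _) !lr.
have [d1 d2] := delta_lin; have HB1 := B1_valid.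
have [l1 l2] := up_lin HA HB1 Hp delta_lin.
have [i1 i2 i3] := inj2_hom A B1.
have HU : face B1 Q (unit1 Q) by apply: copy_face.
have FU : face B1 Q (ascale (psi v) (unit1 Q)).
  by have [_ FS _] := HB1; have [_ _ fz _] := FS Q; apply: fz; apply: HU.
have us : uniq (lefts s) by rewrite ls.
have fs l : l \in lefts s by rewrite ls; case: l.
rewrite -es (first_uniq (f := fun _ => Q) (a' := fun _ => ascale (psi v) (unit1 Q))
  (phi' := delta) HA Hp us fs HB HB1 Hq delta_lin) //; last first.
- move=> [] [|[] w] //= _.
  by rewrite d2 delta_unit1 mulr1.
- rewrite es -(swap_single _ _ _ HA HB1 Hp delta_lin).
  by rewrite i2 ctxZ ?l2 //; apply: fprod_alg.
Qed.

Lemma insert_word (A B : mfalg F) phi psi Q v (c b : seq (mcar A)) :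
  matrix_unit_erasing -> valid_mf A -> valid_mf B -> lin phi -> lin psi ->
  face B Q v -> c ++ b <> [::] -> Forallp (@in_faces A) (c ++ b) ->
  P A B phi psi (lprod (map (inj1 A B) c ++ inj2 A B v :: map (inj1 A B) b)) =
  psi v * phi (lprod (c ++ b)).
Proof.
by move=> MP HA HB Hp Hq Fv ne Hf; rewrite (reduce_single (Q := Q)) // erase_word.
Qed.

Lemma insert_word2 (A B : mfalg F) phi psi Q v (c b : seq (mcar A)) :
  matrix_unit_erasing -> valid_mf A -> valid_mf B -> lin phi -> lin psi ->
  face B Q v -> c ++ b <> [::] -> Forallp (@in_faces A) (c ++ b) ->
  P B A psi phi (lprod (map (inj2 B A) c ++ inj1 B A v :: map (inj2 B A) b)) =
  psi v * phi (lprod (c ++ b)).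
Proof.
by move=> MP HA HB Hp Hq Fv ne Hf; rewrite -swap_single // (insert_word (Q := Q)).
Qed.

End UniversalProduct.

Lemma lprod_pair (A : alg) (HA : is_alg A) (c b : seq A) x y :
  lprod (c ++ [:: x, y & b]) = lprod (c ++ amul x y :: b).
Proof. by rewrite !lprod_ctx. Qed.

Lemma ideal_gen_ideal (A : alg) (G : A -> Prop) : is_ideal (ideal_gen G).
Proof.
split.
- by move=> J [].
- by move=> x y hx hy J HJ HG; case: (HJ) => _ h _ _ _; apply: h; [apply: hx|apply: hy].
- by move=> c x hx J HJ HG; case: (HJ) => _ _ h _ _; apply: h; apply: hx.
- by move=> x y hy J HJ HG; case: (HJ) => _ _ _ h _; apply: h; apply: hy.
- by move=> x y hx J HJ HG; case: (HJ) => _ _ _ _ h; apply: h; apply: hx.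
Qed.

Lemma ideal_ctx (A : alg) (J : A -> Prop) (c b : seq A) x :
  is_alg A -> is_ideal J -> J x -> J (lprod (c ++ x :: b)).
Proof.
move=> HA [_ _ _ Jl Jr] Jx; rewrite lprod_ctx //.
have : J (foldl (@amul A) x b).
  by elim: b x Jx => //= y b IH x Jx; apply: IH; apply: Jr.
by elim: c => //= y c IH h; apply: Jl; apply: IH.
Qed.

Section Unital.
Variables (F : Type) (A : mfalg F) (u : F -> mcar A) (phi : mcar A -> C).
Hypotheses (HA : valid_mf A) (Hu : unit_family u) (Hphi : lin phi).
Hypothesis Hid : forall z,
  ideal_gen (fun w => exists q Q, w = asub (u q) (u Q)) z -> phi z = 0.

(** Modulo the ideal all units agree, so [u Q] may be exchanged for the unit of the face of a
    neighbouring letter, which absorbs it. *)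
Lemma unit_insert Q (c b : seq (mcar A)) : c ++ b <> [::] ->
  Forallp (fun x => exists Q, face A Q x) (c ++ b) ->
  phi (lprod (c ++ u Q :: b)) = phi (lprod (c ++ b)).
Proof.
have [HAa _ _] := HA.
have key q : phi (lprod (c ++ u Q :: b)) = phi (lprod (c ++ u q :: b)).
  apply/eqP; rewrite -subr_eq0 -linB //; apply/eqP/Hid.
  rewrite [asub (lprod _) _]/asub -(ctxZ HAa) -(ctxD HAa); apply: (@ideal_ctx _ (ideal_gen _)) => //.
    exact: ideal_gen_ideal.
  by move=> J _; apply; exists Q, q.
case: b key => [|y b] key.
  case/lastP: c key => [//|c y] key _; rewrite cats0 => Hf.
  have [q qy] : exists q, face A q y by move: Hf; rewrite -cats1 => /Forallp_cat [_ []].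
  rewrite (key q) cat_rcons lprod_pair //; have [_ /(_ y qy) [_ ->]] := Hu q.
  by rewrite cats1.
move=> _ /Forallp_cat [_ [[q qy] _]].
by rewrite (key q) lprod_pair //; have [_ /(_ y qy) [->]] := Hu q.
Qed.
End Unital.

Lemma index_split (T : Type) (c b : seq T) y :
  exists N (x : 'I_N -> T) (c0 b0 : seq 'I_N) i0,
    [/\ uniq (c0 ++ i0 :: b0), forall i, i \in c0 ++ i0 :: b0, map x c0 = c,
        x i0 = y & map x b0 = b].
Proof.
have [N [x [c0 [[|i0 b0] [ucb fcb ec eb]]]]] := index_cat c (y :: b) => //.
by case: eb => ? ?; exists N, x, c0, b0, i0.
Qed.

Lemma valid_span (F : Type) (A : mfalg F) : valid_mf A ->
  forall x, span (fun x => exists Q, face A Q x) x.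
Proof.
move=> HA; have [HAa _ _] := HA; apply: (valid_ind HA); first exact: span_subalg.
by move=> Q x Hx; apply: span_gen; exists Q.
Qed.

(** * From erasing to unit preservation *)

Section UnitPreserving.
Unset Implicit Arguments.
Variables (F : finType) (P : uprod F).
Set Implicit Arguments.
Hypotheses (HP : is_uprod P) (Hsym : symmetric_up P).
Hypothesis MP : matrix_unit_erasing P.

Section Pair.
Variables (A1 A2 : mfalg F) (u1 : F -> mcar A1) (phi1 : mcar A1 -> C) (phi2 : mcar A2 -> C).
Hypotheses (HA1 : valid_mf A1) (HA2 : valid_mf A2) (Hu1 : unit_family u1).
Hypotheses (Hp1 : lin phi1) (Hp2 : lin phi2).
Hypothesis Hid : forall z,
  ideal_gen (fun w => exists q Q, w = asub (u1 q) (u1 Q)) z -> phi1 z = 0.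
Hypothesis Hone : forall Q, phi1 (u1 Q) = 1.

Let T := (mcar A1 + mcar A2)%type.
Let lt : T -> mcar (fprod A1 A2) := letter (fun x => x).
Let in_face (x : T) : Prop :=
  match x with inl x => exists Q, face A1 Q x | inr y => exists Q, face A2 Q y end.

Lemma unit1_erase Q (c b : seq T) : c ++ b <> [::] -> Forallp in_face (c ++ b) ->
  P A1 A2 phi1 phi2 (lprod (map lt c ++ inj1 A1 A2 (u1 Q) :: map lt b)) =
  P A1 A2 phi1 phi2 (lprod (map lt (c ++ b))).
Proof.
have [N [x [c0 [b0 [i0 [ui fi <- ei <-]]]]]] := index_split c b (inl (u1 Q)).
move=> ne Hf.
have vB := B1_valid F; have lB := delta_lin F.
have v12 := fprod_valid HA1 HA2; have vB1 := fprod_valid vB HA1.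
have lP := up_lin HP HA1 HA2 Hp1 Hp2; have lQ := up_lin HP vB HA1 lB Hp1.
have [HA1a _ _] := HA1.
have Hx i : in_face (x i).
  have [->|ni] := eqVneq i i0.
    by rewrite ei; exists Q; case: (Hu1 Q).
  have : exists k, (k < size (c0 ++ b0))%N /\ nth i0 (c0 ++ b0) k = i.
    have icb : i \in c0 ++ b0.
      by have := fi i; rewrite !mem_cat inE (negbTE ni).
    by exists (index i (c0 ++ b0)); rewrite index_mem nth_index.
  move=> [k [hk <-]]; rewrite -map_cat in Hf; move/Forallp_map: Hf => Hf.
  exact: (Forallp_nth i0 Hf hk).
pose isl (t : T) := if t is inl _ then true else false.
(* The positions that hold letters of [A1], among them the position [i0] of the unit. *)
pose L := {i : 'I_N | isl (x i)}.
pose a (l : L) : mcar A1 := if x (val l) is inl z then z else azero.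
have i0L : isl (x i0) by rewrite ei.
pose l0 : L := exist _ i0 i0L.
have fa l : exists Q, face A1 Q (a l).
  by case: l => i; rewrite /a /=; move: (Hx i); case: (x i).
(* [u1 Q] may lie in several faces; at [l0] the face has to be [Q], where the replacement [unit1 Q]
   lies. *)
pose f (l : L) : F := if l == l0 then Q else projT1 (cid (fa l)).
have al0 : a l0 = u1 Q by rewrite /a /= ei.
have Hfa l : face A1 (f l) (a l).
  rewrite /f; case: eqP => [->|_]; last by case: cid.
  by rewrite al0; case: (Hu1 Q).
pose B := fprod (B1 F) A1.
pose a' (l : L) : mcar B :=
  if l == l0 then inj1 (B1 F) A1 (unit1 Q) else inj2 (B1 F) A1 (a l).
have Hfa' l : face B (f l) (a' l).
  rewrite /a'; have [->|nl] := eqVneq l l0.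
    rewrite /f eqxx; have [_ h] := inj1_mfhom (B1 F) A1; apply: h; exact: copy_face.
  by have [_ h] := inj2_mfhom (B1 F) A1; apply: h; apply: Hfa.
pose g (i : 'I_N) : L + mcar A2 :=
  if insub i is Some l then inl l else inr (if x i is inr y then y else azero).
pose s := map g (c0 ++ i0 :: b0).
have ls : lefts s = pmap insub (c0 ++ i0 :: b0).
  rewrite /s; elim: (_ ++ _) => //= i v <-; rewrite /g /lefts /=.
  by case: insub.
have us : uniq (lefts s) by rewrite ls pmap_sub_uniq.
have fs l : l \in lefts s by rewrite ls mem_pmap_sub fi.
have gE i : letter a (g i) = lt (x i).
  rewrite /g; case: insubP => [l _ lE|]; rewrite /= /a ?lE /lt.
    by move: (valP l); rewrite /= lE; case: (x i).
  by case: (x i).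
have -> : map lt (map x c0) ++ inj1 A1 A2 (u1 Q) :: map lt (map x b0) = map (letter a) s.
  have -> : inj1 A1 A2 (u1 Q) = letter a (g i0) by rewrite gE ei.
  rewrite /s map_cat map_cat /= -!map_comp.
  by congr (_ ++ _ :: _); apply: eq_map => i; rewrite /= gE.
(* The moments agree because the unit can be erased on both sides: in [A1] by [unit_insert], in the
   product of [B1] and [A1] by [insert_word2]. The word that consists of the unit alone has value 1
   on both sides. *)
rewrite (first_uniq HP HA2 Hp2 us fs HA1 vB1 Hp1 lQ Hfa Hfa'); last first.
  move=> k w ukw.
  have Fa v : Forallp (in_faces (A := A1)) (map a v).
    by apply/Forallp_map; apply: Forallp_all => l; exists (f l).
  have a'E v : l0 \notin v -> map a' v = map (inj2 (B1 F) A1) (map a v).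
    move=> nv; rewrite -map_comp; apply/eq_in_map => l lv /=.
    by rewrite /a'; case: eqP => // el; rewrite -el lv in nv.
  have [h|h] := boolP (l0 \in k :: w); last first.
    rewrite a'E // -(hom_lprod _ _ (inj2_hom _ _)) up_res2 //.
  move: ukw; case/splitPr: h => w1 w2.
  rewrite cat_uniq /= negb_or -andbA => /and5P [_ n1 _ n2 _].
  rewrite !map_cat /= al0 (a'E _ n1) (a'E _ n2) {1}/a' eqxx.
  have [e|ne2] := pselect (map a w1 ++ map a w2 = [::]).
    move: e; case: (w1) => // /=; case: (w2) => // _ /=.
    by rewrite up_res1 // delta_unit1.
  rewrite (insert_word2 HP Hsym (Q := Q)) //; last 2 first.
  - exact: copy_face.
  - by rewrite -map_cat.
  by rewrite delta_unit1 mul1r (unit_insert HA1) // -map_cat.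
(* After reassociation the new unit is the only letter of the factor [B1], and [insert_word2] erases
   it next to the product of [A1] and [A2]. *)
have [_ _ hassoc _] := HP; rewrite hassoc // (hom_lprodn (h := @fassoc _ _ _ _)).
all: try exact: fprod_alg.
2: exact: fassoc_hom.
have a's i : fassoc (letter a' (g i)) =
    if i == i0 then inj1 (B1 F) (fprod A1 A2) (unit1 Q)
    else inj2 (B1 F) (fprod A1 A2) (lt (x i)).
  rewrite -gE /g; case: insubP => [l _ lE|] /=.
    rewrite /a' -(inj_eq val_inj) lE /=; case: eqP => _.
      exact: fassoc_inj1.
    exact: fassoc_inj2.
  case: eqP => [->|_ _]; first by rewrite i0L.
  exact: fassoc_inj3.
have ne0 : map lt (map x c0) ++ map lt (map x b0) <> [::].
  by rewrite -map_cat; case: (_ ++ _) ne.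
have mapE v : i0 \notin v -> map (@fassoc _ _ _ _ \o (letter a' \o g)) v =
    map (inj2 (B1 F) (fprod A1 A2)) (map lt (map x v)).
  move=> nv; rewrite -!map_comp; apply/eq_in_map => i iv /=.
  by rewrite a's; case: eqP => // e; rewrite -e iv in nv.
rewrite /s -!map_comp map_cat map_cons.
move: ui; rewrite cat_uniq /= negb_or -andbA => /and5P [_ n1 _ n2 _].
rewrite (mapE _ n1) (mapE _ n2) /= a's eqxx (insert_word2 HP Hsym (Q := Q)) //.
- by rewrite delta_unit1 mul1r map_cat.
- exact: copy_face.
- rewrite -!map_cat; apply/Forallp_map/Forallp_map/Forallp_all => i.
  move: (Hx i); case: (x i) => y [q qy]; exists q.
    by have [_ h] := inj1_mfhom A1 A2; apply: h.
  by have [_ h] := inj2_mfhom A1 A2; apply: h.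
Qed.

Lemma fprod_span z : span (fun z => exists2 x, in_face x & z = lt x) z.
Proof.
have Hspan := span_subalg (fun z => exists2 x, in_face x & z = lt x) (fprod_alg A1 A2).
move: z; apply: fprod_ind => //.
- move=> x; elim: (valid_span HA1 x) => {x} [x s Hs||x y _ sx _ sy|c x _ sx].
  + rewrite (hom_lprod _ _ (inj1_hom _ _)); apply: span_word.
    have -> : inj1 A1 A2 x :: map (inj1 A1 A2) s = map (fun y => lt (inl y)) (x :: s) by [].
    apply/Forallp_map; elim: (x :: s) Hs => //= y v IH [Hy Hv].
    by split; [exists (inl y)|apply: IH].
  + rewrite (hom0 _ (fprod_alg A1 A2) (inj1_hom _ _)); first exact: span_zero.
    by case: HA1.
  + by have [-> _ _] := inj1_hom A1 A2; apply: span_add.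
  + by have [_ -> _] := inj1_hom A1 A2; apply: span_scale.
- move=> x; elim: (valid_span HA2 x) => {x} [x s Hs||x y _ sx _ sy|c x _ sx].
  + rewrite (hom_lprod _ _ (inj2_hom _ _)); apply: span_word.
    have -> : inj2 A1 A2 x :: map (inj2 A1 A2) s = map (fun y => lt (inr y)) (x :: s) by [].
    apply/Forallp_map; elim: (x :: s) Hs => //= y v IH [Hy Hv].
    by split; [exists (inr y)|apply: IH].
  + rewrite (hom0 _ (fprod_alg A1 A2) (inj2_hom _ _)); first exact: span_zero.
    by case: HA2.
  + by have [-> _ _] := inj2_hom A1 A2; apply: span_add.
  + by have [_ -> _] := inj2_hom A1 A2; apply: span_scale.
Qed.

Let Phi := P A1 A2 phi1 phi2.
Let words s : Forallp (fun z => exists2 x, in_face x & z = lt x) s ->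
  exists2 t, Forallp in_face t & s = map lt t.
Proof.
elim: s => [|z s IH] /=; first by exists [::].
by move=> [[x Hx ->] /IH [t Ht ->]]; exists (x :: t).
Qed.

Lemma unit1_erase_all Q : let U := inj1 A1 A2 (u1 Q) in
  [/\ forall x, Phi (amul x U) = Phi x, forall y, Phi (amul U y) = Phi y &
      forall x y, Phi (amul (amul x U) y) = Phi (amul x y)].
Proof.
move=> U; have HA := fprod_alg A1 A2; have [lD lZ] := up_lin HP HA1 HA2 Hp1 Hp2.
have l0 := lin0 HA (up_lin HP HA1 HA2 Hp1 Hp2).
split.
- move=> x; elim: (fprod_span x) => {x} [x s Hs||x y _ sx _ sy|c x _ sx].
  + have [[|x' s'] Ht // e] := words Hs; rewrite /Phi e.
    have := unit1_erase Q (c := x' :: s') (b := [::]).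
    rewrite cats0 => <- //; by rewrite map_cons (lprod_cat HA).
  + by rewrite alg_mul0r // /Phi l0.
  + by rewrite (alg_mulDl HA) /Phi !lD; congr (_ + _).
  + by rewrite -(alg_mulZl HA) /Phi !lZ; congr (_ * _).
- move=> x; elim: (fprod_span x) => {x} [x s Hs||x y _ sx _ sy|c x _ sx].
  + have [[|x' s'] Ht // e] := words Hs; rewrite /Phi e.
    have := unit1_erase Q (c := [::]) (b := x' :: s').
    rewrite cat0s => <- //; by rewrite map_cons cat0s (lprod_cons HA).
  + by rewrite alg_mulr0 // /Phi l0.
  + by rewrite (alg_mulDr HA) /Phi !lD; congr (_ + _).
  + by rewrite -(alg_mulZr HA) /Phi !lZ; congr (_ * _).
- move=> x y; elim: (fprod_span x) => {x} [x s Hs||x x' _ sx _ sx'|c x _ sx].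
  + have [[|x1 s1] Ht // e] := words Hs; rewrite /Phi e.
    elim: (fprod_span y) => {y} [y v Hv||y y' _ sy _ sy'|c y _ sy].
    * have [[|y1 v1] Hu // e'] := words Hv; rewrite e'.
      have := unit1_erase Q (c := x1 :: s1) (b := y1 :: v1).
      rewrite map_cat !map_cons -(lprod_cat HA) => <- //; last first.
        by apply/Forallp_cat.
      by rewrite (lprod_cat HA) (lprod_cons HA) (alg_mulA HA).
    * by rewrite !alg_mulr0.
    * by rewrite !(alg_mulDr HA) /Phi !lD; congr (_ + _).
    * by rewrite -!(alg_mulZr HA) /Phi !lZ; congr (_ * _).
  + by rewrite !alg_mul0r.
  + by rewrite !(alg_mulDl HA) /Phi !lD; congr (_ + _).
  + by rewrite -!(alg_mulZl HA) /Phi !lZ; congr (_ * _).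
Qed.

End Pair.

Lemma erasing_unit_preserving : unit_preserving P.
Proof.
move=> A1 A2 u1 u2 p1 p2 HA1 HA2 Hu1 Hu2 Hp1 Hp2 Hi1 Ho1 Hi2 Ho2 U.
have HA := fprod_alg A1 A2; have lP := up_lin HP HA1 HA2 Hp1 Hp2.
have U1 (i : bool) Q : P A1 A2 p1 p2 (U i Q) = 1.
  by case: i; rewrite /U; [rewrite up_res1|rewrite up_res2].
split=> //.
have er (i : bool) Q : let V := U i Q in
  [/\ forall x, P A1 A2 p1 p2 (amul x V) = P A1 A2 p1 p2 x,
      forall y, P A1 A2 p1 p2 (amul V y) = P A1 A2 p1 p2 y &
      forall x y, P A1 A2 p1 p2 (amul (amul x V) y) = P A1 A2 p1 p2 (amul x y)].
  case: i; rewrite /U; first exact: (unit1_erase_all HA1 HA2 Hu1 Hp1 Hp2 Hi1 Ho1).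
  have [e1 e2 e3] := unit1_erase_all HA2 HA1 Hu2 Hp2 Hp1 Hi2 Ho2 Q.
  have [s1 s2 s3] := fswap_hom A1 A2.
  have sw z : P A1 A2 p1 p2 z = P A2 A1 p2 p1 (fswap z) by apply: Hsym.
  by split=> *; rewrite !sw !s3 fswap_inj2 ?e1 ?e2 ?e3.
move=> z Hz.
(* The largest ideal on which the product functional vanishes, so it suffices to find the generators
   in it. *)
pose J z := [/\ P A1 A2 p1 p2 z = 0, forall x, P A1 A2 p1 p2 (amul x z) = 0,
  forall y, P A1 A2 p1 p2 (amul z y) = 0 &
  forall x y, P A1 A2 p1 p2 (amul (amul x z) y) = 0].
suff [//] : J z; have [lD lZ] := lP; have l0 := lin0 HA lP; apply: Hz.
- split.
  + by split=> *; rewrite ?(alg_mulr0 HA) ?(alg_mul0r HA).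
  + move=> x y [x1 x2 x3 x4] [y1 y2 y3 y4].
    by split=> *; rewrite ?(alg_mulDr HA) ?(alg_mulDl HA) lD ?x1 ?x2 ?x3 ?x4 ?y1 ?y2 ?y3 ?y4 addr0.
  + move=> c x [x1 x2 x3 x4].
    by split=> *; rewrite -?(alg_mulZr HA) -?(alg_mulZl HA) lZ ?x1 ?x2 ?x3 ?x4 mulr0.
  + move=> x y [y1 y2 y3 y4]; split=> *; rewrite ?y2 ?y4 //.
      by rewrite (alg_mulA HA).
    by rewrite (alg_mulA HA).
  + move=> x y [x1 x2 x3 x4]; split=> *; rewrite ?x3 ?(alg_mulA HA) //.
      by rewrite -(alg_mulA HA).
    by rewrite -(alg_mulA HA).
- move=> _ [i [j [q [Q ->]]]].
  have [a1 a2 a3] := er i q; have [b1 b2 b3] := er j Q.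
  rewrite /asub; split=> *; rewrite ?(alg_mulDr HA) ?(alg_mulDl HA) lD
    -?(alg_mulZr HA) -?(alg_mulZl HA) lZ mulN1r ?U1 ?a1 ?a2 ?a3 ?b1 ?b2 ?b3 ?subrr //.
Qed.

End UnitPreserving.

(** * Highest coefficients *)

Lemma derive1_scale (f : CN -> CN) (c : CN) :
  @derive1 CN CN (fun s : CN => c * f s) 0 = c * @derive1 CN CN f 0.
Proof.
have [->|c0] := eqVneq c 0.
  by rewrite mul0r derive1E; under eq_fun do rewrite mul0r; rewrite derive_cst.
rewrite /derive1.
set g := fun h : CN => h^-1 *: (f (h + 0) - f 0) : CN.
transitivity (lim ((fun h : CN => c * g h) @ 0^')%classic).
  congr (lim (_ @ 0^')%classic); apply/funext => h.
  by rewrite -[LHS]/(h^-1 * (c * f (h + 0) - c * f 0)) -mulrBr mulrCA.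
have [cg|ncg] := pselect (cvg (g @ 0^')%classic).
  exact: (@limZl_tmp CN CN _ _ _ c g cg).
have ncg' : ~ cvg ((fun h : CN => c * g h) @ 0^')%classic.
  by have := @is_cvgZlE CN CN _ _ _ c g c0 => /= ->.
(* without a limit, both sides are the default value, which is 0 *)
by rewrite (dvgP ncg) (dvgP ncg') -[point]/(0 : C) mulr0.
Qed.

Lemma derive1_linear (K : CN) : @derive1 CN CN (fun s : CN => s * K) 0 = K.
Proof.
rewrite /derive1; apply: (@cvg_lim CN); first exact: norm_hausdorff.
have : ((fun h : CN => K) @ 0^' --> K)%classic by apply: cvg_cst.
apply: cvg_trans; apply: near_eq_cvg; near=> h.
rewrite addr0 mul0r subr0 scalerA mulVf ?scale1r //.
by near: h; exact: nbhs_dnbhs_neq.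
Unshelve. all: by end_near.
Qed.

Lemma dmix_scale k (c : C) g : dmix k (fun t => c * g t) = c * dmix k g.
Proof.
elim: k g => [|k IH] g //=; rewrite -derive1_scale; congr (@derive1 CN CN _ 0).
by apply/funext => s; rewrite IH.
Qed.

(** This removes from a mixed derivative a variable in which the product is linear, such as that of
    a singleton block numbered last. *)
Lemma dmix_last k (g : (nat -> C) -> C) :
  (forall s t, g (fun j => if j == k then s else t j) = g t) ->
  dmix k.+1 (fun t => t k * g t) = dmix k g.
Proof.
move=> Hg; rewrite /= -[RHS]derive1_linear; congr (@derive1 CN CN _ 0); apply/funext => s.
rewrite eqxx -dmix_scale; congr (dmix k _); apply/funext => t.
by rewrite Hg.
Qed.

Section HighestCoeffs.
Unset Implicit Arguments.
Variables (F : finType) (P : uprod F) (alpha : coeffs F).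
Set Implicit Arguments.
Hypotheses (HP : is_uprod P) (Hsym : symmetric_up P) (Hal : highest_coeffs P alpha).

Lemma preim_13_2 : preim_partition (fun i : 'I_3 => (i == inord 1 : nat)) [set: 'I_3] = pi_13_2.
Proof.
have v1 : (inord 1 : 'I_3) = 1%N :> nat by rewrite inordK.
have cE (x : 'I_3) :
    [set y in [set: 'I_3] | (x == inord 1 : nat) == (y == inord 1 : nat)] =
    if x == inord 1 then [set inord 1] else [set inord 0; inord 2].
  apply/setP => y; rewrite !inE; case: ifP => x1; rewrite !inE.
    by rewrite /=; case: (y == inord 1).
  rewrite -!val_eqE /= v1 !inordK //; case: y => -[|[|[|]]] //.
rewrite /preim_partition /equivalence_partition /pi_13_2.
apply/setP => B; rewrite !inE; apply/imsetP/orP.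
- by move=> [x _ ->]; rewrite cE; case: ifP; [right|left].
- case=> /eqP ->; [exists (inord 0)|exists (inord 1)]; rewrite ?inE // cE ?eqxx //.
  by rewrite -val_eqE /= v1 inordK.
Qed.

(** The coefficient [nu] determines an actual value of the product here, because for [x] and [y] of
    mean zero this value is linear in each of the two functionals. *)
Lemma nu_formula (M : alg) (tau : M -> C) Q x y :
  nu_one alpha -> is_alg M -> lin tau -> tau x = 0 -> tau y = 0 ->
  let A := FM F M in
  P A (B1 F) (fun z => tau (fold z)) (@delta F)
    (lprod [:: inj1 A (B1 F) (copy Q x); inj2 A (B1 F) (unit1 Q);
               inj1 A (B1 F) (copy Q y)]) = tau (amul x y).
Proof.
move=> nu HM Ht tx ty A.
have vB := B1_valid F; have lB := delta_lin F.
pose s : seq (bool + mcar (B1 F)) := [:: inl true; inr (unit1 Q); inl false].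
have us : uniq (lefts s) by [].
have fs l : l \in lefts s by case: l.
pose f (_ : bool) := Q.
pose D (N : alg) (sig : N -> C) (d : bool -> N) :=
  first_functional P (@delta F) f s sig d - 1 * sig (lprod (map d [:: true; false])).
pose a b := if b then x else y.
suff : D _ tau a = 0.
  by rewrite /D mul1r => /eqP; rewrite subr_eq0 => /eqP.
have fn := first_functional_natml HP f vB lB us fs.
have Dn : natml D.
  have [n1 n2] := fn; split.
    move=> N N' h sig d HN HN' Hh Hs; rewrite /D n1 //; congr (_ - _ * sig _).
    by rewrite hom_lprodn // -map_comp.
  move=> N sig HN Hs; apply: multilin_sub; first exact: n2.
  by apply: word_multilin => //; case.
apply: (natml_partition0 Dn HM Ht) => W HW N sig b HN Hs mom.
have sb l : sig (b l) = 0.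
  rewrite -[b l]/(lprod (map b [:: l])) mom //; case: eqP => // e.
  by case: l {e}; rewrite /moment /= ?tx ?ty.
rewrite /D mul1r; apply/eqP; rewrite subr_eq0; apply/eqP.
pose Af (k : nat) : mfalg F := if k is 0 then FM F N else B1 F.
pose ph k : mcar (Af k) -> C :=
  match k return mcar (Af k) -> C with 0 => fun z => sig (fold z) | _.+1 => @delta F end.
pose xs k (l : 'I_3) : mcar (Af k) :=
  match k return mcar (Af k) with
  | 0 => copy Q (if l == inord 0 then b true else b false)
  | _.+1 => unit1 Q end.
pose bb (i : 'I_3) : nat := (i == inord 1).
have vN := FM_valid F HN.
have lsf : lin (fun z : mcar (FM F N) => sig (fold z)).
  by apply: lin_comp => //; apply: fold_hom.
have e3 : enum 'I_3 = [:: inord 0; inord 1; inord 2].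
  apply: (inj_map val_inj); rewrite val_enum_ord /=; by rewrite !inordK.
have n02 : (inord 0 == inord 1 :> 'I_3) = false by rewrite -val_eqE /= !inordK.
have n21 : (inord 2 == inord 1 :> 'I_3) = false by rewrite -val_eqE /= !inordK.
have n20 : (inord 2 == inord 0 :> 'I_3) = false by rewrite -val_eqE /= !inordK.
have lst : [seq emb Af 1 (bb l) (xs (bb l) l) | l <- enum 'I_3] =
    map (letter (fun l => copy Q (b l))) s.
  by rewrite e3 /= /bb n02 n21 eqxx /= n20 eqxx.
have dl : delta (unit1 Q) = 1 := delta_unit1 Q.
have facQ z : face (FM F N) Q (copy Q z) by apply: copy_face.
have fac1 : face (B1 F) Q (unit1 Q) by apply: copy_face.
have K t0 t1 : P (FM F N) (B1 F) (fun z => t0 * sig (fold z)) (fun z => t1 * delta z)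
      (lprod (map (letter (fun l => copy Q (b l))) s)) =
    t1 * (t0 * first_functional P (@delta F) f s sig b).
  have lt0 := lin_scale t0 lsf; have lt0' := lin_scale t0 Hs.
  have lt1 := lin_scale t1 lB.
  have /= -> := reduce_single HP Hsym [:: copy Q (b true)] [:: copy Q (b false)] vN vB lt0 lt1 fac1.
  rewrite dl mulr1; congr (_ * _).
  have [n1 n2] := fn; have ml := n2 N sig HN Hs.
  (* Scaling [sig] by [t0] acts on repetition-free moments as scaling the single letter [b true]:
     one-letter words have value 0, and both two-letter words contain that letter. *)
  rewrite -[in RHS](upd_id b true) -(mlZ ml).
  rewrite -[LHS]/(first_functional P (@delta F) f s (fun z => t0 * sig z) b).
  apply: (natml_uniq fn HN HN lt0' Hs) => l w ulw.
  have [_ sZ] := Hs.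
  case: w ulw => [|l' [|l'' w]].
  - by move=> _; rewrite !lprod1 sb /upd; case: eqP => _; rewrite ?sZ sb mulr0.
  - case: l l' => [] [] // _; rewrite /= /upd /= -?(alg_mulZl HN) -?(alg_mulZr HN) sZ //.
  - by move: l l' l'' => [] [] [] /=; rewrite ?inE ?eqxx ?orbT ?andbF ?andFb /=.
(* A function linear in both variables is recovered from its mixed derivative at 0. *)
transitivity (dmix 2 (fun t => t 1%N * (t 0%N * first_functional P (@delta F) f s sig b))).
  by rewrite !dmix_last.
transitivity (dmix 2 (fun t => iphi P (fun k y => t k * ph k y) 1
   (lprod [seq emb Af 1 (bb l) (xs (bb l) l) | l <- enum 'I_3]))).
  by congr (dmix 2 _); apply/funext => t; rewrite lst -K.
rewrite (Hal (k := 2) (A := Af) (phi := ph) (f := fun _ => Q) (b := bb) (x := xs)) //.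
- rewrite preim_13_2 (nu Q) // mul1r e3 big_ord_recl big_ord1 /= /bb n02 n21 eqxx /= n20 eqxx.
  have fh := fold_hom F HN; have [_ _ fM] := fh.
  by rewrite dl mulr1 fM !fold_copy.
- by case=> [|[|]].
- by case=> [|[|]].
- by move=> l; rewrite /bb; case: eqP.
- by case=> [|[|]] // _; [exists (inord 0)|exists (inord 1)]; rewrite /bb ?n02 ?eqxx.
- by move=> l; rewrite /bb; case: eqP => _; [exact: fac1|exact: facQ].
Qed.

End HighestCoeffs.

(** * From unit preservation to erasing *)

Definition munit n : matalg n := (1%:M : 'M[C]_n).

(** Modulo the ideal of unit differences, [u] equals the unit [e] of the face [Q] of [A], and [e]
    disappears under [fold], through which [phi] factors. *)
Lemma unit_preserving_erasing (F : finType) (P : uprod F) :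
  is_uprod P -> unit_preserving P -> matrix_unit_erasing P.
Proof.
move=> HP up n p Q pw A phi u.
have HM := matalg_is_alg n; have H1 := matalg_is_alg 1.
have vA := FM_valid F HM; have vB := B1_valid F; have lB := delta_lin F.
have lphi : lin phi by apply: lin_comp (wtrace_lin _); apply: fold_hom.
have unitM m : forall x : matalg m, amul (munit m) x = x /\ amul x (munit m) = x.
  by move=> x; rewrite /munit /= mul1mx mulmx1.
(* [fold] sends all copies of the identity to the same matrix, so its kernel is an ideal that
   contains their differences. *)
have kill m (q : 'I_m -> C) : weights q -> forall z : mcar (FM F (matalg m)),
    ideal_gen (fun w => exists q Q : F, w = asub (copy q (munit m)) (copy Q (munit m))) z ->
    wtrace q (fold z) = 0.
  move=> _ z Hz; have Hm := matalg_is_alg m.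
  have fh := fold_hom F Hm; have [f1 f2 f3] := fh.
  suff -> : fold z = azero by apply: (lin0 Hm (wtrace_lin _)).
  apply: (Hz (fun z => fold z = azero)).
    split; first exact: (hom0 (FM_alg F Hm) Hm fh).
    - by move=> x y ex ey; rewrite f1 ex ey (alg_add0 Hm).
    - by move=> c x ex; rewrite f2 ex alg_scaler0.
    - by move=> x y ey; rewrite f3 ey alg_mulr0.
    - by move=> x y ey; rewrite f3 ey alg_mul0r.
  by move=> _ [q1 [q2 ->]]; rewrite /asub f1 f2 !fold_copy // (alg_addN Hm).
have one m (q : 'I_m -> C) R : weights q -> wtrace q (fold (copy R (munit m) : mcar (FM F (matalg m)))) = 1.
  by move=> qw; rewrite fold_copy ?wtrace1 //; apply: matalg_is_alg.
have [||||h1 _] := up A (B1 F) (fun q => copy q (munit n)) (@unit1 F) phi (@delta F)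
  vA vB (unit_FM HM (unitM n)) (unit_FM H1 (unitM 1%N)) lphi lB.
- exact: kill.
- by move=> R; apply: one.
- by apply: kill; apply: tr1_weights.
- exact: delta_unit1.
have lP := up_lin HP vA vB lphi lB; have HAB := fprod_alg A (B1 F).
pose e := inj1 A (B1 F) (copy Q (munit n)).
pose gens (w : mcar (fprod A (B1 F))) := exists (i j : bool) (q R : F),
   w = asub (if i then inj1 A (B1 F) (copy q (munit n)) else inj2 A (B1 F) (unit1 q))
            (if j then inj1 A (B1 F) (copy R (munit n)) else inj2 A (B1 F) (unit1 R)).
have ideal := @ideal_gen_ideal (mcar (fprod A (B1 F))) gens.
case: ideal => _ _ _ idl idr.
have ue : ideal_gen gens
   (asub u e).
  by move=> J _; apply; exists false, true, Q, Q.
have [i1 i2 i3] := inj1_hom A (B1 F).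
have [f1 f2 f3] := fold_hom F HM.
have asubMl x y z : amul x (asub y z) = asub (amul x y) (amul x z) :> mcar (fprod A (B1 F)).
  by rewrite /asub (alg_mulDr HAB) (alg_mulZr HAB).
have asubMr x y z : amul (asub y z) x = asub (amul y x) (amul z x) :> mcar (fprod A (B1 F)).
  by rewrite /asub (alg_mulDl HAB) (alg_mulZl HAB).
have fe : fold (copy Q (munit n) : mcar A) = munit n by rewrite fold_copy.
have val x : P A (B1 F) phi (@delta F) (inj1 A (B1 F) x) = phi x by rewrite up_res1.
have eq0 x y : ideal_gen gens
   (asub x y) -> P A (B1 F) phi (@delta F) x = P A (B1 F) phi (@delta F) y.
  by move=> /h1; rewrite (linB lP) => /eqP; rewrite subr_eq0 => /eqP.
split.
- move=> b; rewrite (eq0 _ (amul e (inj1 A (B1 F) b))); last first.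
    by rewrite -asubMr; apply: idr.
  by rewrite /e -i3 val /phi f3 fe; have [-> _] := unitM n (fold b).
- move=> c; rewrite (eq0 _ (amul (inj1 A (B1 F) c) e)); last first.
    by rewrite -asubMl; apply: idl.
  by rewrite /e -i3 val /phi f3 fe; have [_ ->] := unitM n (fold c).
- move=> c b; rewrite (eq0 _ (amul (amul (inj1 A (B1 F) c) e) (inj1 A (B1 F) b))); last first.
    by rewrite -asubMr; apply: idr; rewrite -asubMl; apply: idl.
  by rewrite /e -!i3 val /phi !f3 fe; have [_ ->] := unitM n (fold c).
Qed.

(** * Positivity and null vectors *)

Lemma affine_ge0 (M b c : C) : 0 <= M ->
  (forall z : C, 0 <= M + z * b + z^* * c) -> b = 0 /\ c = 0.
Proof.
move=> M0 H.
(* On the real multiples of [w] the expression is affine in the real parameter and bounded below,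
   hence constant. Then [w = 1] and [w = 'i] separate [b] from [c]. *)
have key w : w * b + w^* * c = 0.
  set s := w * b + w^* * c; have [//|s0] := eqVneq s 0.
  have sr : s \is Num.real.
    have -> : s = (M + s) - M by rewrite addrAC subrr add0r.
    by rewrite rpredB ?ger0_real // /s addrA.
  (* Chosen so that [M + t * s = -1]. *)
  pose t := - ((M + 1) / s).
  have tr : t^* = t.
    by apply: conj_Creal; rewrite rpredN rpredM ?rpredV // rpredD ?rpred1 ?ger0_real.
  have := H (t * w); rewrite rmorphM /= tr -addrA -!mulrA -mulrDr -/s /t mulNr divfK //.
  by rewrite opprD addrA subrr add0r oppr_ge0 ler10.
have k1 := key 1; have ki := key 'i.
rewrite conjC1 !mul1r in k1; rewrite conjCi mulNr -mulrBr in ki.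
move/eqP: ki; rewrite mulf_eq0 (negbTE (neq0Ci _)) /= subr_eq0 => /eqP e.
rewrite e -mulr2n in k1; move/eqP: k1; rewrite mulrn_eq0 /= => /eqP c0.
by rewrite e c0.
Qed.

Section NullVector.
Variables (F : Type) (A : mfsalg F) (Phi : mcar (sbase A) -> C).
Hypotheses (HA : valid_mfs A) (HPhi : rstate Phi).
Local Notation "x ^s" := (sstar A x) (at level 2, format "x ^s").

(* Cauchy-Schwarz: a null vector (l, a) of the unitization is orthogonal to everything. *)
Lemma null_vector (l : C) (a : mcar (sbase A)) :
  l^* * l + l^* * Phi a + l * Phi (a^s) + Phi (amul (a^s) a) = 0 ->
  forall y, l * Phi y + Phi (amul y a) = 0 /\ l^* * Phi y + Phi (amul (a^s) y) = 0.
Proof.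
have [[Ha _ _] [sD [sZ [sM [sK _]]]]] := HA; have [[lD lZ] pos] := HPhi.
move=> N0.
have key b : l * Phi (b^s) + Phi (amul (b^s) a) = 0 /\ l^* * Phi b + Phi (amul (a^s) b) = 0.
  apply: (@affine_ge0 (Phi (amul (b^s) b))).
    by have := pos 0 b; rewrite conjC0 !mul0r !add0r.
  (* The vector [b] is perturbed by [z] times the null vector. The term in [z^* * z] vanishes by
     [N0], which leaves an expression for [affine_ge0]. *)
  move=> z; have := pos (z * l) (aadd b (ascale z a)).
  rewrite sD sZ (alg_mulDl Ha) !(alg_mulDr Ha) -!(alg_mulZl Ha) -!(alg_mulZr Ha).
  rewrite !lD !lZ ?lD ?lZ rmorphM /=.
  set e1 := _ + _; set e2 := _ + _ ; suff -> : e1 = e2 by [].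
  rewrite -[e2]addr0 -(mulr0 (z^* * z)) -N0 {N0}/e1 /e2.
  ring.
by move=> y; have [_ h] := key y; have [h' _] := key (y^s); rewrite sK in h'.
Qed.
End NullVector.

Definition mstar n (T : matalg n) : matalg n := (map_mx Num.conj (T : 'M[C]_n))^T.

Lemma mstarD n (x y : matalg n) : mstar (aadd x y) = aadd (mstar x) (mstar y).
Proof. by apply/matrixP => i j; rewrite !mxE rmorphD. Qed.
Lemma mstarZ n (c : C) (x : matalg n) : mstar (ascale c x) = ascale (c^*) (mstar x).
Proof. by apply/matrixP => i j; rewrite !mxE rmorphM. Qed.
Lemma mstarM n (x y : matalg n) : mstar (amul x y) = amul (mstar y) (mstar x).
Proof. by rewrite /mstar /= map_mxM trmx_mul. Qed.
Lemma mstarK n (x : matalg n) : mstar (mstar x) = x.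
Proof. by apply/matrixP => i j; rewrite !mxE conjCK. Qed.
Lemma mstar1 n : mstar (munit n) = munit n.
Proof. by rewrite /mstar /munit map_mx1 trmx1. Qed.

Lemma wtrace_star n (p : 'I_n -> C) (T : matalg n) : weights p ->
  wtrace p (mstar T) = (wtrace p T)^*.
Proof.
move=> [p0 _]; rewrite /wtrace rmorph_sum; apply: eq_bigr => i _ /=.
by rewrite rmorphM !mxE; congr (_ * _); apply/esym/conj_Creal/ger0_real.
Qed.

Lemma wtrace_pos n (p : 'I_n -> C) (T : matalg n) : weights p ->
  0 <= wtrace p (amul (mstar T) T).
Proof.
move=> [p0 _]; apply: sumr_ge0 => i _; apply: mulr_ge0 => //=.
by rewrite mxE; apply: sumr_ge0 => k _; rewrite !mxE mulrC mul_conjC_ge0.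
Qed.

Section MatrixStar.
Variables (F : finType) (n : nat).
Let s (q : F) (x : mcar (single (matalg n) q)) : mcar (single (matalg n) q) := mstar x.
Let HM := matalg_is_alg n.

Definition FMs : mfsalg F := MFSAlg (fstar (A := fun q => single (matalg n) q) s).

Let valid (q : F) : valid_mf (single (matalg n) q) := single_valid q HM.
Let sF (q Q : F) x : face (single (matalg n) q) Q x -> face (single (matalg n) q) Q (s x).
Proof.
case=> [->|->]; [by left|right].
by rewrite /s /mstar map_mx0 trmx0.
Qed.

Lemma FMs_valid : valid_mfs FMs.
Proof.
apply: (@FPm_mfs F F (fun q => single (matalg n) q) valid s).
- by move=> *; apply: mstarD.
- by move=> *; apply: mstarZ.
- by move=> *; apply: mstarM.
- by move=> *; apply: mstarK.
- exact: sF.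
Qed.

Lemma FMs_copy q x : sstar FMs (copy q x : mcar (FM F (matalg n))) = copy q (mstar x).
Proof.
apply: (@fstar_embed F F (fun q => single (matalg n) q) s).
- by move=> *; apply: mstarD.
- by move=> *; apply: mstarZ.
- by move=> *; apply: mstarM.
Qed.

Lemma FMs_fold (z : mcar (FM F (matalg n))) : fold (sstar FMs z : mcar (FM F (matalg n))) = mstar (fold z).
Proof.
have [f1 f2 f3] := fold_hom F HM.
have [_ [sD [sZ [sM _]]]] := FMs_valid.
move: z; apply: FM_ind; last by move=> q x; rewrite FMs_copy !fold_copy.
split.
- have z0 : azero = ascale 0 azero :> mcar (FM F (matalg n)).
    by rewrite alg_scaler0 //; apply: FM_alg.
  by rewrite z0 sZ !f2 mstarZ conjC0 !alg_scale0.
- by move=> x y ex ey; rewrite sD !f1 ex ey mstarD.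
- by move=> c x ex; rewrite sZ !f2 ex mstarZ.
- by move=> x y ex ey; rewrite sM !f3 ex ey mstarM.
Qed.

(** With [T] the matrix [l] times the identity plus [fold a], the unital extension takes the value
    [wtrace p] of [mstar T] times [T]. *)
Lemma FMs_state (p : 'I_n -> C) : weights p ->
  rstate (A := FMs) (fun z => wtrace p (fold (z : mcar (FM F (matalg n))))).
Proof.
move=> pw; have fh := fold_hom F HM; have [f1 f2 f3] := fh.
have [tD tZ] := wtrace_lin p.
split; first by apply: lin_comp (wtrace_lin _).
move=> l a; rewrite f3 FMs_fold.
set T := fold _; have := wtrace_pos (aadd (ascale l (munit n)) T) pw.
rewrite mstarD mstarZ mstar1 (alg_mulDl HM) !(alg_mulDr HM) -!(alg_mulZl HM) -!(alg_mulZr HM).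
have e x : amul (munit n) x = x by rewrite /munit /= mul1mx.
have e' x : amul x (munit n) = x by rewrite /munit /= mulmx1.
rewrite !e !e' !tD !tZ /munit (wtrace1 pw) mulr1.
by rewrite !addrA.
Qed.
End MatrixStar.

(** * From nu = 1 to erasing, by positivity *)

Section NuErasing.
Unset Implicit Arguments.
Variables (F : finType) (P : uprod F) (alpha : coeffs F).
Set Implicit Arguments.
Hypotheses (HP : is_uprod P) (Hsym : symmetric_up P) (Hpos : positive_up P).
Hypotheses (Hal : highest_coeffs P alpha) (nu : nu_one alpha).

Lemma nu_erasing : matrix_unit_erasing P.
Proof.
move=> n p Q pw A phi u.
have HM := matalg_is_alg n; have H1 := matalg_is_alg 1.
have vA := FM_valid F HM; have vB := B1_valid F; have lB := delta_lin F.
have fh := fold_hom F HM; have [f1 f2 f3] := fh.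
have lphi : lin phi by apply: lin_comp (wtrace_lin _).
have [tD tZ] := wtrace_lin p; have t1 : wtrace p (munit n) = 1 := wtrace1 pw.
pose G := fsprod (FMs F n) (FMs F 1).
have vG : valid_mfs G := fsprod_mfs (FMs_valid F n) (FMs_valid F 1).
pose Phi : mcar (fprod A (B1 F)) -> C := P A (B1 F) phi (@delta F).
have HPhi : rstate (A := G) Phi.
  exact: (Hpos (FMs_valid F n) (FMs_valid F 1) (FMs_state F pw) (FMs_state F tr1_weights)).
have null := null_vector vG HPhi.
have [[HG _ _] [sD [sZ [sM [sK _]]]]] := vG; have [[lD lZ] _] := HPhi.
have lPhi : lin Phi by split.
pose i1 := inj1 A (B1 F).
have [i1D i1Z i1M] : is_hom i1 := inj1_hom A (B1 F).
have [_ _ i2M] := inj2_hom A (B1 F).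
have [cD cZ cM] := copy_hom (matalg n) Q.
have s1 x : sstar G (i1 x) = i1 (sstar (FMs F n) x) by apply: fsprod_star1; apply: FMs_valid.
have s2 x : sstar G (inj2 A (B1 F) x) = inj2 A (B1 F) (sstar (FMs F 1) x).
  by apply: fsprod_star2; apply: FMs_valid.
have Phi1 x : Phi (i1 x) = phi x by apply: up_res1.
(* The vector [1 - e] of the unitization is null, since its square has value
   [1 - 2 * Phi e + Phi e = 0]. *)
have proj e : sstar G e = e -> amul e e = e -> Phi e = 1 ->
    forall y, Phi (amul y e) = Phi y /\ Phi (amul e y) = Phi y.
  move=> se ee Pe y.
  have [] := null 1 (ascale (-1) e) _ y.
    rewrite sZ se -(alg_mulZl HG) -(alg_mulZr HG) ee !lZ Pe rmorphN1 conjC1.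
    by ring.
  rewrite sZ se -(alg_mulZl HG) -(alg_mulZr HG) !lZ rmorphN1 conjC1 !mul1r !mulN1r.
  by move=> /eqP; rewrite subr_eq0 => /eqP <- /eqP; rewrite subr_eq0 => /eqP <-.
have su : sstar G u = u.
  by rewrite /u s2; congr inj2; rewrite [LHS]FMs_copy mstar1.
have uu : amul u u = u.
  rewrite /u -i2M; congr inj2.
  by have [_ _ h] := copy_hom (matalg 1) Q; rewrite /unit1 -h /= mul1mx.
have Phiu : Phi u = 1 by rewrite /Phi /u up_res2 // delta_unit1.
pose e := i1 (copy Q (munit n)).
have se : sstar G e = e by rewrite /e s1; congr i1; rewrite [LHS]FMs_copy mstar1.
have ee : amul e e = e by rewrite /e -i1M -cM /munit /= mul1mx.
have Phie : Phi e = 1 by rewrite /e Phi1 /phi fold_copy.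
have Pu y := proj u su uu Phiu y; have Pe y := proj e se ee Phie y.
(* [phi] factors through the star homomorphism [fold], so elements of its kernel are null
   vectors. *)
have ker x : fold x = azero -> forall y, Phi (amul y (i1 x)) = 0.
  move=> fx y; have fsx : fold (sstar (FMs F n) x : mcar A) = azero.
    by rewrite FMs_fold fx /mstar /= map_mx0 trmx0.
  have [] := null 0 (i1 x) _ y; last by rewrite mul0r add0r.
  rewrite conjC0 !mul0r !add0r s1 -i1M Phi1 /phi f3 fx alg_mulr0 //.
  exact: (lin0 HM (wtrace_lin p)).
(* With [nu = 1], [nu_formula] equates the values of [b^* u b] and [b^* b]. Since [u] is a
   projection, expanding the square of [u b - b] shows that it is a null vector. *)
have zero_mean T : wtrace p T = 0 ->
    forall y, Phi (amul y (amul u (i1 (copy Q T)))) = Phi (amul y (i1 (copy Q T))).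
  move=> T0 y; set b := i1 _.
  have sb : sstar G b = i1 (copy Q (mstar T)) by rewrite /b s1 -FMs_copy.
  have nuT : Phi (amul (amul (sstar G b) u) b) = phi (amul (copy Q (mstar T)) (copy Q T)).
    have Ts0 : wtrace p (mstar T) = 0 by rewrite wtrace_star // T0 conjC0.
    have := nu_formula HP Hsym Hal Q nu HM (wtrace_lin p) Ts0 T0.
    by rewrite /phi f3 !fold_copy // => <-; rewrite sb.
  have bb : Phi (amul (sstar G b) b) = phi (amul (copy Q (mstar T)) (copy Q T)).
    by rewrite sb -i1M Phi1.
  have [] := null 0 (asub (amul u b) b) _ y.
    rewrite conjC0 !mul0r !add0r /asub sD sZ sM su rmorphN1.
    rewrite (alg_mulDl HG) !(alg_mulDr HG) -!(alg_mulZl HG) -!(alg_mulZr HG).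
    rewrite !lD !lZ (alg_mulA HG) -[amul (amul (amul _ _) _) _](alg_mulA HG).
    rewrite -[amul (amul (sstar G b) u) (amul u b)](alg_mulA HG).
    rewrite [amul u (amul u b)](alg_mulA HG) uu (alg_mulA HG).
    by rewrite nuT bb !mulN1r opprK addrA addrN add0r addNr.
  rewrite mul0r add0r /asub (alg_mulDr HG) -(alg_mulZr HG) lD lZ mulN1r => /eqP.
  by rewrite subr_eq0 => /eqP.
have absorb b y : Phi (amul (amul y u) (i1 b)) = Phi (amul y (i1 b)).
  (* Three parts: one of mean zero in the face [Q] of [u], a multiple of the projection [e] of value
     1, and an element of the kernel of [fold]. *)
  have dec : b = aadd (aadd (copy Q (asub (fold b) (ascale (wtrace p (fold b)) (munit n))))
       (ascale (wtrace p (fold b)) (copy Q (munit n)))) (asub b (copy Q (fold b))).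
    have HA := FM_alg F HM.
    rewrite -cZ -cD /asub -[X in copy Q X](alg_addA HM).
    rewrite [X in copy Q (aadd _ X)](alg_addC HM).
    rewrite (alg_addN HM) (alg_addr0 HM).
    rewrite [X in _ = aadd _ X](alg_addC HA) (alg_addA HA) (alg_addN HA).
    by rewrite (alg_add0 HA).
  set b1 := copy Q _ in dec; set b2 := copy Q _ in dec; set b3 := asub _ _ in dec.
  have z1 : wtrace p (asub (fold b) (ascale (wtrace p (fold b)) (munit n))) = 0.
    by rewrite (linB (wtrace_lin p)) tZ t1 mulr1 subrr.
  have z3 : fold b3 = azero.
    by rewrite /b3 /asub f1 f2 fold_copy // (alg_addN HM).
  clearbody b3; rewrite dec !i1D i1Z !(alg_mulDr HG) -!(alg_mulZr HG) !lD !lZ !(ker b3) //.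
  rewrite -[amul (amul y u) (i1 b1)](alg_mulA HG) zero_mean //.
  have [Pye _] := Pe y; have [Pyue _] := Pe (amul y u); have [Pyu _] := Pu y.
  by rewrite Pye Pyue Pyu.
split.
- by move=> b; have [_] := Pu (i1 b); rewrite -Phi1.
- by move=> c; have [h _] := Pu (i1 c); rewrite -Phi1.
- by move=> c b; rewrite -Phi1 i1M; apply: absorb.
Qed.
End NuErasing.

(** * From erasing to singleton inductivity *)

Lemma eq_preim_partition (T : finType) (rT rT' : eqType) (g : T -> rT) (h : T -> rT') D :
  (forall x y, (g x == g y) = (h x == h y)) -> preim_partition g D = preim_partition h D.
Proof.
move=> e; apply: eq_in_imset => x _; apply/setP => y.
by rewrite !inE /= e.
Qed.

Lemma enum_lift m (s : 'I_m.+1) : enum 'I_m.+1 =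
  map (lift s) (take s (enum 'I_m)) ++ s :: map (lift s) (drop s (enum 'I_m)).
Proof.
apply: (inj_map val_inj); rewrite val_enum_ord map_cat map_cons -!map_comp.
have sm : (s <= m)%N by rewrite -ltnS ltn_ord.
have e (t : seq 'I_m) : map (val \o lift s) t = map (bump s) (map val t) by rewrite -map_comp.
rewrite !e map_take map_drop val_enum_ord take_iota drop_iota (minn_idPl sm) add0n.
have -> : map (bump s) (iota 0 s) = iota 0 s.
  rewrite -[RHS]map_id; apply/eq_in_map => i; rewrite mem_iota add0n /= => lt_is.
  by rewrite /bump leqNgt lt_is.
have -> : map (bump s) (iota s (m - s)) = iota s.+1 (m - s).
  rewrite -[s.+1]add1n iotaDl; apply/eq_in_map => i; rewrite mem_iota => /andP[le_si _].
  by rewrite /bump le_si.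
transitivity (iota 0 (s + (m - s).+1)); first by rewrite addnS subnKC.
by rewrite iotaD.
Qed.

(* Numbers the blocks of pi other than {s} by 0, 1, ..., and {s} comes last. *)
Section BlockIndex.
Variables (m : nat) (pi : {set {set 'I_m.+1}}) (s : 'I_m.+1).
Hypotheses (Hpi : partition pi [set: 'I_m.+1]) (spi : [set s] \in pi).

Let rest := enum (pi :\ [set s]).
Definition block_index (l : 'I_m.+1) : nat := index (pblock pi l) rest.

Let tI : trivIset pi. Proof. by case/and3P: Hpi. Qed.
Let cov l : l \in cover pi. Proof. by have /and3P[/eqP -> _ _] := Hpi; rewrite inE. Qed.
Let pblock_s : pblock pi s = [set s].
Proof. by apply: def_pblock => //; rewrite inE. Qed.

Let rest_mem B : (B \in rest) = (B != [set s]) && (B \in pi).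
Proof. by rewrite mem_enum !inE. Qed.

Lemma pblock_neq l : l != s -> pblock pi l \in rest.
Proof.
move=> ls; rewrite rest_mem pblock_mem ?andbT //; apply: contra ls => /eqP e.
by have := cov l; rewrite -mem_pblock e inE.
Qed.

Lemma block_index_s : block_index s = size rest.
Proof. by apply: memNindex; rewrite pblock_s rest_mem eqxx. Qed.

Lemma block_index_lt l : l != s -> (block_index l < size rest)%N.
Proof. by move=> /pblock_neq; rewrite -index_mem. Qed.

Lemma block_index_eq x y : (block_index x == block_index y) = (pblock pi x == pblock pi y).
Proof.
apply/eqP/eqP => [e|]; last by rewrite /block_index => ->.
have [xs|xs] := eqVneq x s; have [ys|ys] := eqVneq y s; first by rewrite xs ys.
- by have := block_index_lt ys; rewrite -e xs block_index_s ltnn.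
- by have := block_index_lt xs; rewrite e ys block_index_s ltnn.
rewrite -(nth_index set0 (pblock_neq xs)) -(nth_index set0 (pblock_neq ys)).
by congr nth.
Qed.

Lemma block_index_onto k : (k < size rest)%N -> exists2 l, l != s & block_index l = k.
Proof.
move=> ks; have := mem_nth set0 ks; set B := nth set0 rest k.
rewrite rest_mem => /andP[Bs Bpi].
have /set0Pn [l lB] : B != set0 by apply: contraTneq Bpi => ->; case/and3P: Hpi.
have e := def_pblock tI Bpi lB.
exists l; first by apply: contra Bs => /eqP ls; rewrite -e ls pblock_s.
by rewrite /block_index e /B index_uniq // enum_uniq.
Qed.

Lemma preim_block_index : preim_partition block_index [set: 'I_m.+1] = pi.
Proof.
rewrite -[RHS](preim_partition_pblock Hpi).
by apply: eq_preim_partition => x y; apply: block_index_eq.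
Qed.

Lemma preim_block_index_lift :
  preim_partition (fun l => block_index (lift s l)) [set: 'I_m] =
  [set (lift s) @^-1: B | B : {set 'I_m.+1} in pi & B != [set s]].
Proof.
have cl x : [set y in [set: 'I_m] | block_index (lift s x) == block_index (lift s y)] =
    lift s @^-1: pblock pi (lift s x).
  by apply/setP => y; rewrite !inE block_index_eq eq_pblock.
apply/setP => D; apply/imsetP/imsetP => [[x _ ->]|[B]].
  exists (pblock pi (lift s x)); last exact: cl.
  have := pblock_neq (l := lift s x); rewrite rest_mem inE andbC; apply.
  by rewrite eq_sym neq_lift.
rewrite inE => /andP[Bpi Bs] ->.
have /set0Pn [z zB] : B != set0 by apply: contraTneq Bpi => ->; case/and3P: Hpi.
have eB := def_pblock tI Bpi zB.
have [x zx|zs] := unliftP s z; last by move: Bs; rewrite -eB zs pblock_s eqxx.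
by exists x => //; rewrite -eB zx; apply/esym/cl.
Qed.

Lemma size_rest_gt0 : (0 < m)%N -> (0 < size rest)%N.
Proof.
move=> m0; have := block_index_lt (l := lift s (Ordinal m0)).
by rewrite eq_sym neq_lift => /(_ isT); apply: leq_trans.
Qed.
End BlockIndex.

Section Iterated.
Unset Implicit Arguments.
Variables (F : finType) (P : uprod F).
Set Implicit Arguments.
Hypothesis HP : is_uprod P.
Unset Implicit Arguments.
Variables (A : nat -> mfalg F).
Set Implicit Arguments.
Hypothesis HA : forall k, valid_mf (A k).

Lemma iprod_valid m : valid_mf (iprod A m).
Proof. by elim: m => //= m IH; apply: fprod_valid. Qed.

Lemma iphi_lin (phi : forall k, mcar (A k) -> C) m :
  (forall k, lin (phi k)) -> lin (iphi P phi m).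
Proof.
by move=> Hp; elim: m => //= m IH; apply: up_lin => //; apply: iprod_valid.
Qed.

Lemma eq_iphi (phi psi : forall k, mcar (A k) -> C) m :
  (forall k, (k <= m)%N -> phi k = psi k) -> iphi P phi m = iphi P psi m.
Proof.
elim: m => [|m IH] e /=; first exact: e.
by rewrite IH => [|k km]; [rewrite e|apply: e; apply: leqW].
Qed.

Lemma emb_last m x : emb A m.+1 m.+1 x = inj2 (iprod A m) (A m.+1) x.
Proof.
rewrite /=; case: PeanoNat.Nat.eq_dec => // e.
by rewrite (eq_irrelevance e (erefl _)).
Qed.

Lemma emb_lt m k x : (k <= m)%N -> emb A m.+1 k x = inj1 (iprod A m) (A m.+1) (emb A m k x).
Proof.
move=> km /=; case: PeanoNat.Nat.eq_dec => // e.
by exfalso; move: km; rewrite e ltnn.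
Qed.

Lemma emb_face m k Q x : (k <= m)%N -> face (A k) Q x -> face (iprod A m) Q (emb A m k x).
Proof.
elim: m => [|m IH] km Fx; first by case: k km x Fx.
move: km; rewrite leq_eqVlt => /orP[/eqP e|]; last rewrite ltnS => km.
  subst k; rewrite emb_last.
  by have [_ h] := inj2_mfhom (iprod A m) (A m.+1); apply: h.
rewrite emb_lt //; have [_ h] := inj1_mfhom (iprod A m) (A m.+1); apply: h.
exact: IH.
Qed.
End Iterated.

Section SingletonInductive.
Unset Implicit Arguments.
Variables (F : finType) (P : uprod F) (alpha : coeffs F).
Set Implicit Arguments.
Hypotheses (HP : is_uprod P) (Hsym : symmetric_up P) (Hal : highest_coeffs P alpha).

Let A (_ : nat) : mfalg F := B1 F.
Let vA k : valid_mf (A k) := B1_valid F.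

Lemma delta_units T (f : T -> F) (s : seq T) : s <> [::] ->
  delta (lprod (map (fun l => unit1 (f l)) s)) = 1.
Proof.
have HM := matalg_is_alg 1; case: s => // x s _.
rewrite /delta (hom_lprodn _ (FM_alg F HM) HM (fold_hom F HM)) -map_comp.
have -> : map (fold (F := F) \o (fun l => unit1 (f l))) (x :: s) = nseq (size s).+1 (munit 1).
  by elim: s x => [|y s IH] x /=; rewrite /unit1 fold_copy //; congr cons; apply: IH.
have -> : lprod (nseq (size s).+1 (munit 1)) = munit 1.
  elim: (size s) => // k IH; rewrite [nseq _ _]/= (lprod_cons HM) -[_ :: nseq _ _]/(nseq k.+1 _) IH.
  by rewrite /munit /= mul1mx.
exact: (wtrace1 tr1_weights).
Qed.

(** Evaluation at units of [B1] turns every factor of the product over the blocks into 1, which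
    isolates the coefficient. *)
Lemma alpha_dmix k n (f : 'I_n -> F) (b : 'I_n -> nat) :
  (0 < k)%N -> (forall l, (b l < k)%N) -> (forall i, (i < k)%N -> exists l, b l = i) ->
  alpha n f (preim_partition b [set: 'I_n]) =
  dmix k (fun t => iphi P (fun i (y : mcar (A i)) => t i * delta y) k.-1
           (lprod [seq emb A k.-1 (b l) (unit1 (f l)) | l <- enum 'I_n])).
Proof.
move=> k0 bk onto.
rewrite (Hal (A := A) (phi := fun _ => @delta F) (f := f) (x := fun _ l => unit1 (f l))) //.
- rewrite big1 ?mulr1 // => i _; apply: delta_units.
  have [l /eqP bl] := onto i (ltn_ord i) => e.
  have : l \in [seq l <- enum 'I_n | b l == i] by rewrite mem_filter bl mem_enum.
  by rewrite e.
- by move=> i _; apply: delta_lin.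
- by move=> l; apply: copy_face.
Qed.

Lemma alpha_one n (f : 'I_n.+1 -> F) : alpha n.+1 f [set [set: 'I_n.+1]] = 1.
Proof.
have -> : [set [set: 'I_n.+1]] = preim_partition (fun _ => 0%N) [set: 'I_n.+1].
  apply/setP => B; rewrite inE; apply/eqP/imsetP => [->|[x _ ->]].
    by exists ord0 => //; apply/setP => y; rewrite !inE.
  by apply/setP => y; rewrite !inE.
rewrite (@alpha_dmix 1) //; last by case=> // _; exists ord0.
have -> : (fun t : nat -> C => iphi P (fun i (y : mcar (A i)) => t i * delta y) 1.-1
    (lprod [seq emb A 1.-1 0 (unit1 (f l)) | l <- enum 'I_n.+1])) = (fun t => t 0%N * 1).
  apply/funext => t /=; rewrite delta_units // => e.
  by have := size_enum_ord n.+1; rewrite e.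
by rewrite dmix_last.
Qed.

Lemma erasing_singleton_inductive : matrix_unit_erasing P -> singleton_inductive alpha.
Proof.
move=> MP m f pi s m0 Hpi spi.
(* Numbering the block of [s] last makes its factor the outermost one of [iprod] and its derivative
   the outermost one of [dmix]. *)
rewrite -{1}(preim_block_index Hpi spi) -(preim_block_index_lift Hpi spi).
pose rest := enum (pi :\ [set s]); pose b := block_index pi s.
have bs : b s = size rest := block_index_s Hpi spi.
have bl l : l != s -> (b l < size rest)%N := block_index_lt Hpi (l := l).
have onto k : (k < size rest)%N -> exists2 l, l != s & b l = k.
  exact: (block_index_onto Hpi spi).
have r0 : (0 < size rest)%N := size_rest_gt0 s Hpi m0.
rewrite -/b; case: (size rest) bs bl onto r0 => // k bs bl onto _.
have lifts (l : 'I_m) : lift s l != s by rewrite eq_sym neq_lift.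
have bk l : (b l < k.+2)%N.
  by have [->|ls] := eqVneq l s; rewrite ?bs // ltnS ltnW // bl.
have bonto i : (i < k.+2)%N -> exists l, b l = i.
  rewrite ltnS leq_eqVlt => /orP[/eqP ->|ik]; first by exists s.
  by have [l _ e] := onto i ik; exists l.
have bl' (l : 'I_m) : (b (lift s l) < k.+1)%N := bl _ (lifts l).
have bonto' i : (i < k.+1)%N -> exists l : 'I_m, b (lift s l) = i.
  move=> ik; have [l ls <-] := onto i ik.
  by have [j e|e] := unliftP s l; [exists j; rewrite -e|rewrite e eqxx in ls].
apply: (etrans (alpha_dmix f (ltn0Sn k.+1) bk bonto)).
apply: (etrans _ (esym (alpha_dmix (fun l => f (lift s l)) (ltn0Sn k) bl' bonto'))).
apply: (etrans _ (dmix_last _)); last first.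
  move=> u t; congr (_ _); apply: eq_iphi => i ik; apply/funext => y.
  by case: eqP ik => // ->; rewrite ltnn.
congr (dmix _ _); apply/funext => t.
have lt i : lin (fun y : mcar (A i) => t i * delta y) by apply: lin_scale; apply: delta_lin.
rewrite [k.+2.-1]/= (enum_lift s) map_cat map_cons bs emb_last.
have e (v : seq 'I_m) : map (fun l => emb A k.+1 (b l) (unit1 (f l))) (map (lift s) v) =
    map (inj1 (iprod A k) (A k.+1))
      (map (fun l => emb A k (b (lift s l)) (unit1 (f (lift s l)))) v).
  rewrite -!map_comp; apply: eq_map => l.
  exact: (@emb_lt F A k (b (lift s l)) (unit1 (f (lift s l))) (bl' l)).
pose w := map (fun l => emb A k (b (lift s l)) (unit1 (f (lift s l)))) (enum 'I_m).
pose phi := iphi P (fun i (y : mcar (A i)) => t i * delta y) k.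
have lphi : lin phi := iphi_lin HP vA k lt.
have vk : valid_mf (iprod A k) := iprod_valid vA k.
have Fw : Forallp (@in_faces F (iprod A k)) w.
  apply/Forallp_map/Forallp_all => l; exists (f (lift s l)).
  by apply: emb_face; [exact: bl'|exact: copy_face].
have ne : w <> [::].
  by move=> /(congr1 size); rewrite size_map size_enum_ord /= => e0; rewrite e0 in m0.
have ws : w = take s w ++ drop s w by rewrite cat_take_drop.
rewrite ws in ne Fw; rewrite !e !map_take !map_drop -/w -map_take -map_drop.
(* Erasing the letter at [s] extracts its value, the variable [t k.+1], in front of the product over
   the other blocks. *)
have := insert_word HP Hsym MP vk (vA k.+1) lphi (lt k.+1) (copy_face (f s) (munit 1)) ne Fw.
by rewrite -ws delta_unit1 mulr1.
Qed.

(** Removing the middle point leaves a single block of two points, whose coefficient is 1 by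
    [alpha_one] for any faces. *)
Lemma singleton_inductive_nu : singleton_inductive alpha -> nu_one alpha.
Proof.
move=> SI Q f _; rewrite (SI 2%N f pi_13_2 (inord 1)) //.
- have v1 : (inord 1 : 'I_3) = 1%N :> nat by rewrite inordK.
  rewrite -(alpha_one (fun l : 'I_2 => f (lift (inord 1) l))); congr (alpha _ _ _).
  apply/setP => D; rewrite inE; apply/imsetP/eqP => [[B]|->].
    rewrite !inE => /andP[/orP[]/eqP-> h ->]; last by rewrite eqxx in h.
    apply/setP => x; rewrite !inE -!val_eqE /= v1 !inordK //.
    by case: x => -[|[|]].
  exists [set inord 0; inord 2].
    rewrite !inE eqxx /=; apply/eqP => /setP /(_ (inord 0)).
    by rewrite !inE -!val_eqE /= v1 !inordK.
  apply/setP => x; rewrite !inE -!val_eqE /= v1 !inordK //.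
  by case: x => -[|[|]].
- rewrite -preim_13_2; exact: preim_partitionP.
- by rewrite !inE eqxx orbT.
Qed.

End SingletonInductive.

Theorem theorem9p7 (F : finType) (P : uprod F) (alpha : coeffs F) :
  is_uprod P -> symmetric_up P -> positive_up P -> highest_coeffs P alpha ->
  (unit_preserving P <-> nu_one alpha) /\ (nu_one alpha <-> singleton_inductive alpha).
Proof.
move=> HP Hsym Hpos Hal.
have e2 : nu_one alpha -> matrix_unit_erasing P := nu_erasing HP Hsym Hpos Hal.
have e3 := erasing_singleton_inductive HP Hsym Hal.
have e4 := singleton_inductive_nu Hal.
split; split.
- by move=> /(unit_preserving_erasing HP) /e3.
- by move=> /e2 /(erasing_unit_preserving HP Hsym).
- by move=> /e2 /e3.
- exact: e4.
Qed.
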